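(* Let $n\in\mathbb{N}$ with $n\ge 2$ and let $\boldsymbol{\alpha}=(\alpha_1,\ldots,\alpha_n)\in\mathbb{R}^n$ with $\alpha_k\notin\pi\mathbb{Z}$ for every $k\in\{1,\ldots,n\}$. Then for every $f\in\mathscr{S}(\mathbb{R}^n)$, $$f=I_1^{\boldsymbol{\alpha}}\left(\sum_{j=1}^n R_j^{\boldsymbol{\alpha}}\left(e_{-\boldsymbol{\alpha}}\,\partial_j(e_{\boldsymbol{\alpha}}f)\right)\right)=\sum_{j=1}^n I_1^{\boldsymbol{\alpha}}\left(R_j^{\boldsymbol{\alpha}}\left(e_{-\boldsymbol{\alpha}}\,\partial_j(e_{\boldsymbol{\alpha}}f)\right)\right)\quad\text{in }\mathscr{S}'(\mathbb{R}^n).$$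
   Context: $\mathscr{S}(\mathbb{R}^n)$ is the space of (complex-valued) Schwartz functions, $\mathscr{S}'(\mathbb{R}^n)$ the space of tempered distributions, and $\partial_j$ the partial derivative in the $j$th variable. Let $\boldsymbol{\alpha}=(\alpha_1,\ldots,\alpha_n)\in\mathbb{R}^n$ with $\alpha_k\notin\pi\mathbb{Z}$ for all $k$. Chirp function: $e_{\boldsymbol{\alpha}}(\boldsymbol{x}):=e^{2\pi i\sum_{k=1}^n a(\alpha_k)x_k^2}$ with $a(\alpha_k):=\frac{\cot(\alpha_k)}{2}$. The $j$th fractional Riesz transform related to chirp functions ($j\in\{1,\ldots,n\}$): for $g\in\mathscr{S}(\mathbb{R}^n)$ and $\boldsymbol{x}\in\mathbb{R}^n$, $$R_j^{\boldsymbol{\alpha}}(g)(\boldsymbol{x}):=c_n\,e_{-\boldsymbol{\alpha}}(\boldsymbol{x})\ \mathrm{p.v.}\int_{\mathbb{R}^n}\frac{x_j-y_j}{|\boldsymbol{x}-\boldsymbol{y}|^{n+1}}g(\boldsymbol{y})e_{\boldsymbol{\alpha}}(\boldsymbol{y})\,d\boldsymbol{y},\qquad c_n:=\frac{\Gamma(\frac{n+1}{2})}{\pi^{\frac{n+1}{2}}}.$$ Fractional Riesz potential related to chirp functions: for $\beta\in(0,n)$, $$I_\beta^{\boldsymbol{\alpha}}(g)(\boldsymbol{x}):=\frac{1}{\gamma(\beta)}e_{-\boldsymbol{\alpha}}(\boldsymbol{x})\int_{\mathbb{R}^n}\frac{g(\boldsymbol{y})}{|\boldsymbol{x}-\boldsymbol{y}|^{n-\beta}}e_{\boldsymbol{\alpha}}(\boldsymbol{y})\,d\boldsymbol{y},\qquad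 \gamma(\beta):=\frac{\pi^{n/2}2^\beta\Gamma(\beta/2)}{\Gamma((n-\beta)/2)},$$ and $I_1^{\boldsymbol{\alpha}}$ is the case $\beta=1$. It is defined for Schwartz $g$, and applied by the same integral formula to the functions $R_j^{\boldsymbol{\alpha}}(\cdots)$ (not necessarily Schwartz) occurring here. *)

(* Defs.v *)
From HB Require Import structures.
From mathcomp Require Import all_boot all_order all_algebra.
From mathcomp Require Import complex.
From mathcomp Require Import all_classical all_reals all_analysis.

Set Implicit Arguments.
Unset Strict Implicit.
Unset Printing Implicit Defensive.
Import Order.TTheory GRing.Theory Num.Theory.
Import numFieldNormedType.Exports.

Local Open Scope classical_set_scope.
Local Open Scope complex_scope.
Local Open Scope ring_scope.

(* Points of R^n are row vectors; the library norm on row vectors is the sup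
   norm, so the Euclidean norm is defined below.  The library has no normed
   R-module structure on R[i], so limits, derivatives and integrals of
   complex-valued functions are taken componentwise. *)

(* Lebesgue measure on the Borel sets of R^n, as an iterated product measure.
   It lives on n-tuples, which (unlike row vectors) carry the product
   sigma-algebra in the library; see lebesgue_tuple_box for its values on
   boxes. *)
Section lebesgue_tuple.
Context {R : realType}.

Local Notation RT := (measurableTypeR R).

Section lebesgueS.
Variables (n : nat) (m : {sigma_finite_measure set (n.-tuple RT) -> \bar R}).

Definition consp (p : RT * n.-tuple RT) : n.+1.-tuple RT :=
  [tuple of p.1 :: p.2].

Lemma measurable_consp : measurable_fun setT consp.
Proof.
apply: measurable_cons; first exact: measurable_fst.
exact: measurable_snd.
Qed.

Definition lebesgueS : set (n.+1.-tuple RT) -> \bar R :=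
  pushforward (lebesgue_measure \x m)%E consp.

Let preim A : measurable A -> measurable (consp @^-1` A).
Proof. by move=> mA; rewrite -[X in measurable X]setTI; exact: measurable_consp. Qed.

Let lebesgueS0 : lebesgueS set0 = 0%E.
Proof. by rewrite /lebesgueS /pushforward preimage_set0 measure0. Qed.

Let lebesgueS_ge0 A : (0 <= lebesgueS A)%E.
Proof. by rewrite /lebesgueS /pushforward measure_ge0. Qed.

Let lebesgueS_sigma_additive : semi_sigma_additive lebesgueS.
Proof.
move=> F mF tF mUF; rewrite /lebesgueS /pushforward preimage_bigcup.
apply: measure_semi_sigma_additive.
- by move=> k; exact: preim.
- apply/trivIsetP => /= i j _ _ ij; rewrite -preimage_setI.
  by move/trivIsetP : tF => /(_ _ _ _ _ ij) ->//; rewrite preimage_set0.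
- by rewrite -preimage_bigcup; exact: preim.
Qed.

HB.instance Definition _ := isMeasure.Build _ _ _ lebesgueS
  lebesgueS0 lebesgueS_ge0 lebesgueS_sigma_additive.

Let lebesgueS_sigma_finite : sigma_finite setT lebesgueS.
Proof.
have /sigma_finiteP[F [TF ndF Foo]] :=
  sigma_finiteT (lebesgue_measure : {sigma_finite_measure set RT -> \bar R}).
have /sigma_finiteP[G [TG ndG Goo]] := sigma_finiteT m.
pose uncons (t : n.+1.-tuple RT) : RT * n.-tuple RT :=
  (thead t, [tuple of behead t]).
have conspK : uncons \o consp = id.
  apply/funext => -[x t]; rewrite /uncons /consp /=.
  by congr pair; exact/val_inj.
have muncons : measurable_fun setT uncons.
  apply: measurable_fun_pair; first exact: measurable_tnth.
  exact: measurable_behead.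
exists (fun k => uncons @^-1` (F k `*` G k)) => [|k].
  apply/esym; rewrite -subTset => t _.
  have [i _ Fi] : (\bigcup_i F i) (uncons t).1 by rewrite -TF.
  have [j _ Gj] : (\bigcup_i G i) (uncons t).2 by rewrite -TG.
  exists (maxn i j) => //; split.
  - by move: Fi; exact/subsetPset/ndF/leq_maxl.
  - by move: Gj; exact/subsetPset/ndG/leq_maxr.
have [mF Fk] := Foo k; have [mG Gk] := Goo k; split.
  rewrite -[X in measurable X]setTI; apply: muncons => //.
  exact: measurableX.
rewrite /lebesgueS /pushforward -comp_preimage conspK preimage_id.
by rewrite product_measure1E// lte_mul_pinfty// ge0_fin_numE.
Qed.

HB.instance Definition _ := @Measure_isSigmaFinite.Build _ _ _ lebesgueS
  lebesgueS_sigma_finite.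

End lebesgueS.

Fixpoint lebesgue_tuple (n : nat) :
    {sigma_finite_measure set (n.-tuple RT) -> \bar R} :=
  match n with
  | 0 => \d_([tuple] : 0.-tuple RT)
  | k.+1 => lebesgueS (lebesgue_tuple k)
  end.

End lebesgue_tuple.

Lemma lebesgue_tuple_box (R : realType) (n : nat)
    (A : 'I_n -> set (measurableTypeR R)) :
  (forall i, measurable (A i)) ->
  lebesgue_tuple n [set t | forall i, A i (tnth t i)] =
  (\prod_(i < n) lebesgue_measure (A i))%E.
Proof.
elim: n A => [|n IH] A mA.
  by rewrite big_ord0 /= diracE mem_set//= => -[].
rewrite big_ord_recl -IH//= /lebesgueS /pushforward -product_measure1E//.
  congr product_measure1; apply/seteqP; split=> [[x t]/= H|[x t]/= [H0 H] i].
    by split=> [|i]; [exact: (H ord0)|have := H (lift ord0 i); rewrite tnthS].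
  by have [j ->|->] := unliftP ord0 i; rewrite ?tnthS.
rewrite (_ : [set _ | _] = \bigcap_(i in [set: 'I_n])
    ((@tnth _ _)^~ i @^-1` A (lift ord0 i))); last first.
  by apply/seteqP; split=> [t H i _|t H i]; [exact: H|exact: (H i)].
apply: fin_bigcap_measurable => // i _.
by rewrite -[X in measurable X]setTI; exact: measurable_tnth.
Qed.

Section euclidean.
Context {R : realType} {n : nat}.
Implicit Types (x y : 'rV[R]_n) (D : set 'rV[R]_n) (u : 'rV[R]_n -> R[i]).

Definition enorm x : R := Num.sqrt (\sum_(j < n) x ord0 j ^+ 2).

Definition rV_of_tuple (t : n.-tuple (measurableTypeR R)) : 'rV[R]_n :=
  \row_j tnth t j.

(* Cintegrable and Cintegral: (absolute) integrability on D and the integral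
   over D, with respect to Lebesgue measure transported to row vectors. *)
Definition Cintegrable D u : Prop :=
  (lebesgue_tuple n).-integrable (rV_of_tuple @^-1` D)
    (fun t => (complex.Re (u (rV_of_tuple t)))%:E) /\
  (lebesgue_tuple n).-integrable (rV_of_tuple @^-1` D)
    (fun t => (complex.Im (u (rV_of_tuple t)))%:E).

Definition Cintegral D u : R[i] :=
  (\int[lebesgue_tuple n]_(t in rV_of_tuple @^-1` D)
     complex.Re (u (rV_of_tuple t))) +i*
  (\int[lebesgue_tuple n]_(t in rV_of_tuple @^-1` D)
     complex.Im (u (rV_of_tuple t))).

(* Principal value at x: limit, as eps -> 0+, of the integrals over the
   complements of the closed Euclidean balls of radius eps around x. *)
Definition pv_trunc x u (eps : R) : R[i] :=
  Cintegral [set y | eps < enorm (x - y)] u.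

Definition pv_exists x u : Prop :=
  [/\ forall eps : R, 0 < eps -> Cintegrable [set y | eps < enorm (x - y)] u,
      cvg (complex.Re (pv_trunc x u eps) @[eps --> 0^'+]) &
      cvg (complex.Im (pv_trunc x u eps) @[eps --> 0^'+])].

Definition pv_integral x u : R[i] :=
  lim (complex.Re (pv_trunc x u eps) @[eps --> 0^'+]) +i*
  lim (complex.Im (pv_trunc x u eps) @[eps --> 0^'+]).

Definition partial (j : 'I_n) u x : R[i] :=
  'D_(delta_mx ord0 j) (@complex.Re R \o u) x +i*
  'D_(delta_mx ord0 j) (@complex.Im R \o u) x.

(* Iterated partial derivatives: the multi-index is given by a list of the
   variables of derivation. *)
Definition partials (s : seq 'I_n) u : 'rV[R]_n -> R[i] := foldr partial u s.

Definition smooth u : Prop :=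
  forall s : seq 'I_n,
    [/\ continuous (@complex.Re R \o partials s u),
        continuous (@complex.Im R \o partials s u) &
        forall (j : 'I_n) x,
          derivable (@complex.Re R \o partials s u) x (delta_mx ord0 j) /\
          derivable (@complex.Im R \o partials s u) x (delta_mx ord0 j)].

Definition monomial (a : 'I_n -> nat) x : R := \prod_(j < n) x ord0 j ^+ a j.

Definition schwartz u : Prop :=
  smooth u /\
  forall (a : 'I_n -> nat) (s : seq 'I_n), exists M : R,
    forall x, `|monomial a x| * Normc.normc (partials s u x) <= M.

Definition schwartz_norm (N : nat) u : R :=
  sup [set r | exists (a : 'I_n -> nat) (s : seq 'I_n) x,
    [/\ (\sum_(j < n) a j <= N)%N, (size s <= N)%N &
        r = `|monomial a x| * Normc.normc (partials s u x)]].

(* The values of T outside the Schwartz space are irrelevant. *)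
Definition tempered_distribution (T : ('rV[R]_n -> R[i]) -> R[i]) : Prop :=
  (forall (c : R[i]) phi psi, schwartz phi -> schwartz psi ->
     T (fun x => c * phi x + psi x) = c * T phi + T psi) /\
  (exists (N : nat) (C : R), forall phi, schwartz phi ->
     Normc.normc (T phi) <= C * schwartz_norm N phi).

Definition distr_of u (phi : 'rV[R]_n -> R[i]) : R[i] :=
  Cintegral setT (fun x => u x * phi x).

Definition tempered_function u : Prop :=
  (forall phi, schwartz phi -> Cintegrable setT (fun x => u x * phi x)) /\
  tempered_distribution (distr_of u).

(* Equality in S'(R^n) of (the distributions induced by) two functions. *)
Definition eq_tempered u v : Prop :=
  [/\ tempered_function u, tempered_function v &
      forall phi, schwartz phi -> distr_of u phi = distr_of v phi].

End euclidean.

Section fractional_operators.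
Context {R : realType} {n : nat}.
Implicit Types (alpha x y : 'rV[R]_n) (beta : R) (g : 'rV[R]_n -> R[i]).

(* Euler's Gamma function, for positive arguments. *)
Definition Gamma (s : R) : R :=
  \int[lebesgue_measure]_(t in `]0%R, +oo[) (t `^ (s - 1) * expR (- t)).

Definition chirp_coef (a : R) : R := cos a / sin a / 2.

Definition chirp alpha x : R[i] :=
  let theta := 2 * pi * \sum_(k < n) chirp_coef (alpha ord0 k) * x ord0 k ^+ 2 in
  cos theta +i* sin theta.

Definition riesz_const : R :=
  Gamma (n.+1%:R / 2) / pi `^ (n.+1%:R / 2).

Definition riesz_integrand alpha (j : 'I_n) g x y : R[i] :=
  ((x ord0 j - y ord0 j) / enorm (x - y) ^+ n.+1)%:C * g y * chirp alpha y.

Definition frac_riesz_exists alpha (j : 'I_n) g x : Prop :=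
  pv_exists x (riesz_integrand alpha j g x).

(* Meaningful at the points where frac_riesz_exists holds. *)
Definition frac_riesz alpha (j : 'I_n) g x : R[i] :=
  riesz_const%:C * chirp (- alpha) x *
  pv_integral x (riesz_integrand alpha j g x).

Definition riesz_gamma beta : R :=
  pi `^ (n%:R / 2) * 2 `^ beta * Gamma (beta / 2) / Gamma ((n%:R - beta) / 2).

Definition potential_integrand alpha beta g x y : R[i] :=
  g y / (enorm (x - y) `^ (n%:R - beta))%:C * chirp alpha y.

Definition frac_potential_exists alpha beta g x : Prop :=
  Cintegrable setT (potential_integrand alpha beta g x).

(* Meaningful for 0 < beta < n, at the points where frac_potential_exists
   holds. *)
Definition frac_potential alpha beta g x : R[i] :=
  (riesz_gamma beta)^-1%:C * chirp (- alpha) x *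
  Cintegral setT (potential_integrand alpha beta g x).

(* The argument of the j-th Riesz transform: e_{-alpha} d_j (e_alpha f). *)
Definition chirp_partial alpha (j : 'I_n) (f : 'rV[R]_n -> R[i]) x : R[i] :=
  chirp (- alpha) x * partial j (fun y => chirp alpha y * f y) x.

End fractional_operators.

(* Main.v *)
(* Put h = chirp alpha * f.  The chirps cancel inside the operators, so the
   theorem amounts to h = I_1 (sum_j R_j d_j h) for the classical Riesz
   transforms and the classical Riesz potential of order 1, for the real and
   imaginary parts of h separately; this is proved without Fourier transform,
   by subordination to Gaussians.  Let N_a be the Gaussian density on R^n with
   standard deviation |a| and kap = (2 pi)^(-1/2).  Euler's integral gives
     |w|^(1-n) / gamma(1) = kap * int_R N_a(w) da,
     c_n w_j / |w|^(n+1) = - kap * int_R (d_j N_a)(w) da.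
   Symmetrizing around x and integrating by parts, the second formula yields
   R_j d_j h (x) = - kap * int_R (N_a * d_j^2 h)(x) da, and then, since
   N_a * N_b = N_s with s = (a^2 + b^2)^(1/2), the first one yields
     I_1 R_j d_j h (x) = - kap^2 * int_R int_R (N_s * d_j^2 h)(x) da db.
   In the coordinates (a, b) = (b r, b) the double integral factors as pi times
   int_R |b| (N_b * d_j^2 h)(x) db.  Finally b * sum_j N_b * d_j^2 h is the
   derivative of N_b * h in b, which goes from h (x) at b = 0 to 0 at infinity,
   so that the last integrals add up to - 2 h (x). *)

(* R_j d_j h need not be a Schwartz function, so each exchange of integrals must be justified by
   absolute convergence. The majorant is always a multiple of 1 / (1 + a^2) in each Gaussian
   parameter a. For |a| at most 1 the derivatives stay on h; for |a| at least 1 they are moved to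
   the Gaussian, which gains a factor a^-2. The dimension enters through N_a <= |a|^-n <= a^-2 for
   |a| at least 1; this makes the potential converge and compensates the weight |b| of the last
   integral. The parameters run over all of R, so that the coordinates (b r, b) only call for two
   linear dilations; the density left in r is 1 / (1 + r^2), whose integral is the factor pi. The
   individual terms I_1 R_j d_j h have no simple value: only the full Laplacian is a derivative in
   b, so the sum over j must be taken before integrating in b. Evenness in b doubles the half-line
   value - h (x), and kap^2 = 1 / (2 pi) turns - kap^2 * pi * (- 2 h (x)) into h (x). The identity
   thus holds at every point, and equality in S' follows. *)
From HB Require Import structures.
Require Import Defs.
From mathcomp Require Import all_boot all_order all_algebra.
From mathcomp Require Import complex.
From mathcomp Require Import all_classical all_reals all_analysis.
From mathcomp Require Import measurable_realfun.
From mathcomp Require Import ring lra.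
Set Implicit Arguments.
Unset Strict Implicit.
Unset Printing Implicit Defensive.
Import Order.TTheory GRing.Theory Num.Theory.
Import numFieldNormedType.Exports.
Local Open Scope classical_set_scope.
Local Open Scope ring_scope.

(** * Integrals of real-valued functions *)

Section real_integrals.
Context d (T : measurableType d) (R : realType).
Variable mu : {measure set T -> \bar R}.
Implicit Types f g : T -> R.

Definition summable_fun f := mu.-integrable [set: T] (EFin \o f).

Lemma summable_measurable f : summable_fun f -> measurable_fun [set: T] f.
Proof. by move=> /measurable_int/measurable_EFinP. Qed.

Lemma summable_le f g : measurable_fun [set: T] f ->
  (forall x, `|f x| <= g x) -> summable_fun g -> summable_fun f.
Proof.
move=> mf fg; apply: le_integrable => //; first exact/measurable_EFinP.
by move=> x _ /=; rewrite lee_fin (le_trans (fg x))// ler_norm.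
Qed.

Lemma summable_norm f : summable_fun f -> summable_fun (fun x => `|f x|).
Proof. by move=> /integrable_norm. Qed.

Lemma summable_funD f g : summable_fun f -> summable_fun g ->
  summable_fun (fun x => f x + g x).
Proof. by move=> sf sg; exact: (integrableD _ sf sg). Qed.

Lemma summable_funB f g : summable_fun f -> summable_fun g ->
  summable_fun (fun x => f x - g x).
Proof. by move=> sf sg; exact: (integrableB _ sf sg). Qed.

Lemma summable_funZ c f : summable_fun f -> summable_fun (fun x => c * f x).
Proof. by move=> sf; exact: (integrableZl _ c sf). Qed.

Lemma summable_sum (I : Type) (s : seq I) (F : I -> T -> R) :
  (forall i, summable_fun (F i)) -> summable_fun (fun x => \sum_(i <- s) F i x).
Proof.
move=> sF; elim: s => [|i s IH].
  under eq_fun do rewrite big_nil; exact: integrable0.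
by under eq_fun do rewrite big_cons; exact: summable_funD.
Qed.

Lemma summable_Mbounded f g C : measurable_fun [set: T] f ->
  (forall x, `|f x| <= C) -> summable_fun g -> summable_fun (fun x => f x * g x).
Proof.
move=> mf fC sg; apply: (@summable_le _ (fun x => C * `|g x|)).
- by apply: measurable_funM => //; exact: summable_measurable.
- by move=> x; rewrite normrM ler_wpM2r.
- exact/summable_funZ/summable_norm.
Qed.

Lemma Rintegral_sum (I : Type) (s : seq I) (F : I -> T -> R) :
  (forall i, summable_fun (F i)) ->
  \int[mu]_x (\sum_(i <- s) F i x) = \sum_(i <- s) \int[mu]_x F i x.
Proof.
move=> sF; elim: s => [|i s IH].
  by under eq_Rintegral do rewrite big_nil; rewrite Rintegral_cst// mul0r big_nil.
under eq_Rintegral do rewrite big_cons.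
by rewrite RintegralD// ?IH ?big_cons//; [exact: sF|exact: summable_sum].
Qed.

Lemma Rintegral_le f g : summable_fun f -> summable_fun g ->
  (forall x, f x <= g x) -> \int[mu]_x f x <= \int[mu]_x g x.
Proof. by move=> sf sg fg; apply: le_Rintegral => // x _; exact: fg. Qed.

Lemma Rintegral_norm_le f g : summable_fun f -> summable_fun g ->
  (forall x, `|f x| <= g x) -> `|\int[mu]_x f x| <= \int[mu]_x g x.
Proof.
move=> sf sg fg; apply: (le_trans (le_normr_Rintegral measurableT sf)).
by apply: Rintegral_le => //; exact: summable_norm.
Qed.

Lemma EFin_Rintegral f : summable_fun f ->
  (\int[mu]_x f x)%:E = (\int[mu]_x (f x)%:E)%E.
Proof. by move=> sf; rewrite fineK//; exact: integrable_fin_num. Qed.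

Lemma summable_ge0 f (c : R) : measurable_fun [set: T] f ->
  (forall x, 0 <= f x) -> (\int[mu]_x (f x)%:E <= c%:E)%E -> summable_fun f.
Proof.
move=> mf f0 fc; apply/integrableP; split; first exact/measurable_EFinP.
under eq_integral do rewrite /= ger0_norm//.
by rewrite (le_lt_trans fc)// ltry.
Qed.

Lemma summable_ge0_val f (c : R) : measurable_fun [set: T] f ->
  (forall x, 0 <= f x) -> (\int[mu]_x (f x)%:E = c%:E)%E ->
  summable_fun f /\ \int[mu]_x f x = c.
Proof.
move=> mf f0 fc; split; last by rewrite /Rintegral fc.
by apply: (@summable_ge0 _ c) => //; rewrite fc.
Qed.

Lemma measurable_fun_inv (f : T -> R) : measurable_fun [set: T] f ->
  (forall x, 0 <= f x) -> measurable_fun [set: T] (fun x => (f x)^-1).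
Proof.
move=> mf f0; rewrite (_ : (fun x => _) = (fun x => f x `^ (-1))).
  exact: (measurableT_comp (measurable_powR (-1)) mf).
by apply/funext => x; rewrite powR_inv1.
Qed.

End real_integrals.
Arguments summable_fun {d T R} mu f.

Section real_fubini.
Context d1 d2 (T1 : measurableType d1) (T2 : measurableType d2) (R : realType).
Variable m1 : {sigma_finite_measure set T1 -> \bar R}.
Variable m2 : {sigma_finite_measure set T2 -> \bar R}.
Implicit Types f : T1 * T2 -> R.

Lemma measurable_section1 f x : measurable_fun [set: T1 * T2] f ->
  measurable_fun [set: T2] (fun y => f (x, y)).
Proof. by move=> mf; exact: (measurableT_comp mf (measurable_pair1 x)). Qed.

Lemma measurable_section2 f y : measurable_fun [set: T1 * T2] f ->
  measurable_fun [set: T1] (fun x => f (x, y)).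
Proof. by move=> mf; exact: (measurableT_comp mf (measurable_pair2 y)). Qed.

Lemma measurable_Rintegral2 f : measurable_fun [set: T1 * T2] f ->
  measurable_fun [set: T1] (fun x => \int[m2]_y f (x, y)).
Proof.
move=> /measurable_EFinP mf; apply: (measurableT_comp (fine_measurable measurableT)) => //=.
under eq_fun do rewrite integralE.
apply: emeasurable_funB.
- rewrite [X in measurable_fun _ X](_ : _ = fubini_F m2 ((EFin \o f)^\+)%E); last first.
    by apply/funext => x; apply: eq_integral => y _; rewrite !funeposE.
  apply: measurable_fun_fubini_tonelli_F => //.
  exact: measurable_funepos.
- rewrite [X in measurable_fun _ X](_ : _ = fubini_F m2 ((EFin \o f)^\-)%E); last first.
    by apply/funext => x; apply: eq_integral => y _; rewrite !funenegE.
  apply: measurable_fun_fubini_tonelli_F => //.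
  exact: measurable_funeneg.
Qed.

Lemma measurable_Rintegral1 f : measurable_fun [set: T1 * T2] f ->
  measurable_fun [set: T2] (fun y => \int[m1]_x f (x, y)).
Proof.
move=> /measurable_EFinP mf; apply: (measurableT_comp (fine_measurable measurableT)) => //=.
under eq_fun do rewrite integralE.
apply: emeasurable_funB.
- rewrite [X in measurable_fun _ X](_ : _ = fubini_G m1 ((EFin \o f)^\+)%E); last first.
    by apply/funext => x; apply: eq_integral => y _; rewrite !funeposE.
  apply: measurable_fun_fubini_tonelli_G => //.
  exact: measurable_funepos.
- rewrite [X in measurable_fun _ X](_ : _ = fubini_G m1 ((EFin \o f)^\-)%E); last first.
    by apply/funext => x; apply: eq_integral => y _; rewrite !funenegE.
  apply: measurable_fun_fubini_tonelli_G => //.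
  exact: measurable_funeneg.
Qed.

(** Tonelli's criterion, with a summable majorant for the norms of the sections instead of an
    iterated integral. The integrability behind each exchange of integrals below comes from this
    lemma or its mirror image. *)
Lemma summable_prod2 f (K : T2 -> R) : measurable_fun [set: T1 * T2] f ->
  (forall y, summable_fun m1 (fun x => f (x, y))) ->
  summable_fun m2 K -> (forall y, \int[m1]_x `|f (x, y)| <= K y) ->
  summable_fun (m1 \x m2)%E f.
Proof.
move=> mf sf sK fK; apply/integrable21ltyP; first exact/measurable_EFinP.
apply: (@le_lt_trans _ _ (\int[m2]_y (K y)%:E)%E); last first.
  by rewrite -EFin_Rintegral// ltry.
have mG : measurable_fun setT (fun y => (\int[m1]_x `|f (x, y)|%:E)%E).
  rewrite [X in measurable_fun _ X](_ : _ = fubini_G m1 (EFin \o (Num.norm \o f))) //.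
  apply: measurable_fun_fubini_tonelli_G.
    by apply/measurable_EFinP; exact: measurableT_comp.
  by move=> x /=; rewrite lee_fin.
apply: ge0_le_integral => //.
- by move=> y _; exact: integral_ge0.
- by apply/measurable_EFinP; exact: summable_measurable sK.
- move=> y _ /=.
  have := fK y; rewrite -lee_fin EFin_Rintegral//; exact: summable_norm.
Qed.

Lemma summable_prod1 f (K : T1 -> R) : measurable_fun [set: T1 * T2] f ->
  (forall x, summable_fun m2 (fun y => f (x, y))) ->
  summable_fun m1 K -> (forall x, \int[m2]_y `|f (x, y)| <= K x) ->
  summable_fun (m1 \x m2)%E f.
Proof.
move=> mf sf sK fK; apply/integrable12ltyP; first exact/measurable_EFinP.
apply: (@le_lt_trans _ _ (\int[m1]_y (K y)%:E)%E); last first.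
  by rewrite -EFin_Rintegral// ltry.
have mG : measurable_fun setT (fun x => (\int[m2]_y `|f (x, y)|%:E)%E).
  rewrite [X in measurable_fun _ X](_ : _ = fubini_F m2 (EFin \o (Num.norm \o f))) //.
  apply: measurable_fun_fubini_tonelli_F.
    by apply/measurable_EFinP; exact: measurableT_comp.
  by move=> x /=; rewrite lee_fin.
apply: ge0_le_integral => //.
- by move=> y _; exact: integral_ge0.
- by apply/measurable_EFinP; exact: summable_measurable sK.
- move=> y _ /=.
  have := fK y; rewrite -lee_fin EFin_Rintegral//; exact: summable_norm.
Qed.

(** On a null set the section may fail to be summable. The real integral is then a default value,
    which is still bounded by the integral of the norm and does not change the outer integral. *)
Lemma Rfubini1 f : summable_fun (m1 \x m2)%E f ->
  summable_fun m1 (fun x => \int[m2]_y f (x, y)) /\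
  \int[m1]_x \int[m2]_y f (x, y) = \int[(m1 \x m2)%E]_z f z.
Proof.
move=> sf; have mf := measurable_int _ sf.
have mI : measurable_fun [set: T1] (EFin \o (fun x => \int[m2]_y f (x, y))).
  apply/measurable_EFinP/measurable_Rintegral2; exact: summable_measurable sf.
have mA : measurable_fun [set: T1] (fubini_F m2 (abse \o (EFin \o f))).
  by apply: measurable_fun_fubini_tonelli_F => [|z]; [exact: measurableT_comp|exact: abse_ge0].
split.
  apply: (@le_integrable _ _ _ _ _ measurableT _ (fubini_F m2 (abse \o (EFin \o f)))) => //.
    move=> x _ /=; rewrite [X in (_ <= X)%E]gee0_abs; last first.
      by apply: integral_ge0 => y _; exact: abse_ge0.
    have mx : measurable_fun [set: T2] (fun y => (f (x, y))%:E).
      exact/measurable_EFinP/measurable_section1/summable_measurable/sf.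
    apply: le_trans (le_abse_integral _ measurableT mx).
    by rewrite /Rintegral; case: (integral _ _ _) => [r| |]//=; rewrite ?normr0 ?leey.
  apply/integrableP; split => //.
  under eq_fun => x.
    rewrite gee0_abs; last by apply: integral_ge0 => y _; exact: abse_ge0.
    over.
  exact/integrable12ltyP.
rewrite /Rintegral -(integral12_prod_meas1 sf) //; congr fine.
apply: ae_eq_integral => //; first exact: measurable_fubini_F sf.
apply: filterS (ae_integrable1 sf) => x ix _ /=.
by rewrite /fubini_F fineK//; exact: integrable_fin_num ix.
Qed.

Lemma Rfubini2 f : summable_fun (m1 \x m2)%E f ->
  summable_fun m2 (fun x => \int[m1]_y f (y, x)) /\
  \int[m2]_x \int[m1]_y f (y, x) = \int[(m1 \x m2)%E]_z f z.
Proof.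
move=> sf; have mf := measurable_int _ sf.
have mI : measurable_fun [set: T2] (EFin \o (fun x => \int[m1]_y f (y, x))).
  apply/measurable_EFinP/measurable_Rintegral1; exact: summable_measurable sf.
have mA : measurable_fun [set: T2] (fubini_G m1 (abse \o (EFin \o f))).
  by apply: measurable_fun_fubini_tonelli_G => [|z]; [exact: measurableT_comp|exact: abse_ge0].
split.
  apply: (@le_integrable _ _ _ _ _ measurableT _ (fubini_G m1 (abse \o (EFin \o f)))) => //.
    move=> x _ /=; rewrite [X in (_ <= X)%E]gee0_abs; last first.
      by apply: integral_ge0 => y _; exact: abse_ge0.
    have mx : measurable_fun [set: T1] (fun y => (f (y, x))%:E).
      exact/measurable_EFinP/measurable_section2/summable_measurable/sf.
    apply: le_trans (le_abse_integral _ measurableT mx).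
    by rewrite /Rintegral; case: (integral _ _ _) => [r| |]//=; rewrite ?normr0 ?leey.
  apply/integrableP; split => //.
  under eq_fun => x.
    rewrite gee0_abs; last by apply: integral_ge0 => y _; exact: abse_ge0.
    over.
  exact/integrable21ltyP.
rewrite /Rintegral -(integral21_prod_meas1 sf) //; congr fine.
apply: ae_eq_integral => //; first exact: measurable_fubini_G sf.
apply: filterS (ae_integrable2 sf) => x ix _ /=.
by rewrite /fubini_G fineK//; exact: integrable_fin_num ix.
Qed.

Lemma Rfubini f : summable_fun (m1 \x m2)%E f ->
  \int[m1]_x \int[m2]_y f (x, y) = \int[m2]_y \int[m1]_x f (x, y).
Proof. by move=> sf; rewrite (Rfubini1 sf).2 (Rfubini2 sf).2. Qed.

Lemma summable_funX (f : T1 -> R) (g : T2 -> R) :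
  summable_fun m1 f -> summable_fun m2 g ->
  summable_fun (m1 \x m2)%E (fun z => f z.1 * g z.2).
Proof.
move=> sf sg; apply: (@summable_prod1 _ (fun x => `|f x| * \int[m2]_y `|g y|)).
- apply: measurable_funM.
    exact: (measurableT_comp (summable_measurable sf) measurable_fst).
  exact: (measurableT_comp (summable_measurable sg) measurable_snd).
- by move=> x /=; exact: summable_funZ.
- under eq_fun do rewrite mulrC; exact/summable_funZ/summable_norm.
- move=> x /=; under eq_Rintegral do rewrite normrM.
  by rewrite RintegralZl//; exact: summable_norm.
Qed.

Lemma RintegralX (f : T1 -> R) (g : T2 -> R) :
  summable_fun m1 f -> summable_fun m2 g ->
  \int[(m1 \x m2)%E]_z (f z.1 * g z.2) = (\int[m1]_x f x) * \int[m2]_y g y.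
Proof.
move=> sf sg; rewrite -(Rfubini1 (summable_funX sf sg)).2/=.
under eq_Rintegral do rewrite RintegralZl//.
by rewrite RintegralZr.
Qed.

End real_fubini.

(** * Invariance properties of Lebesgue measure *)

Section change_of_variables.
Context d1 d2 (T1 : measurableType d1) (T2 : measurableType d2) (R : realType).
Variables (m1 : {measure set T1 -> \bar R}) (m2 : {measure set T2 -> \bar R}).
Variables (phi : T1 -> T2) (k : R).
Hypothesis mphi : measurable_fun [set: T1] phi.
Hypothesis phiE : forall g : T2 -> \bar R, measurable_fun [set: T2] g ->
  (forall y, (0 <= g y)%E) ->
  (\int[m1]_x g (phi x) = k%:E * \int[m2]_y g y)%E.

Lemma summable_change f : summable_fun m2 f -> summable_fun m1 (f \o phi).
Proof.
move=> sf; have mf := summable_measurable sf; apply/integrableP; split.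
  by apply/measurable_EFinP; exact: measurableT_comp.
have := phiE (g := abse \o (EFin \o f)).
move=> /= ->//; last by apply: measurableT_comp => //; exact/measurable_EFinP.
have := summable_norm sf => /EFin_Rintegral /= <-.
by rewrite -EFinM ltry.
Qed.

(** Positive and negative parts reduce this to the nonnegative formula [phiE], where the Jacobian is
    the constant [k]. *)
Lemma Rintegral_change f : summable_fun m2 f ->
  \int[m1]_x f (phi x) = k * \int[m2]_y f y.
Proof.
move=> sf; have mf := summable_measurable sf.
have E := EFin_Rintegral (summable_change sf).
apply: EFin_inj; rewrite [LHS]E [in LHS]integralE EFinM EFin_Rintegral//.
rewrite [in RHS]integralE.
have mfE : measurable_fun [set: T2] (EFin \o f) by exact/measurable_EFinP.
rewrite muleBr//; last first.
  apply: fin_num_adde_defr; apply: integrable_pos_fin_num => //.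
rewrite -!phiE//; [|exact: measurable_funeneg|exact: measurable_funepos].
by congr (_ - _)%E; apply: eq_integral => x _; rewrite ?funeposE ?funenegE.
Qed.

End change_of_variables.

Section lebesgue_invariance.
Context (R : realType).
Local Notation RT := (measurableTypeR R).
Local Notation leb := (@lebesgue_measure R).

Lemma ge0_integral_affine (k c : R) (g : RT -> \bar R) : 0 < k ->
  measurable_fun [set: RT] g -> (forall x, (0 <= g x)%E) ->
  (\int[leb]_x g (k * x + c)%R = k^-1%:E * \int[leb]_x g x)%E.
Proof.
move=> k0 mg g0.
pose phi (x : RT) : RT := k * x + c.
have mphi : measurable_fun [set: RT] phi.
  by apply: measurable_funD => //; exact: measurable_funM.
have k0' : 0 <= k by exact: ltW.
pose K := NngNum k0'.
(* Lebesgue measure is determined by the length of half-open intervals, and [k] times its image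
   under [phi] gives them that length. *)
have H A : measurable A -> leb A = mscale K (pushforward leb phi) A.
  apply: lebesgue_measure_unique => _ [[a b] _ <-] /=.
  pose J : set RT := `]((a - c) / k)%R, ((b - c) / k)%R]%classic.
  have E : phi @^-1` `]a, b] = J.
    apply/seteqP; split => x; rewrite /J/= !in_itv/= /phi.
      by rewrite ltr_pdivrMr// ler_pdivlMr// ltrBlDr lerBrDr mulrC.
    by rewrite ltr_pdivrMr// ler_pdivlMr// ltrBlDr lerBrDr (mulrC x).
  transitivity (k%:E * leb J)%E; last first.
    by congr (_ * _)%E; rewrite -E.
  rewrite /J !lebesgue_measure_itv/= !lte_fin ltr_pM2r ?invr_gt0// ltrD2r.
  case: ifPn => ab; last by rewrite mule0.
  by rewrite -!EFinD -EFinM; congr EFin; field; rewrite gt_eqF.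
have -> : (\int[leb]_x g x = k%:E * \int[pushforward leb phi]_x g x)%E.
  rewrite -[k]/(K%:num) -ge0_integral_mscale//.
  by apply: eq_measure_integral => A mA _; exact: H.
rewrite muleA -EFinM mulVf ?gt_eqF// mul1e.
by rewrite ge0_integral_pushforward.
Qed.

Lemma ge0_integral_opp (g : RT -> \bar R) :
  measurable_fun [set: RT] g -> (forall x, (0 <= g x)%E) ->
  (\int[leb]_x g (- x)%R = \int[leb]_x g x)%E.
Proof.
move=> mg g0.
transitivity (\int[pushforward leb (-%R : RT -> RT)]_x g x)%E.
  by rewrite ge0_integral_pushforward.
by apply: eq_measure_integral => A mA _; exact: lebesgue_measureN.
Qed.

Lemma ge0_integral_shift (c : R) (g : RT -> \bar R) :
  measurable_fun [set: RT] g -> (forall x, (0 <= g x)%E) ->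
  (\int[leb]_x g (x + c)%R = \int[leb]_x g x)%E.
Proof.
move=> mg g0; have := ge0_integral_affine c ltr01 mg g0.
by under eq_integral do rewrite mul1r; rewrite invr1 mul1e.
Qed.

Lemma ge0_integral_reflect (c : R) (g : RT -> \bar R) :
  measurable_fun [set: RT] g -> (forall x, (0 <= g x)%E) ->
  (\int[leb]_x g (c - x)%R = \int[leb]_x g x)%E.
Proof.
move=> mg g0; rewrite -(ge0_integral_shift c mg g0).
rewrite -(@ge0_integral_opp (fun x => g (x + c))) //.
  by under eq_integral do rewrite addrC.
by apply: (measurableT_comp mg); exact: measurable_funD.
Qed.

Section tuples.

Lemma ge0_integral_tupleS n (g : n.+1.-tuple RT -> \bar R) :
  measurable_fun [set: n.+1.-tuple RT] g -> (forall x, (0 <= g x)%E) ->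
  (\int[lebesgue_tuple n.+1]_t g t =
   \int[leb]_x \int[lebesgue_tuple n]_t g [tuple of x :: t])%E.
Proof.
move=> mg g0; rewrite [LHS](_ : _ =
  \int[pushforward (leb \x lebesgue_tuple n)%E (@consp R n)]_t g t)%E//.
rewrite ge0_integral_pushforward//; last exact: measurable_consp.
rewrite preimage_setT fubini_tonelli1//.
  by apply: measurableT_comp => //; exact: measurable_consp.
by move=> z; exact: g0.
Qed.

Lemma ge0_integral_tuple0 (g : 0.-tuple RT -> \bar R) :
  measurable_fun [set: 0.-tuple RT] g -> (forall x, (0 <= g x)%E) ->
  (\int[lebesgue_tuple 0]_t g t = g [tuple])%E.
Proof. by move=> mg g0; rewrite /= integral_dirac// diracT mul1e. Qed.

Lemma measurable_tuple_map n (phi : 'I_n -> RT -> RT) :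
  (forall i, measurable_fun setT (phi i)) ->
  measurable_fun [set: n.-tuple RT]
   (fun t => [tuple phi i (tnth t i) | i < n] : n.-tuple RT).
Proof.
move=> mphi; apply/measurable_fun_tnthP => i.
rewrite (_ : _ \o _ = phi i \o (@tnth _ _)^~ i).
  by apply: measurableT_comp => //; exact: measurable_tnth.
by apply/funext => t /=; rewrite tnth_mktuple.
Qed.

Lemma ge0_integral_tuple_map n (phi : 'I_n -> RT -> RT) (g : n.-tuple RT -> \bar R) :
  (forall i, measurable_fun setT (phi i)) ->
  (forall i (f : RT -> \bar R), measurable_fun setT f -> (forall x, (0 <= f x)%E) ->
    (\int[leb]_x f (phi i x) = \int[leb]_x f x)%E) ->
  measurable_fun setT g -> (forall x, (0 <= g x)%E) ->
  (\int[lebesgue_tuple n]_t g [tuple phi i (tnth t i) | i < n] =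
   \int[lebesgue_tuple n]_t g t)%E.
Proof.
elim: n phi g => [|n IH] phi g mphi phiE mg g0.
  by apply: eq_integral => t _; rewrite [t]tuple0 [X in g X]tuple0.
have mh := measurable_tuple_map mphi.
rewrite !ge0_integral_tupleS//; last exact: (measurableT_comp mg mh).
have step x : (\int[lebesgue_tuple n]_t
    g [tuple phi i (tnth [tuple of x :: t] i) | i < n.+1] =
    \int[lebesgue_tuple n]_t g [tuple of phi ord0 x :: t])%E.
  have := IH (fun i => phi (lift ord0 i)) (fun t => g [tuple of phi ord0 x :: t]).
  move=> <- //.
  - apply: eq_integral => t _; congr g; apply: eq_from_tnth => i.
    have [j ->|->] := unliftP ord0 i; rewrite tnth_mktuple ?tnthS ?tnth_mktuple//.
  - by move=> i f; exact: phiE.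
  - by apply: (measurableT_comp mg); exact: measurable_cons.
under eq_integral do rewrite step.
rewrite (phiE ord0 (fun y => \int[lebesgue_tuple n]_t g [tuple of y :: t])%E) //.
- apply: (@measurable_fun_fubini_tonelli_F _ _ _ _ _ (lebesgue_tuple n)
    (fun z => g (consp z))) => //.
  by apply: (measurableT_comp mg); exact: measurable_consp.
- by move=> x; exact: integral_ge0.
Qed.

Lemma ge0_integral_tuple_prod n (f : 'I_n -> RT -> \bar R) :
  (forall i, measurable_fun setT (f i)) -> (forall i x, (0 <= f i x)%E) ->
  (\int[lebesgue_tuple n]_t \prod_(i < n) f i (tnth t i) =
   \prod_(i < n) \int[leb]_x f i x)%E.
Proof.
elim: n f => [|n IH] f mf f0.
  rewrite big_ord0; under eq_integral do rewrite big_ord0.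
  by rewrite ge0_integral_tuple0.
have mprod m (h : 'I_m -> RT -> \bar R) : (forall i, measurable_fun setT (h i)) ->
  measurable_fun [set: m.-tuple RT] (fun t => \prod_(i < m) h i (tnth t i))%E.
  move=> mh; elim: (index_enum _) => [|i s IHs].
    by rewrite [X in measurable_fun _ X](_ : _ = cst 1%E)//; apply/funext => t; rewrite big_nil.
  under eq_fun do rewrite big_cons.
  apply: emeasurable_funM => //.
  by apply: (measurableT_comp (mh i)); exact: measurable_tnth.
rewrite ge0_integral_tupleS//; [|exact: mprod|by move=> t; exact: prode_ge0].
rewrite big_ord_recl -IH//.
have step x : (\int[lebesgue_tuple n]_t
    \prod_(i < n.+1) f i (tnth [tuple of x :: t] i) =
    f ord0 x * \int[lebesgue_tuple n]_t \prod_(i < n) f (lift ord0 i) (tnth t i))%E.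
  rewrite -ge0_integralZl//; [|exact: (mprod n (fun i => f (lift ord0 i)))|by move=> t _; exact: prode_ge0].
  apply: eq_integral => t _; rewrite big_ord_recl; congr (_ * _)%E.
  by apply: eq_bigr => i _; rewrite tnthS.
under eq_integral do rewrite step.
by rewrite ge0_integralZr//; apply: integral_ge0 => t _; exact: prode_ge0.
Qed.

End tuples.
End lebesgue_invariance.

(** * Integration on R^n *)

Section euclidean_integrals.
Context (R : realType) (n : nat).
Local Notation RT := (measurableTypeR R).
Local Notation leb := (@lebesgue_measure R).
Local Notation E := 'rV[R]_n.
Local Notation v := (@rV_of_tuple R n).
Implicit Types (F G : E -> R) (x y c : E).

Definition vsummable F := summable_fun (lebesgue_tuple n) (fun t => F (v t)).
Definition vint F := \int[lebesgue_tuple n]_t F (v t).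

(** Rounding the coordinates of [f] down to the grid of mesh 1 / (k + 1) gives maps with countably
    many values, each taken on a measurable cell. They converge pointwise to [f], and continuity of
    [G] passes to the limit. *)
Lemma measurable_continuous_rV d (T : measurableType d) (G : E -> R) (f : T -> E) :
  continuous G -> (forall i, measurable_fun [set: T] (fun t => f t ord0 i)) ->
  measurable_fun [set: T] (fun t => G (f t)).
Proof.
move=> cG mf.
pose q (k : nat) (m : {ffun 'I_n -> int}) : E := \row_i ((m i)%:~R / k.+1%:R).
pose fl (k : nat) (t : T) : {ffun 'I_n -> int} :=
  [ffun i => Num.floor (f t ord0 i * k.+1%:R)].
have mfl k m : measurable [set t | fl k t = m].
  rewrite (_ : [set _ | _] = \bigcap_(i in [set: 'I_n])
    ((fun t => f t ord0 i * k.+1%:R) @^-1` [set` `[(m i)%:~R, (m i + 1)%:~R[])).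
    apply: fin_bigcap_measurable => // i _.
    rewrite -[X in measurable X]setTI.
    have mfi : measurable_fun [set: T] (fun t => f t ord0 i * k.+1%:R).
      exact: measurable_funM.
    exact: mfi.
  apply/seteqP; split => [t /= <- i _ /=|t /= H].
    by rewrite in_itv/= ffunE floor_itv.
  apply/ffunP => i; rewrite ffunE; apply/eqP; rewrite floor_eq.
  by have := H i I; rewrite /= in_itv.
apply: (@measurable_fun_cvg _ _ _ _ (fun k t => G (q k (fl k t)))).
  move=> k _ Y mY; rewrite setTI.
  rewrite (_ : _ @^-1` _ = \bigcup_(m : {ffun 'I_n -> int})
     (if `[< Y (G (q k m)) >] then [set t | fl k t = m] else set0)).
    by apply: countable_bigcupT_measurable => // m; case: ifP.
  apply/seteqP; split => [t /= Yt|t [m _]].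
    by exists (fl k t) => //; rewrite ifT//; apply/asboolP.
  by case: ifPn => // /asboolP Ym /= ->.
move=> t _; apply: (cvg_comp (fun k => q k (fl k t)) G _ (cG (f t))).
apply/cvgrPdist_lt => e e0.
near=> k.
rewrite [ltLHS]/Num.Def.normr/= mx_normrE (bigmax_lt _ e0)//= => -[i j] _ /=.
rewrite !mxE (ord1 i) ffunE.
have k0 : (0 : R) < k.+1%:R by [].
set a := f t ord0 j.
have /andP[H1 H2] := floor_itv (a * k.+1%:R).
have ek : k.+1%:R^-1 < e.
  near: k; exact: near_infty_natSinv_lt (PosNum e0).
apply: le_lt_trans ek.
rewrite -[X in `|X - _|](mulfK (negbT (gt_eqF k0)) a) -mulrBl normrM [`|_^-1|]gtr0_norm ?invr_gt0//.
rewrite ler_piMl ?invr_ge0// ger0_norm ?subr_ge0//.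
by rewrite lerBlDr addrC; move: H2; rewrite intrD => /ltW.
Unshelve. all: by end_near. Qed.

Lemma measurable_coord_tuple (i : 'I_n) :
  measurable_fun [set: n.-tuple RT] (fun t => v t ord0 i).
Proof.
rewrite (_ : (fun t => _) = (@tnth _ _)^~ i); first exact: measurable_tnth.
by apply/funext => t; rewrite mxE.
Qed.

Lemma measurable_continuous_tuple G : continuous G ->
  measurable_fun [set: n.-tuple RT] (fun t => G (v t)).
Proof.
by move=> cG; apply: measurable_continuous_rV => // i; exact: measurable_coord_tuple.
Qed.

Lemma vint_reflect c F : vsummable F ->
  vsummable (fun y => F (c - y)) /\ vint (fun y => F (c - y)) = vint F.
Proof.
pose phi (i : 'I_n) (x : RT) : RT := c ord0 i - x.
have mphi i : measurable_fun setT (phi i) by exact: measurable_funB.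
have phiE := ge0_integral_tuple_map mphi (fun i f mf f0 =>
  ge0_integral_reflect (c ord0 i) mf f0).
have mm := measurable_tuple_map mphi.
have phiE1 g mg g0 := etrans (phiE g mg g0) (esym (mul1e _)).
have Ev t : v [tuple phi i (tnth t i) | i < n] = c - v t.
  by apply/rowP => i; rewrite !mxE tnth_mktuple.
move=> sF.
have := summable_change mm phiE1 sF; have := Rintegral_change mm phiE1 sF.
rewrite mul1r /vsummable /vint /= => <- H; split.
  by move: H; congr (summable_fun _ _); apply/funext => t /=; rewrite Ev.
by apply: eq_Rintegral => t _; rewrite Ev.
Qed.

(** A translation is the composite of two point reflections, here through c / 2 and through 0. *)
Lemma vint_shift c F : vsummable F ->
  vsummable (fun y => F (y + c)) /\ vint (fun y => F (y + c)) = vint F.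
Proof.
move=> sF; have [sF' E1] := vint_reflect (c : E) sF.
have [sF'' E2] := vint_reflect (0 : E) sF'.
split.
  by move: sF''; congr vsummable; apply/funext => y; rewrite sub0r opprK addrC.
rewrite -E1 -E2; congr vint; apply/funext => y.
by rewrite sub0r opprK addrC.
Qed.

Lemma vsummableD F G : vsummable F -> vsummable G ->
  vsummable (fun y => F y + G y).
Proof. by move=> sF sG; exact: (summable_funD sF sG). Qed.

Lemma vsummableB F G : vsummable F -> vsummable G ->
  vsummable (fun y => F y - G y).
Proof. by move=> sF sG; exact: (summable_funB sF sG). Qed.

Lemma vsummableZ k F : vsummable F -> vsummable (fun y => k * F y).
Proof. exact: summable_funZ. Qed.

Lemma vsummable_norm F : vsummable F -> vsummable (fun y => `|F y|).
Proof. exact: summable_norm. Qed.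

Lemma vintD F G : vsummable F -> vsummable G ->
  vint (fun y => F y + G y) = vint F + vint G.
Proof. by move=> sF sG; rewrite /vint RintegralD. Qed.

Lemma vintB F G : vsummable F -> vsummable G ->
  vint (fun y => F y - G y) = vint F - vint G.
Proof. by move=> sF sG; rewrite /vint RintegralB. Qed.

Lemma vintZ k F : vsummable F -> vint (fun y => k * F y) = k * vint F.
Proof. by move=> sF; rewrite /vint RintegralZl. Qed.

Lemma vint_le F G : vsummable F -> vsummable G -> (forall y, F y <= G y) ->
  vint F <= vint G.
Proof. by move=> sF sG FG; apply: Rintegral_le. Qed.

Lemma vint_norm_le F G : vsummable F -> vsummable G ->
  (forall y, `|F y| <= G y) -> `|vint F| <= vint G.
Proof. by move=> sF sG FG; apply: Rintegral_norm_le. Qed.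

Lemma vsummable_prod (f : 'I_n -> R -> R) (c : 'I_n -> R) :
  (forall i, measurable_fun [set: RT] (f i)) -> (forall i (x : R), 0 <= f i x) ->
  (forall i, (\int[leb]_x (f i x)%:E = (c i)%:E)%E) ->
  vsummable (fun x => \prod_(i < n) f i (x ord0 i)) /\
  vint (fun x => \prod_(i < n) f i (x ord0 i)) = \prod_(i < n) c i.
Proof.
move=> mf f0 fc; apply: summable_ge0_val.
- elim: (index_enum _) => [|i s IHs].
    by under eq_fun do rewrite big_nil; exact: measurable_cst.
  under eq_fun do rewrite big_cons.
  apply: measurable_funM => //; apply: (measurableT_comp (mf i)).
  exact: measurable_coord_tuple.
- by move=> t; apply: prodr_ge0 => i _; exact: f0.
- transitivity (\int[lebesgue_tuple n]_t \prod_(i < n) (f i (tnth t i))%:E)%E.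
    apply: eq_integral => t _; rewrite -prodEFin.
    by apply: eq_bigr => i _; rewrite mxE.
  rewrite (ge0_integral_tuple_prod (f := fun i (x : RT) => (f i x)%:E)).
  + by rewrite -prodEFin; apply: eq_bigr => i _; exact: fc.
  + by move=> i; exact/measurable_EFinP.
  + by move=> i x; rewrite lee_fin.
Qed.

(** A point is a box with degenerate sides, and at least one side exists when n is positive. This
    discards the singularity of the potential kernel, where its Gaussian formula fails. *)
Lemma ae_tuple_neq (x : E) : (0 < n)%N ->
  {ae lebesgue_tuple n, forall t, v t != x}.
Proof.
move=> n0; pose A (i : 'I_n) : set RT := [set x ord0 i].
have mA i : measurable (A i) by exact: measurable_set1.
exists [set t | forall i, A i (tnth t i)]; split.
- rewrite (_ : [set _ | _] = \bigcap_(i in [set: 'I_n])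
      ((@tnth _ _)^~ i @^-1` A i)).
    apply: fin_bigcap_measurable => // i _.
    by rewrite -[X in measurable X]setTI; exact: measurable_tnth.
  by apply/seteqP; split=> [t H i _|t H i]; [exact: H|exact: (H i)].
- rewrite lebesgue_tuple_box//.
  rewrite (bigD1 (Ordinal n0))//= lebesgue_measure_set1 mul0e//.
- move=> t /= /negP; rewrite negbK => /eqP tx i.
  by rewrite /A /= -tx mxE.
Qed.

Lemma derive_line F x u t : derivable F (x + t *: u) u ->
  is_derive t (1 : R) (fun s : R => F (x + s *: u)) ('D_u F (x + t *: u)).
Proof.
move=> dF.
have H : (fun h : R => h^-1 *: (((fun s : R => F (x + s *: u)) \o shift t) (h *: (1 : R))
     - F (x + t *: u))) =
   (fun h : R => h^-1 *: ((F \o shift (x + t *: u)) (h *: u) - F (x + t *: u))).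
  apply/funext => h /=; congr (_ *: (F _ - _)).
  by rewrite [h *: 1]mulr1 scalerDl addrCA.
by split; [rewrite /derivable H|rewrite /derive H].
Qed.

Lemma is_derive_line F x u a :
  is_derive (0 : R) (1 : R) (fun s : R => F (x + s *: u)) a -> is_derive x u F a.
Proof.
move=> [dF <-].
have H : (fun h : R => h^-1 *: (((fun s : R => F (x + s *: u)) \o shift 0) (h *: (1 : R))
     - F (x + 0 *: u))) =
   (fun h : R => h^-1 *: ((F \o shift x) (h *: u) - F x)).
  apply/funext => h /=; rewrite addr0 scale0r addr0; congr (_ *: (F _ - _)).
  by rewrite [h *: 1]mulr1 addrC.
by split; [move: dF; rewrite /derivable H|rewrite /derive H].
Qed.

Definition ebase (j : 'I_n) : E := delta_mx ord0 j.

Lemma ebaseE i j : ebase j ord0 i = (i == j)%:R.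
Proof. by rewrite mxE eqxx. Qed.

Lemma derive_line_mvt F j L x t : (forall y, derivable F y (ebase j)) ->
  (forall y, `|'D_(ebase j) F y| <= L) ->
  `|F (x + t *: ebase j) - F x| <= L * `|t|.
Proof.
move=> dF FL.
pose phi s := F (x + s *: ebase j).
have dphi (s : R) : is_derive s (1 : R) phi ('D_(ebase j) F (x + s *: ebase j)).
  exact: derive_line.
have cphi : continuous phi.
  move=> s; apply: differentiable_continuous; apply/derivable1_diffP.
  by have [] := dphi s.
have key a b : a <= b -> `|phi b - phi a| <= L * `|b - a|.
  move=> ab.
  have [c _ ->] := @MVT_segment R phi _ a b ab (fun s _ => dphi s)
     (continuous_subspaceT cphi).
  by rewrite normrM ler_wpM2r.
rewrite (_ : F (x + t *: ebase j) = phi t) // (_ : F x = phi 0); last first.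
  by rewrite /phi scale0r addr0.
have [t0|t0] := leP 0 t.
  by have := key _ _ t0; rewrite subr0.
by have := key _ _ (ltW t0); rewrite distrC sub0r normrN.
Qed.

(** The segment from x to x + z is replaced by a path along the axes, one coordinate at a time, so
    that the mean value theorem applies to each partial derivative. *)
Lemma lipschitz_partials F L : (forall j y, derivable F y (ebase j)) ->
  (forall j y, `|'D_(ebase j) F y| <= L) ->
  forall x z, `|F (x + z) - F x| <= L * \sum_(i < n) `|z ord0 i|.
Proof.
move=> dF FL x z.
have -> : z = \sum_(i < n) z ord0 i *: ebase i.
  apply/rowP => j; rewrite summxE (bigD1 j)//= big1 => [|i ij].
    by rewrite !mxE !eqxx mulr1 addr0.
  by rewrite !mxE eqxx/= eq_sym (negbTE ij) mulr0.
have -> : \sum_(i < n) `|(\sum_(i < n) z ord0 i *: ebase i) ord0 i| =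
          \sum_(i < n) `|z ord0 i|.
  apply: eq_bigr => j _; congr `|_|; rewrite summxE (bigD1 j)//= big1 => [|i ij].
    by rewrite !mxE !eqxx mulr1 addr0.
  by rewrite !mxE eqxx/= eq_sym (negbTE ij) mulr0.
elim: (index_enum _) => [|i s IH].
  by rewrite !big_nil addr0 subrr normr0 mulr0.
rewrite !big_cons mulrDr.
rewrite (_ : x + (_ + _) = x + \sum_(j <- s) z ord0 j *: ebase j + z ord0 i *: ebase i); last first.
  by rewrite -addrA [in RHS](addrC (\sum_(j <- s) _)).
rewrite (_ : F _ - F x = (F (x + \sum_(j <- s) z ord0 j *: ebase j + z ord0 i *: ebase i)
   - F (x + \sum_(j <- s) z ord0 j *: ebase j)) +
   (F (x + \sum_(j <- s) z ord0 j *: ebase j) - F x)); last first.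
  by rewrite addrA subrK.
apply: (le_trans (ler_normD _ _)); apply: lerD => //.
exact: derive_line_mvt.
Qed.

(* Translation invariance and the fundamental theorem of calculus along the
   j-th axis: both sides of [F (y + e_j) - F y = \int_0^1 d_j F (y + t e_j)]
   are integrated over y. *)
Lemma vint_partial0 F F' j : (forall y, is_derive y (ebase j) F (F' y)) ->
  continuous F' -> vsummable F -> vsummable F' -> vint F' = 0.
Proof.
move=> dF cF' sF sF'.
pose h (z : n.-tuple RT * RT) : R :=
  \1_`[0, 1]%classic z.2 * F' (v z.1 + z.2 *: ebase j).
have mh : measurable_fun [set: n.-tuple RT * RT] h.
  apply: measurable_funM.
    by apply: (measurableT_comp _ measurable_snd); exact: measurable_indic.
  apply: measurable_continuous_rV => // i.
  under eq_fun do rewrite mxE [X in _ + X]mxE.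
  apply: measurable_funD.
    by apply: (measurableT_comp (measurable_coord_tuple i) measurable_fst).
  by apply: measurable_funM => //; exact: measurable_snd.
have s1 : summable_fun leb (\1_`[0, 1]%classic : RT -> R).
  by apply: integrable_indic_itv.
have shF t := vint_shift (t *: ebase j) sF'.
have sh : summable_fun (lebesgue_tuple n \x leb)%E h.
  apply: (@summable_prod2 _ _ _ _ _ (lebesgue_tuple n) leb h (fun t => \1_`[0, 1]%classic t * vint (fun y => `|F' y|))) => //.
  - move=> t; rewrite /h/=; have H := (shF t).1; exact: (summable_funZ _ H).
  - by under eq_fun do rewrite mulrC; exact: summable_funZ.
  - move=> t; rewrite /h/=.
    under eq_Rintegral do rewrite normrM.
    rewrite RintegralZl//; last by apply: summable_norm; exact: (shF t).1.
    have [_ E2] := vint_shift (t *: ebase j) (vsummable_norm sF').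
    rewrite (_ : \int[_]_x _ = vint (fun y => `|F' y|)) //.
    rewrite ger0_norm//; exact: indicE_ge0.
have cline y : continuous (fun t : R => F' (y + t *: ebase j)).
  move=> t; apply: (@continuous_comp _ _ _ (fun t : R => y + t *: ebase j) F'); last exact: cF'.
  apply: cvgD; first exact: cvg_cst.
  by apply: cvgZr_tmp; exact: cvg_id.
have dline y (t : R) : is_derive t (1 : R) (fun t : R => F (y + t *: ebase j)) (F' (y + t *: ebase j)).
  have [d <-] := dF (y + t *: ebase j).
  exact: derive_line.
have inner (y : n.-tuple RT) : \int[leb]_t (h (y, t)) = F (v y + ebase j) - F (v y).
  rewrite (_ : \int[_]_x _ = \int[leb]_(t in `[0, 1]) F' (v y + t *: ebase j)).
    rewrite /Rintegral (@continuous_FTC2 _ _ (fun t : R => F (v y + t *: ebase j))) //=.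
    - by rewrite scale1r scale0r addr0.
    - exact: continuous_subspaceT.
    - have cc : continuous (fun t : R => F (v y + t *: ebase j)).
        move=> t; apply: differentiable_continuous; apply/derivable1_diffP.
        by have [] := dline (v y) t.
      split; [|apply: cvg_at_right_filter; exact: cc|apply: cvg_at_left_filter; exact: cc].
      by move=> t _; have [] := dline (v y) t.
    - move=> t _; rewrite derive1E.
      by have [] := dline (v y) t.
  rewrite [RHS]Rintegral_mkcond; apply: eq_Rintegral => t _.
  by rewrite /h/= patchE indicE; case: ifPn => _; rewrite ?mul1r ?mul0r.
have := Rfubini sh.
under eq_Rintegral do rewrite inner.
have [sF1 E1] := vint_shift (ebase j) sF.
have := vintB sF1 sF; rewrite {1}/vint => ->.
rewrite E1 subrr /h/=.
have inner2 t : \int[lebesgue_tuple n]_x (\1_`[0, 1]%classic t * F' (v x + t *: ebase j)) =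
   \1_`[0, 1]%classic t * vint F'.
  rewrite RintegralZl//; last exact: (shF t).1.
  by rewrite -(shF t).2.
under eq_Rintegral do rewrite inner2.
rewrite RintegralZr// => /esym.
rewrite /Rintegral integral_indic//= setIT lebesgue_measure_itv/= lte_fin ltr01.
by rewrite oppr0 adde0/= mul1r.
Qed.

End euclidean_integrals.

(** * Gaussian densities *)

Section gaussian1.
Context (R : realType).
Local Notation leb := (@lebesgue_measure R).
Implicit Types (a b t x y z : R).

(* Signed standard deviations a are allowed, so that times range over R; the
   junk value at a = 0 is 0. *)
Definition gauss1 a t : R := normal_peak a * normal_fun 0 a t.

Lemma gauss1_ge0 a t : 0 <= gauss1 a t.
Proof. by rewrite mulr_ge0 ?normal_peak_ge0 ?normal_fun_ge0. Qed.

Lemma gauss1_subE a m t : a != 0 -> gauss1 a (t - m) = normal_pdf m a t.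
Proof. by move=> a0; rewrite normal_pdfE// /gauss1 /normal_fun subr0. Qed.

Lemma measurable_gauss1 a : measurable_fun [set: R] (gauss1 a).
Proof. by apply: measurable_funM => //; exact: measurable_normal_fun. Qed.

Lemma integral_gauss1_sub a m : a != 0 ->
  (\int[leb]_t (gauss1 a (t - m))%:E = 1)%E.
Proof.
move=> a0; rewrite -(integral_normal_pdf m a).
by apply: eq_integral => t _; rewrite gauss1_subE.
Qed.

Lemma integral_gauss1 a : a != 0 -> (\int[leb]_t (gauss1 a t)%:E = 1)%E.
Proof.
move=> a0; rewrite -(integral_gauss1_sub 0 a0).
by under [RHS]eq_integral do rewrite subr0.
Qed.

Lemma normal_peak_le a : a != 0 -> normal_peak a <= `|a|^-1.
Proof.
move=> a0; rewrite /normal_peak lef_pV2 ?posrE ?normr_gt0//; last first.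
  by rewrite sqrtr_gt0 mulrn_wgt0// mulr_gt0 ?pi_gt0// exprn_even_gt0.
rewrite -sqrtr_sqr ler_sqrt; last by rewrite mulrn_wge0// mulr_ge0 ?pi_ge0 ?sqr_ge0.
rewrite -mulr_natr -mulrA ler_peMr ?sqr_ge0//.
by have := pi_ge2 R; lra.
Qed.

Lemma normal_peakE a : normal_peak a = `|a|^-1 * (Num.sqrt (pi *+ 2))^-1.
Proof. by rewrite /normal_peak -mulrnAr sqrtrM ?sqr_ge0// sqrtr_sqr invfM. Qed.

Lemma normal_peakM a b s c : `|a| * `|b| = `|s| * `|c| ->
  normal_peak a * normal_peak b = normal_peak s * normal_peak c.
Proof.
move=> H; rewrite !normal_peakE mulrACA [RHS]mulrACA; congr (_ * _).
by rewrite -!invfM H.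
Qed.

(** Completing the square in y, with variances A and B: the centre is the weighted mean of x and z,
    and the new variance is A B / (A + B). *)
Lemma gauss_exponents (A B x y z : R) : A != 0 -> B != 0 -> A + B != 0 ->
  - (x - y) ^+ 2 / (B * 2) + - (y - z) ^+ 2 / (A * 2) =
  - (x - z) ^+ 2 / ((A + B) * 2) +
  - (y - (A * x + B * z) / (A + B)) ^+ 2 / (A * B / (A + B) * 2).
Proof. by move=> A0 B0 AB0; field; rewrite A0 B0 AB0. Qed.

Lemma gauss1_semigroup a b x y z : a != 0 -> b != 0 ->
  let s := Num.sqrt (a ^+ 2 + b ^+ 2) in
  gauss1 b (x - y) * gauss1 a (y - z) =
  gauss1 s (x - z) *
  gauss1 (a * b / s) (y - (a ^+ 2 * x + b ^+ 2 * z) / (a ^+ 2 + b ^+ 2)).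
Proof.
move=> a0 b0 s.
have a2 : 0 < a ^+ 2 by rewrite exprn_even_gt0.
have b2 : 0 < b ^+ 2 by rewrite exprn_even_gt0.
have s2 : s ^+ 2 = a ^+ 2 + b ^+ 2 by rewrite sqr_sqrtr// ltW// addr_gt0.
have s0 : s ^+ 2 != 0 by rewrite s2 gt_eqF// addr_gt0.
have s0' : s != 0 by apply: contra_neq s0 => ->; rewrite expr0n.
have E1 : (a * b / s) ^+ 2 = a ^+ 2 * b ^+ 2 / (a ^+ 2 + b ^+ 2).
  by rewrite -s2 exprMn exprMn exprVn.
rewrite /gauss1 mulrACA [RHS]mulrACA; congr (_ * _).
  by apply: normal_peakM; rewrite -!normrM; congr `|_|; rewrite mulrC mulrCA mulfV// mulr1.
rewrite /normal_fun !subr0 -!expRD; congr expR.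
rewrite E1 s2 -[(b ^+ 2) *+ 2]mulr_natr -[(a ^+ 2) *+ 2]mulr_natr.
rewrite -[(_ + _) *+ 2]mulr_natr -[(_ / _) *+ 2]mulr_natr.
by apply: gauss_exponents; rewrite gt_eqF// addr_gt0.
Qed.

(** With u = |t| / |a| the product is at most u exp(- u^2 / 2), and u <= 1 + u^2 / 2 <= exp(u^2 /
    2). *)
Lemma abs_gauss1_le1 a t : `|t| * gauss1 a t <= 1.
Proof.
have [->|a0] := eqVneq a 0.
  by rewrite /gauss1 /normal_peak expr0n/= mul0r mul0rn sqrtr0 invr0 mul0r mulr0.
have A0 : 0 < `|a| by rewrite normr_gt0.
have N0 : 0 <= normal_fun 0 a t by exact: normal_fun_ge0.
have H1 : `|t| * gauss1 a t <= `|t| / `|a| * normal_fun 0 a t.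
  rewrite /gauss1 mulrA ler_wpM2r// ler_wpM2l//.
  exact: normal_peak_le.
apply: (le_trans H1); rewrite /normal_fun subr0.
set u := `|t| / `|a|.
have -> : - t ^+ 2 / (a ^+ 2 *+ 2) = - (u ^+ 2 / 2).
  rewrite /u exprMn exprVn !real_normK ?num_real// -mulr_natr; field.
  by rewrite a0.
rewrite expRN ler_pdivrMr ?expR_gt0// mul1r.
have := expR_ge1Dx (u ^+ 2 / 2).
have : 0 <= (u - 1) ^+ 2 by exact: sqr_ge0.
rewrite sqrrB1; lra.
Qed.

End gaussian1.

Section gaussian.
Context (R : realType) (n : nat).
Local Notation RT := (measurableTypeR R).
Local Notation E := 'rV[R]_n.
Local Notation v := (@rV_of_tuple R n).
Local Notation e_ j := (@ebase R n j).
Implicit Types (a b : R) (w x y z : E) (j : 'I_n).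

Definition sqn w : R := \sum_(i < n) w ord0 i ^+ 2.

Definition gauss a w : R := normal_peak a ^+ n * expR (- sqn w / (a ^+ 2 *+ 2)).
Definition dgauss j a w : R := - (w ord0 j / a ^+ 2) * gauss a w.
Definition d2gauss j a w : R := ((w ord0 j / a ^+ 2) ^+ 2 - a ^- 2) * gauss a w.

Lemma sqn_ge0 w : 0 <= sqn w.
Proof. by apply: sumr_ge0 => i _; exact: sqr_ge0. Qed.

Lemma sqn_coord w j : w ord0 j ^+ 2 <= sqn w.
Proof.
by rewrite /sqn (bigD1 j)//= lerDl; apply: sumr_ge0 => i _; exact: sqr_ge0.
Qed.

Lemma gauss_ge0 a w : 0 <= gauss a w.
Proof. by rewrite mulr_ge0 ?exprn_ge0 ?normal_peak_ge0 ?expR_ge0. Qed.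

Lemma gauss_prod a w : gauss a w = \prod_(i < n) gauss1 a (w ord0 i).
Proof.
rewrite /gauss1 big_split/= prodr_const card_ord; congr (_ * _).
rewrite /normal_fun -expR_sum; congr expR.
rewrite /sqn -sumrN mulr_suml; apply: eq_bigr => i _; by rewrite subr0.
Qed.

Lemma normal_peak0 : normal_peak (0 : R) = 0.
Proof. by rewrite /normal_peak expr0n/= mul0r mul0rn sqrtr0 invr0. Qed.

Lemma gauss0 w : (0 < n)%N -> gauss 0 w = 0.
Proof. by move=> n0; rewrite /gauss normal_peak0 expr0n gtn_eqF// mul0r. Qed.

Lemma sqnN w : sqn (- w) = sqn w.
Proof. by apply: eq_bigr => i _; rewrite mxE sqrrN. Qed.

Lemma gaussN a w : gauss a (- w) = gauss a w.
Proof. by rewrite /gauss sqnN. Qed.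

Lemma dgaussN j a w : dgauss j a (- w) = - dgauss j a w.
Proof. by rewrite /dgauss gaussN mxE !mulNr opprK. Qed.

Lemma gauss_sqr a b w : a ^+ 2 = b ^+ 2 -> gauss a w = gauss b w.
Proof. by move=> ab; rewrite /gauss /normal_peak ab. Qed.

Lemma measurable_gauss d (T : measurableType d) (A : T -> R) (W : T -> E) :
  measurable_fun [set: T] A ->
  (forall i, measurable_fun [set: T] (fun t => W t ord0 i)) ->
  measurable_fun [set: T] (fun t => gauss (A t) (W t)).
Proof.
move=> mA mW; apply: measurable_funM.
  apply: measurable_funX; apply: measurable_fun_inv => [|x]; last exact: sqrtr_ge0.
  apply: (measurableT_comp (continuous_measurable_fun (@sqrt_continuous R))).
  under eq_fun do rewrite -mulr_natr.
  apply: measurable_funM => //; apply: measurable_funM => //.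
  exact: measurable_funX.
apply: (measurableT_comp (@measurable_expR R)).
apply: measurable_funM.
  apply: measurable_funN; apply: measurable_sum => i.
  exact: measurable_funX.
apply: measurable_fun_inv => [|x].
  under eq_fun do rewrite -mulr_natr.
  by apply: measurable_funM => //; exact: measurable_funX.
by rewrite mulrn_wge0// sqr_ge0.
Qed.

Lemma measurable_coordV d (T : measurableType d) (A : T -> R) (W : T -> E) j :
  measurable_fun [set: T] A ->
  (forall i, measurable_fun [set: T] (fun t => W t ord0 i)) ->
  measurable_fun [set: T] (fun t => W t ord0 j / A t ^+ 2).
Proof.
move=> mA mW; apply: measurable_funM => //.
apply: measurable_fun_inv => [|x]; last exact: sqr_ge0.
exact: measurable_funX.
Qed.

Lemma measurable_dgauss d (T : measurableType d) (A : T -> R) (W : T -> E) j :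
  measurable_fun [set: T] A ->
  (forall i, measurable_fun [set: T] (fun t => W t ord0 i)) ->
  measurable_fun [set: T] (fun t => dgauss j (A t) (W t)).
Proof.
move=> mA mW; apply: measurable_funM; last exact: measurable_gauss.
by apply: measurable_funN; exact: measurable_coordV.
Qed.

Lemma measurable_d2gauss d (T : measurableType d) (A : T -> R) (W : T -> E) j :
  measurable_fun [set: T] A ->
  (forall i, measurable_fun [set: T] (fun t => W t ord0 i)) ->
  measurable_fun [set: T] (fun t => d2gauss j (A t) (W t)).
Proof.
move=> mA mW; apply: measurable_funM; last exact: measurable_gauss.
apply: measurable_funB; first by apply: measurable_funX; exact: measurable_coordV.
apply: measurable_fun_inv => [|x]; last exact: sqr_ge0.
exact: measurable_funX.
Qed.

Lemma continuous_coord i : continuous (fun w : E => w ord0 i).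
Proof. exact: coord_continuous. Qed.

Lemma continuous_mul (F G : E -> R) : continuous F -> continuous G ->
  continuous (fun x => F x * G x).
Proof. by move=> cF cG x; exact: (cvgM (cF x) (cG x)). Qed.

Lemma continuous_add (F G : E -> R) : continuous F -> continuous G ->
  continuous (fun x => F x + G x).
Proof. by move=> cF cG x; exact: (cvgD (cF x) (cG x)). Qed.

Lemma continuous_opp (F : E -> R) : continuous F -> continuous (fun x => - F x).
Proof. by move=> cF x; exact: (cvgN (cF x)). Qed.

Lemma continuous_cst (c : R) : continuous (fun x : E => c).
Proof. exact: cst_continuous. Qed.

Lemma continuous_sum (I : Type) (s : seq I) (F : I -> E -> R) :
  (forall i, continuous (F i)) -> continuous (fun x => \sum_(i <- s) F i x).
Proof.
move=> cF; elim: s => [|i s IH].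
  by under eq_fun do rewrite big_nil; exact: continuous_cst.
by under eq_fun do rewrite big_cons; exact: continuous_add.
Qed.

Lemma continuous_sqn : continuous sqn.
Proof.
by apply: continuous_sum => i; apply: continuous_mul; exact: continuous_coord.
Qed.

Lemma continuous_gauss a : continuous (gauss a).
Proof.
apply: continuous_mul; first exact: continuous_cst.
have cs : continuous (fun w => - sqn w / (a ^+ 2 *+ 2)).
  by apply: continuous_mul; [apply/continuous_opp/continuous_sqn|exact: continuous_cst].
by move=> w; exact: (cvg_comp _ _ (cs w) (@continuous_expR R _)).
Qed.

Lemma continuous_dgauss j a : continuous (dgauss j a).
Proof.
apply: continuous_mul; last exact: continuous_gauss.
by apply/continuous_opp/continuous_mul; [exact: continuous_coord|exact: continuous_cst].
Qed.

Lemma continuous_d2gauss j a : continuous (d2gauss j a).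
Proof.
apply: continuous_mul; last exact: continuous_gauss.
apply: continuous_add; last by apply/continuous_opp/continuous_cst.
by apply: continuous_mul; apply: continuous_mul;
  [exact: continuous_coord|exact: continuous_cst|exact: continuous_coord|exact: continuous_cst].
Qed.

Lemma is_derive_affine (k c t : R) : is_derive t (1 : R) (fun s : R => k + c * s) c.
Proof.
rewrite (_ : (fun s => _) = cst k + c \*: id); last by apply/funext.
by apply: is_derive_eq; rewrite add0r [LHS]mulr1.
Qed.

Lemma is_derive_coord w i j :
  is_derive w (e_ j) (fun w : E => w ord0 i) (i == j)%:R.
Proof.
apply: is_derive_line.
rewrite (_ : (fun s : R => _) = (fun s : R => w ord0 i + (i == j)%:R * s)).
  exact: is_derive_affine.
by apply/funext => s; rewrite mxE [X in _ + X]mxE ebaseE mulrC.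
Qed.

Lemma is_derive_sqn w j : is_derive w (e_ j) sqn (2 * w ord0 j).
Proof.
have H i := @is_deriveX _ _ _ 2 _ _ _ (is_derive_coord w i j).
have := is_derive_sum H.
rewrite (_ : \sum_(i < n) _ = sqn); last first.
  by apply/funext => x; rewrite fct_sumE.
move/is_derive_eq; apply.
rewrite (bigD1 j)//= big1 => [|i /negbTE ->]; last by rewrite scaler0.
by rewrite eqxx addr0 expr1 [LHS]mulr1.
Qed.

Lemma is_derive_gauss a w j : is_derive w (e_ j) (gauss a) (dgauss j a w).
Proof.
apply: is_derive_line.
have [ds es] := is_derive_sqn w j.
have dl := @derive_line R n sqn w (e_ j) 0.
rewrite scale0r addr0 es in dl; have {}dl := dl ds.
have de : is_derive (0 : R) (1 : R)
  (expR \o (fun s : R => (- (a ^+ 2 *+ 2)^-1) *: sqn (w + s *: e_ j)))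
  (expR ((- (a ^+ 2 *+ 2)^-1) *: sqn (w + (0 : R) *: e_ j)) * ((- (a ^+ 2 *+ 2)^-1) *: (2 * w ord0 j))).
  exact: is_derive1_comp.
have := @is_deriveZ _ _ _ _ (normal_peak a ^+ n) _ _ _ de.
rewrite (_ : _ \*: _ = (fun s : R => gauss a (w + s *: e_ j))); last first.
  apply/funext => s; rewrite /gauss; congr (_ * expR _).
  by rewrite [LHS]mulNr mulrC -mulNr.
move/is_derive_eq; apply.
rewrite scale0r addr0 /dgauss /gauss /GRing.scale/=.
rewrite -[(a ^+ 2) *+ 2]mulr_natr invfM.
rewrite [X in expR X](_ : _ = - sqn w / (a ^+ 2 * 2)); last first.
  by rewrite [in RHS]invfM !mulNr mulrC.
rewrite invfM.
have -> : - (a ^- 2 / 2) * (2 * w ord0 j) = - (w ord0 j / a ^+ 2).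
  by rewrite mulNr; congr (- _); rewrite -mulrA mulKf// mulrC.
by rewrite mulrA mulrC.
Qed.

Lemma is_derive_dgauss a w j : is_derive w (e_ j) (dgauss j a) (d2gauss j a w).
Proof.
have dg := is_derive_gauss a w j.
have dc := @is_deriveZ _ _ _ _ (- (a ^+ 2)^-1) _ _ _ (is_derive_coord w j j).
have := is_deriveM dc dg.
rewrite (_ : _ * _ = dgauss j a); last first.
  apply/funext => x; rewrite /dgauss; congr (_ * _).
  by rewrite [LHS]mulNr mulrC.
move/is_derive_eq; apply.
rewrite (_ : (_ \*: _) w = - a ^- 2 * w ord0 j)//.
rewrite /d2gauss /dgauss /GRing.scale/= eqxx/=.
by set A := a ^- 2; ring.
Qed.


Lemma vsummable_gauss a : a != 0 -> vsummable (gauss a).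
Proof.
move=> a0.
have [+ _] := @vsummable_prod R n (fun=> gauss1 a) (fun=> 1) (fun=> measurable_gauss1 a)
  (fun _ => gauss1_ge0 a) (fun=> integral_gauss1 a0).
by congr vsummable; apply/funext => w; rewrite gauss_prod.
Qed.

Lemma vint_gauss a : a != 0 -> vint (gauss a) = 1.
Proof.
move=> a0.
have [_] := @vsummable_prod R n (fun=> gauss1 a) (fun=> 1) (fun=> measurable_gauss1 a)
  (fun _ => gauss1_ge0 a) (fun=> integral_gauss1 a0).
rewrite big1// => <-.
by congr vint; apply/funext => w; rewrite gauss_prod.
Qed.

(** Coordinate by coordinate: in [gauss1_semigroup] the variable y survives only in the second
    factor, a density of mass 1. *)
Lemma gauss_semigroup a b x z : a != 0 -> b != 0 ->
  vsummable (fun y => gauss b (x - y) * gauss a (y - z)) /\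
  vint (fun y => gauss b (x - y) * gauss a (y - z)) =
  gauss (Num.sqrt (a ^+ 2 + b ^+ 2)) (x - z).
Proof.
move=> a0 b0.
pose s := Num.sqrt (a ^+ 2 + b ^+ 2); pose c := a * b / s.
have s0 : s != 0.
  by rewrite gt_eqF// sqrtr_gt0 addr_gt0// exprn_even_gt0.
have c0 : c != 0 by rewrite mulf_neq0 ?mulf_neq0 ?invr_neq0.
pose m (i : 'I_n) := (a ^+ 2 * x ord0 i + b ^+ 2 * z ord0 i) / (a ^+ 2 + b ^+ 2).
pose f (i : 'I_n) (t : R) := gauss1 c (t - m i).
have mf i : measurable_fun [set: RT] (f i).
  by apply: (measurableT_comp (measurable_gauss1 c)); exact: measurable_funB.
have [sf vf] := @vsummable_prod R n f (fun=> 1) mf (fun i t => gauss1_ge0 c _)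
  (fun i => integral_gauss1_sub (m i) c0).
have E1 : (fun y => gauss b (x - y) * gauss a (y - z)) =
    (fun y => gauss s (x - z) * \prod_(i < n) f i (y ord0 i)).
  apply/funext => y; rewrite !gauss_prod -!big_split/=; apply: eq_bigr => i _.
  by rewrite !mxE gauss1_semigroup.
rewrite E1; split; first exact: vsummableZ.
by rewrite vintZ// vf big1// mulr1.
Qed.

Let sqrt2 : R := Num.sqrt 2.

Let sqrt2_gt0 : 0 < sqrt2. Proof. by rewrite sqrtr_gt0. Qed.

Let sqr_sqrt2 : sqrt2 ^+ 2 = 2. Proof. by rewrite sqr_sqrtr. Qed.

(** The factor 4 comes from q exp(- q) <= 1 with q = |w|^2 / (4 a^2), and the power of the square
    root of 2 is the ratio of the peaks of [gauss a] and [gauss (sqrt2 * a)]. *)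
Definition gauss_const : R := 4 * sqrt2 ^+ n.

Lemma gauss_const_ge0 : 0 <= gauss_const.
Proof. by rewrite mulr_ge0// exprn_ge0// ltW. Qed.

(* Half of the exponential absorbs the quadratic factor. *)
Lemma sqn_gauss_le a w : a != 0 ->
  sqn w * gauss a w <= gauss_const * a ^+ 2 * gauss (sqrt2 * a) w.
Proof.
move=> a0; have a2 : 0 < a ^+ 2 by rewrite exprn_even_gt0.
have Ep : normal_peak a = sqrt2 * normal_peak (sqrt2 * a).
  rewrite !normal_peakE normrM invfM (gtr0_norm sqrt2_gt0) -!mulrA mulVKf//.
  by rewrite gt_eqF.
set q := sqn w / (a ^+ 2 * 4).
have Ee : expR (- sqn w / (a ^+ 2 *+ 2)) = expR (- q) * expR (- sqn w / ((sqrt2 * a) ^+ 2 *+ 2)).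
  rewrite -expRD; congr expR; rewrite exprMn sqr_sqrt2 -[a ^+ 2 *+ 2]mulr_natr -[(2 * a ^+ 2) *+ 2]mulr_natr /q.
  by move: (a ^+ 2) a2 => A A0; field; rewrite gt_eqF.
rewrite /gauss Ee Ep exprMn /gauss_const.
set P := normal_peak _ ^+ n; set X := expR (- sqn w / _).
have P0 : 0 <= P by rewrite exprn_ge0// normal_peak_ge0.
have X0 : 0 <= X by exact: expR_ge0.
have S0 : 0 <= sqrt2 ^+ n by rewrite exprn_ge0// ltW.
have H : sqn w * expR (- q) <= 4 * a ^+ 2.
  have -> : sqn w = q * (a ^+ 2 * 4) by rewrite divfK// mulf_neq0// gt_eqF.
  have H0 : q * expR (- q) <= 1.
    rewrite expRN ler_pdivrMr ?expR_gt0// mul1r.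
    by have := expR_ge1Dx q; lra.
  rewrite [leLHS](_ : _ = 4 * a ^+ 2 * (q * expR (- q))); last by ring.
  by rewrite ler_piMr// mulr_ge0// ltW.
rewrite [leLHS](_ : _ = sqn w * expR (- q) * (sqrt2 ^+ n * P * X)); last by ring.
rewrite [leRHS](_ : _ = 4 * a ^+ 2 * (sqrt2 ^+ n * P * X)); last by ring.
by rewrite ler_wpM2r// !mulr_ge0.
Qed.

Lemma sqrt2M_neq0 a : a != 0 -> sqrt2 * a != 0.
Proof. by move=> a0; rewrite mulf_neq0// gt_eqF. Qed.

Lemma measurable_gauss_tuple a x :
  measurable_fun [set: n.-tuple RT] (fun t => gauss a (x - v t)).
Proof.
apply: measurable_gauss => // i; under eq_fun do rewrite mxE [X in _ + X]mxE.
by apply: measurable_funB => //; exact: measurable_coord_tuple.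
Qed.

Lemma vsummable_cont_le (F G : E -> R) : continuous F ->
  (forall y, `|F y| <= G y) -> vsummable G -> vsummable F.
Proof.
move=> cF FG sG; apply: (summable_le _ _ sG); last by move=> t; exact: FG.
exact: measurable_continuous_tuple.
Qed.

Lemma vsummable_dgauss j a : a != 0 -> vsummable (dgauss j a).
Proof.
move=> a0; have a2 : 0 < a ^+ 2 by rewrite exprn_even_gt0.
apply: (@vsummable_cont_le _ (fun w => a ^- 2 * (gauss a w + gauss_const * a ^+ 2 * gauss (sqrt2 * a) w))).
- exact: continuous_dgauss.
- move=> w; have av0 : 0 <= a ^- 2 by rewrite invr_ge0 sqr_ge0.
  rewrite /dgauss normrM normrN normrM (ger0_norm av0) (ger0_norm (gauss_ge0 _ _)).
  rewrite mulrAC mulrC; apply: ler_wpM2l => //.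
  apply: le_trans (lerD (lexx _) (sqn_gauss_le w a0)).
  rewrite -[X in _ <= X + _]mul1r -mulrDl ler_wpM2r ?gauss_ge0//.
  have := sqn_coord w j; have := sqr_ge0 (`|w ord0 j| - 1).
  rewrite -(real_normK (num_real (w ord0 j))) sqrrB1 => H1 H2.
  have := normr_ge0 (w ord0 j) => H3; nra.
- apply: vsummableZ; apply: vsummableD; first exact: vsummable_gauss.
  by apply: vsummableZ; apply: vsummable_gauss; exact: sqrt2M_neq0.
Qed.

(** The majorant is a^-2 times a combination of two densities of mass 1, hence the L^1 norm of order
    a^-2 in [vint_d2gauss_le]. *)
Lemma d2gauss_le j a w : a != 0 ->
  `|d2gauss j a w| <= a ^- 2 * (gauss_const * gauss (sqrt2 * a) w + gauss a w).
Proof.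
move=> a0; have a2 : 0 < a ^+ 2 by rewrite exprn_even_gt0.
rewrite /d2gauss normrM (ger0_norm (gauss_ge0 _ _)).
apply: (@le_trans _ _ (a ^- 2 * (a ^- 2 * sqn w + 1) * gauss a w)).
  rewrite ler_wpM2r ?gauss_ge0//.
  apply: (le_trans (ler_normB _ _)).
  have av0 : 0 <= a ^- 2 by rewrite invr_ge0 sqr_ge0.
  rewrite (ger0_norm (sqr_ge0 _)) (ger0_norm av0) mulrDr mulr1 lerD2r.
  rewrite exprMn mulrC mulrA -expr2 ler_wpM2l ?sqr_ge0//.
  exact: sqn_coord.
rewrite -mulrA; apply: ler_wpM2l; first by rewrite invr_ge0 sqr_ge0.
rewrite mulrDl mul1r lerD2r -mulrA ler_pdivrMl//.
by apply: (le_trans (sqn_gauss_le w a0)); rewrite [leRHS]mulrCA mulrA.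
Qed.

Lemma vsummable_d2gauss j a : a != 0 -> vsummable (d2gauss j a).
Proof.
move=> a0; apply: (vsummable_cont_le (@continuous_d2gauss j a) (fun w => d2gauss_le j w a0)).
apply: vsummableZ; apply: vsummableD; last exact: vsummable_gauss.
by apply: vsummableZ; apply: vsummable_gauss; exact: sqrt2M_neq0.
Qed.

Lemma vint_d2gauss_le j a : a != 0 ->
  vint (fun w => `|d2gauss j a w|) <= (gauss_const + 1) * a ^- 2.
Proof.
move=> a0.
have s1 := vsummable_gauss (sqrt2M_neq0 a0).
have s2 := vsummable_gauss a0.
have := vint_le (vsummable_norm (vsummable_d2gauss j a0))
  (vsummableZ (a ^- 2) (vsummableD (vsummableZ gauss_const s1) s2))
  (fun w => d2gauss_le j w a0).
move/le_trans; apply.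
rewrite vintZ; last by apply: vsummableD => //; exact: vsummableZ.
rewrite vintD//; last exact: vsummableZ.
by rewrite vintZ// !vint_gauss ?sqrt2M_neq0// mulr1 mulrC.
Qed.

Lemma sqn_gauss_sum a : a != 0 -> vsummable (fun w => sqn w * gauss a w) /\
  vint (fun w => sqn w * gauss a w) <= gauss_const * a ^+ 2.
Proof.
move=> a0; have s1 := vsummable_gauss (sqrt2M_neq0 a0).
have ss : vsummable (fun w => sqn w * gauss a w).
  apply: (@vsummable_cont_le _ (fun w => gauss_const * a ^+ 2 * gauss (sqrt2 * a) w)).
  - by apply: continuous_mul; [exact: continuous_sqn|exact: continuous_gauss].
  - move=> w; rewrite ger0_norm; first exact: sqn_gauss_le.
    by apply: mulr_ge0; [exact: sqn_ge0|exact: gauss_ge0].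
  - exact: vsummableZ.
split=> //.
apply: (le_trans (vint_le ss (vsummableZ (gauss_const * a ^+ 2) s1) (fun w => sqn_gauss_le w a0))).
by rewrite vintZ// vint_gauss ?sqrt2M_neq0// mulr1.
Qed.

Lemma gauss1_le a t : gauss1 a t <= `|a|^-1.
Proof.
have [->|a0] := eqVneq a 0; first by rewrite /gauss1 normal_peak0 mul0r normr0 invr0.
rewrite /gauss1 -[leRHS]mulr1; apply: ler_pM; rewrite ?normal_peak_ge0 ?normal_fun_ge0//.
  exact: normal_peak_le.
rewrite /normal_fun -[leRHS]expR0 ler_expR mulNr oppr_le0.
by rewrite divr_ge0 ?sqr_ge0 ?mulrn_wge0 ?sqr_ge0.
Qed.

Lemma gauss_le a w : gauss a w <= `|a| ^- n.
Proof.
rewrite gauss_prod -exprVn -[in leRHS](card_ord n) -prodr_const.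
by apply: ler_prod => i _; rewrite gauss1_ge0 gauss1_le.
Qed.

(** Dimension at least two makes the sup norm decay like a^-2, which is integrable at infinity. *)
Lemma gauss_le_sqr a w : (1 < n)%N -> 1 <= `|a| -> gauss a w <= a ^- 2.
Proof.
move=> n1 a1; apply: (le_trans (gauss_le a w)).
rewrite -(real_normK (num_real a)) -!exprVn.
apply: ler_wiXn2l => //.
by rewrite invf_le1// (lt_le_trans ltr01).
Qed.

(** The j-th factor of the product absorbs the coordinate by [abs_gauss1_le1]; the others are at
    most 1 / |a|. *)
Lemma abs_coord_gauss_le1 a w j : 1 <= `|a| -> `|w ord0 j| * gauss a w <= 1.
Proof.
move=> a1; rewrite gauss_prod (bigD1 j)//= mulrA -[leRHS]mulr1.
have aV1 : `|a|^-1 <= 1 by rewrite invf_le1// (lt_le_trans ltr01).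
have P0 : 0 <= \prod_(i < n | i != j) gauss1 a (w ord0 i).
  by apply: prodr_ge0 => i _; exact: gauss1_ge0.
apply: ler_pM => //; first by rewrite mulr_ge0 ?gauss1_ge0.
  exact: abs_gauss1_le1.
apply: (@le_trans _ _ (\prod_(i < n | i != j) 1)); last by rewrite big1.
by apply: ler_prod => i _; rewrite gauss1_ge0/= (le_trans (gauss1_le _ _)).
Qed.

(** The heat equation in terms of the standard deviation: the density of variance t satisfies d_t =
    Laplacian / 2, and t = a^2 gives the factor a. *)
Lemma is_derive_gauss_std a w : 0 < a ->
  is_derive a (1 : R) (fun s : R => gauss s w) (a * \sum_(j < n) d2gauss j a w).
Proof.
move=> a0.
pose K : R := (Num.sqrt (pi *+ 2))^-1.
pose f : R -> R := (fun s => (s^-1 * K) ^+ n * expR (- sqn w / 2 * s^-1 ^+ 2)).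
have aN0 : a != 0 by rewrite gt_eqF.
have near_eq : \near a, f a = gauss a w.
  near=> s.
  have s0 : 0 < s by near: s; exact: lt_nbhsr.
  rewrite /f /gauss normal_peakE gtr0_norm//; congr (_ * expR _).
  by rewrite -[(s ^+ 2) *+ 2]mulr_natr invfM exprVn -mulrA (mulrC 2^-1).
have dV : is_derive a (1 : R) (fun s : R => s^-1) (- a ^- 2).
  have di : derivable (id : R -> R) a 1 by [].
  apply: DeriveDef; first exact: (@derivableV R R id a 1 aN0 di).
  by rewrite (@deriveV R R id a 1 aN0 di) derive_id [LHS]mulr1.
have d1 := @is_deriveX _ _ _ n _ _ _ (is_deriveM dV (is_derive_cst K a (1 : R))).
have d2 := is_deriveZ (- sqn w / 2) (@is_deriveX _ _ _ 2 _ _ _ dV).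
have d3 := is_derive1_comp (is_derive_expR _) d2.
have := is_deriveM d1 d3.
rewrite (_ : _ * _ = f); last by apply/funext => s; rewrite /f !fctE.
move=> df.
apply: (near_eq_is_derive near_eq); apply: (is_derive_eq df).
rewrite !fctE /GRing.scale/= /f /d2gauss -mulr_suml mulrA.
rewrite -(nbhs_singleton near_eq) /f.
(* For n = 0 both sides vanish, so the truncated exponent [n.-1] is harmless. *)
have E1 : n%:R * (a^-1 * K) ^+ n.-1 * K = n%:R * a * (a^-1 * K) ^+ n.
  case: (n) => [|m]; first by rewrite !mul0r.
  by rewrite /= exprS; move: (_ ^+ m) => Q; field.
have ES : \sum_(i < n) ((w ord0 i / a ^+ 2) ^+ 2 - a ^- 2) = sqn w * (a ^- 2) ^+ 2 - n%:R * a ^- 2.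
  rewrite sumrB sumr_const card_ord mulr_natl /sqn mulr_suml; congr (_ - _).
  by apply: eq_bigr => i _; rewrite exprMn.
rewrite ES /GRing.scale/= mulr0 add0r expr1.
set P := (a^-1 * K) ^+ n in E1 *; set X := expR _.
rewrite [X in _ + X](_ : _ = X * (n%:R * (a^-1 * K) ^+ n.-1 * K) * (- a ^- 2)); last by ring.
rewrite E1; clearbody P X; clear -aN0.
by move: (sqn w) (n%:R : R) => S N; field.
Unshelve. all: by end_near.
Qed.

End gaussian.

(** * Substitution on the half-line *)

Section half_line.
Context (R : realType).
Local Notation leb := (@lebesgue_measure R).
Local Notation pR := (`]0, +oo[%classic : set R).
Implicit Types (f g F G : R -> R) (p q : nat -> R).

Lemma cvg_integral_exhaust f p q : measurable_fun pR f -> (forall x : R, 0 < x -> 0 <= f x) ->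
  (forall k, 0 < p k) -> (forall k l, (k <= l)%N -> p l <= p k) ->
  (forall k l, (k <= l)%N -> q k <= q l) ->
  (forall x : R, 0 < x -> exists k, p k <= x <= q k) ->
  (\int[leb]_(x in `[p k, q k]) (f x)%:E)%E @[k --> \oo] -->
  (\int[leb]_(x in pR) (f x)%:E)%E.
Proof.
move=> mf f0 p0 dp dq ex.
have sub k : `[p k, q k]%classic `<=` pR.
  by move=> x; rewrite /= !in_itv/= andbT => /andP[px _]; exact: lt_le_trans px.
have -> : pR = \bigcup_k `[p k, q k]%classic.
  apply/seteqP; split => [x|x [k _] /sub//].
  by rewrite /= in_itv/= andbT => /ex[k pq]; exists k => //=.
apply: ge0_nondecreasing_set_cvg_integral.
- move=> k l kl; apply/subsetPset => x; rewrite /= !in_itv/= => /andP[px xq].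
  by rewrite (le_trans (dp _ _ kl))//= (le_trans xq)// dq.
- by move=> k; exact: measurable_itv.
- move=> k; apply: measurable_funS (sub k) _ => //.
  exact/measurable_EFinP.
- move=> k x /sub; rewrite /= in_itv/= andbT => x0.
  by rewrite lee_fin f0.
Qed.

Lemma natSinv_le (k l : nat) : (k <= l)%N -> (l.+1%:R^-1 : R) <= k.+1%:R^-1.
Proof. by move=> kl; rewrite lef_pV2 ?posrE// ler_nat. Qed.

Lemma natS_le (k l : nat) : (k <= l)%N -> (k.+1%:R : R) <= l.+1%:R.
Proof. by move=> kl; rewrite ler_nat. Qed.

Lemma natSinv_gt0 (k : nat) : (0 : R) < k.+1%:R^-1.
Proof. by rewrite invr_gt0. Qed.

Lemma natSinv_exhaust (x : R) : 0 < x -> exists k : nat, k.+1%:R^-1 <= x <= k.+1%:R.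
Proof.
move=> x0; exists (Num.truncn (x + x^-1)).
have H : x + x^-1 < (Num.truncn (x + x^-1)).+1%:R by exact: truncnS_gt.
set N := _.+1%:R in H *; have N0 : 0 < N by [].
apply/andP; split.
  rewrite -(invrK x) lef_pV2 ?posrE ?invr_gt0//.
  by apply: ltW; apply: lt_trans H; rewrite ltrDr.
by apply: ltW; apply: lt_trans H; rewrite ltrDl invr_gt0.
Qed.

(** Reduces substitution on the half-line to compact segments: [p k] and [q k] will be the images of
    1 / (k + 1) and k + 1, in the order that the monotonicity dictates. *)
Lemma integral_exhaust_eq f g p q : measurable_fun pR f -> (forall x : R, 0 < x -> 0 <= f x) ->
  measurable_fun pR g -> (forall x : R, 0 < x -> 0 <= g x) ->
  (forall k, 0 < p k) -> (forall k l, (k <= l)%N -> p l <= p k) ->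
  (forall k l, (k <= l)%N -> q k <= q l) ->
  (forall x : R, 0 < x -> exists k, p k <= x <= q k) ->
  (forall k, \int[leb]_(x in `[p k, q k]) (f x)%:E =
     \int[leb]_(x in `[(k.+1%:R^-1)%R, k.+1%:R%R]) (g x)%:E)%E ->
  (\int[leb]_(x in pR) (f x)%:E = \int[leb]_(x in pR) (g x)%:E)%E.
Proof.
move=> mf f0 mg g0 p0 dp dq ex fg.
have cf := cvg_integral_exhaust mf f0 p0 dp dq ex.
have cg := cvg_integral_exhaust mg g0 natSinv_gt0 natSinv_le natS_le natSinv_exhaust.
rewrite -(cvg_lim _ cf)// -[RHS](cvg_lim _ cg)//.
by congr (lim (_ @ \oo)); apply/funext => k; rewrite fg.
Qed.

Section substitution.
Variables (F F' G : R -> R).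
Hypothesis dF : forall x : R, 0 < x -> is_derive x (1 : R) F (F' x).
Hypothesis cF' : forall x : R, 0 < x -> {for x, continuous F'}.
Hypothesis F0 : forall x : R, 0 < x -> 0 < F x.
Hypothesis surjF : forall s : R, 0 < s -> exists2 x, 0 < x & F x = s.
Hypothesis cG : forall s : R, 0 < s -> {for s, continuous G}.
Hypothesis G0 : forall s : R, 0 < s -> 0 <= G s.

Let FE (x : R) : 0 < x -> (F^`())%classic x = F' x.
Proof. by move=> x0; rewrite derive1E; have [_ ->] := dF x0. Qed.

Let cFE (x : R) : 0 < x -> {for x, continuous (F^`())%classic}.
Proof.
move=> x0; rewrite /prop_for /continuous_at FE//.
apply: cvg_trans (cF' x0); apply: near_eq_cvg.
by near=> y; rewrite FE//; near: y; exact: lt_nbhsr.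
Unshelve. all: by end_near. Qed.

Let cF (x : R) : 0 < x -> {for x, continuous F}.
Proof.
move=> x0; apply: differentiable_continuous; apply/derivable1_diffP.
by have [] := dF x0.
Qed.

Let cont_meas (h : R -> R) : (forall x : R, 0 < x -> {for x, continuous h}) ->
  measurable_fun pR h.
Proof.
move=> ch; apply: open_continuous_measurable_fun; first exact: interval_open.
by move=> x; rewrite inE/= in_itv/= andbT; exact: ch.
Qed.

Let mG : measurable_fun pR G. Proof. exact: cont_meas. Qed.

Let dFc (a b : R) : 0 < a -> a < b -> derivable_oo_LRcontinuous F a b.
Proof.
move=> a0 ab; split.
- move=> x; rewrite in_itv/= => /andP[ax _].
  by have [] := dF (lt_trans a0 ax).
- by apply: cvg_at_right_filter; exact: cF.
- by apply: cvg_at_left_filter; apply: cF; exact: lt_trans ab.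
Qed.

Let cGw (a b : R) : 0 < a -> {within `[a, b], continuous G}.
Proof.
move=> a0; apply: continuous_in_subspaceT => x.
by rewrite inE/= in_itv/= => /andP[ax _]; apply: cG; exact: lt_le_trans ax.
Qed.

Let kk (k : nat) : (k.+1%:R^-1 : R) <= k.+1%:R.
Proof.
apply: (@le_trans _ _ 1); last by rewrite ler1n.
by rewrite invf_le1// ler1n.
Qed.

Lemma integral_subst_dec : (forall x y : R, 0 < x -> x < y -> F y < F x) ->
  (forall x : R, 0 < x -> F' x <= 0) ->
  (\int[leb]_(s in pR) (G s)%:E = \int[leb]_(x in pR) (G (F x) * - F' x)%:E)%E.
Proof.
move=> decF F'0.
have leF (x y : R) : 0 < x -> x <= y -> F y <= F x.
  by move=> x0; rewrite le_eqVlt => /predU1P[->//|/(decF _ _ x0)/ltW].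
apply: (@integral_exhaust_eq _ _ (fun k => F k.+1%:R) (fun k => F k.+1%:R^-1)).
- exact: mG.
- exact: G0.
- apply: cont_meas => x x0.
  have c1 : {for x, continuous (G \o F)} by apply: continuous_comp; [exact: cF|exact/cG/F0].
  have c2 : {for x, continuous (fun y => - F' y)} by apply: continuousN; exact: cF'.
  exact: (continuousM c1 c2).
- by move=> x x0; rewrite mulr_ge0 ?G0 ?F0// oppr_ge0 F'0.
- by move=> k; exact: F0.
- by move=> k l kl; apply: leF => //; rewrite ler_nat.
- by move=> k l kl; apply: leF; rewrite ?invr_gt0//; exact: natSinv_le.
- move=> s /surjF[x x0 <-]; have [k /andP[k1 k2]] := natSinv_exhaust x0.
  by exists k; rewrite !leF ?invr_gt0.
- move=> k; have k0 : (0 : R) < k.+1%:R^-1 by rewrite invr_gt0.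
  (* The segment is reduced to the point 1 when k = 0; both integrals vanish there. *)
  have := kk k; rewrite le_eqVlt => /predU1P[kE|klt].
    by rewrite kE !set_itv1 !integral_set1.
  rewrite (@integration_by_substitution_decreasing _ F G) //.
  + apply: eq_integral => x; rewrite inE/= in_itv/= => /andP[kx _].
    by rewrite /= !fctE FE// (lt_le_trans k0).
  + move=> x y; rewrite !in_itv/= => /andP[kx _] /andP[ky _] xy.
    by apply: decF => //; exact: lt_le_trans ky.
  + move=> x; rewrite in_itv/= => /andP[kx _]; apply: cFE; exact: lt_trans kx.
  + apply: cvgP; apply: cvg_at_right_filter; exact: cFE.
  + by apply: cvgP; apply: cvg_at_left_filter; apply: cFE.
  + exact: dFc.
  + by apply: cGw; exact: F0.
Qed.

Lemma integral_subst_inc : (forall x y : R, 0 < x -> x < y -> F x < F y) ->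
  (forall x : R, 0 < x -> 0 <= F' x) ->
  (\int[leb]_(s in pR) (G s)%:E = \int[leb]_(x in pR) (G (F x) * F' x)%:E)%E.
Proof.
move=> incF F'0.
have leF (x y : R) : 0 < x -> x <= y -> F x <= F y.
  by move=> x0; rewrite le_eqVlt => /predU1P[->//|/(incF _ _ x0)/ltW].
apply: (@integral_exhaust_eq _ _ (fun k => F k.+1%:R^-1) (fun k => F k.+1%:R)).
- exact: mG.
- exact: G0.
- apply: cont_meas => x x0.
  have c1 : {for x, continuous (G \o F)} by apply: continuous_comp; [exact: cF|exact/cG/F0].
  exact: (continuousM c1 (cF' x0)).
- by move=> x x0; rewrite mulr_ge0 ?G0 ?F0// F'0.
- by move=> k; apply: F0; rewrite invr_gt0.
- by move=> k l kl; apply: leF; rewrite ?invr_gt0//; exact: natSinv_le.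
- by move=> k l kl; apply: leF => //; rewrite ler_nat.
- move=> s /surjF[x x0 <-]; have [k /andP[k1 k2]] := natSinv_exhaust x0.
  by exists k; rewrite !leF ?invr_gt0.
- move=> k; have k0 : (0 : R) < k.+1%:R^-1 by rewrite invr_gt0.
  have := kk k; rewrite le_eqVlt => /predU1P[kE|klt].
    by rewrite kE !set_itv1 !integral_set1.
  rewrite (@integration_by_substitution_increasing _ F G) //.
  + apply: eq_integral => x; rewrite inE/= in_itv/= => /andP[kx _].
    by rewrite /= !fctE FE// (lt_le_trans k0).
  + move=> x y; rewrite !in_itv/= => /andP[kx _] /andP[ky _] xy.
    by apply: incF => //; exact: lt_le_trans kx.
  + move=> x; rewrite in_itv/= => /andP[kx _]; apply: cFE; exact: lt_trans kx.
  + apply: cvgP; apply: cvg_at_right_filter; exact: cFE.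
  + by apply: cvgP; apply: cvg_at_left_filter; apply: cFE.
  + exact: dFc.
  + by apply: cGw; apply: F0; rewrite invr_gt0.
Qed.

End substitution.
End half_line.

(** * The Riesz kernels as superpositions of Gaussians *)

Section even_functions.
Context (R : realType).
Local Notation RT := (measurableTypeR R).
Local Notation leb := (@lebesgue_measure R).
Local Notation pR := (`]0, +oo[%classic : set R).
Implicit Types (f : RT -> R).

Lemma measurable_pos : measurable (pR : set RT).
Proof. exact: measurable_itv. Qed.

(** With g the restriction to positive arguments, f x = g x + g (- x); the hypothesis at 0 makes
    this hold at the origin too. *)
Lemma Rintegral_even f : summable_fun leb f ->
  f 0 = 0 -> (forall x, f (- x) = f x) ->
  \int[leb]_x f x = 2 * \int[leb]_(x in pR) f x.
Proof.
move=> sf f00 ev; have mf := summable_measurable sf.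
pose g x := \1_pR x * f x.
have sg : summable_fun leb g.
  apply: (summable_Mbounded (C := 1)) => //.
  by move=> x; rewrite indicE; case: (_ \in _); rewrite ?normr1 ?normr0.
have E1 : \int[leb]_(x in pR) f x = \int[leb]_x g x.
  rewrite Rintegral_mkcond; apply: eq_Rintegral => x _.
  by rewrite patchE /g indicE; case: ifPn => _; rewrite ?mul1r ?mul0r.
have mo : measurable_fun [set: RT] (-%R : RT -> RT) by exact: oppr_measurable.
have oE (h : RT -> \bar R) : measurable_fun [set: RT] h -> (forall y, (0 <= h y)%E) ->
    (\int[leb]_x h (- x)%R = 1%:E * \int[leb]_y h y)%E.
  by move=> mh h0; rewrite mul1e ge0_integral_opp.
have sgN := summable_change mo oE sg.
have gN := Rintegral_change mo oE sg; rewrite mul1r in gN.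
rewrite E1 mulrDl !mul1r -{1}gN -RintegralD//.
apply: eq_Rintegral => x _.
rewrite /g ev -mulrDl !indicE !mem_setE !in_itv/= !andbT oppr_gt0.
by have [x0|x0|->] := ltgtP x 0; rewrite ?f00 ?mulr0// ?addr0 ?add0r mul1r.
Qed.

(** Plays two roles: up to a factor 2 it dominates both bounds 1 (for |a| at most 1) and a^-2 (for
    |a| at least 1), and it is the density in r left by the coordinates (b r, b). *)
Definition lorentz (a : RT) : R := (1 + a ^+ 2)^-1.

Lemma lorentz_ge0 a : 0 <= lorentz a.
Proof. by rewrite invr_ge0 addr_ge0// sqr_ge0. Qed.

Lemma measurable_lorentz : measurable_fun [set: RT] lorentz.
Proof.
apply: measurable_fun_inv => [|x]; last by rewrite addr_ge0// sqr_ge0.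
by apply: measurable_funD => //; exact: measurable_funX.
Qed.

Lemma lorentz_integral : summable_fun leb lorentz /\ \int[leb]_a lorentz a = pi.
Proof.
apply: summable_ge0_val; [exact: measurable_lorentz|exact: lorentz_ge0|].
rewrite ge0_symfun_integralT.
- rewrite (_ : [set x | _] = `[0, +oo[%classic); last first.
    by apply/seteqP; split => x/=; rewrite in_itv/= andbT.
  by rewrite (integral0y_oneDsqr R) -EFinM mulrCA divff// mulr1.
- exact: lorentz_ge0.
- exact: continuous_oneDsqrV.
- by move=> x/=; rewrite /lorentz sqrrN.
Qed.

Lemma lorentz_ge_small a : `|a| <= 1 -> 1 <= 2 * lorentz a.
Proof.
move=> a1; rewrite /lorentz ler_pdivlMr; last by rewrite ltr_pwDl// sqr_ge0.
have : a ^+ 2 <= 1 by rewrite -(real_normK (num_real a)) exprn_ile1.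
lra.
Qed.

Lemma lorentz_ge_large a : 1 <= `|a| -> a ^- 2 <= 2 * lorentz a.
Proof.
move=> a1.
have : 1 <= a ^+ 2 by rewrite -(real_normK (num_real a)) exprn_ege1.
move=> a2; rewrite /lorentz ler_pdivlMr; last by rewrite ltr_pwDl// sqr_ge0.
rewrite mulrC ler_pdivrMr; last by rewrite (lt_le_trans ltr01).
lra.
Qed.

End even_functions.

(** * Euler's integral and Gaussian integrals over the standard deviation *)

Section gamma.
Context (R : realType).
Local Notation RT := (measurableTypeR R).
Local Notation leb := (@lebesgue_measure R).
Local Notation pR := (`]0, +oo[%classic : set R).

Lemma is_derive_inv (a : R) : a != 0 -> is_derive a (1 : R) (fun s : R => s^-1) (- a ^- 2).
Proof.
move=> a0; have di : derivable (id : R -> R) a 1 by [].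
apply: DeriveDef; first exact: (@derivableV R R id a 1 a0 di).
by rewrite (@deriveV R R id a 1 a0 di) derive_id [LHS]mulr1.
Qed.

Lemma powRDp (x r s : R) : 0 < x -> x `^ (r + s) = x `^ r * x `^ s.
Proof. by move=> x0; rewrite powRD//; apply/implyP => _; rewrite gt_eqF. Qed.

Let gam (x s : R) := s `^ (x - 1) * expR (- s).

Let gam_ge0 x s : 0 <= gam x s.
Proof. by rewrite mulr_ge0 ?powR_ge0 ?expR_ge0. Qed.

Let continuous_gam x (s : R) : 0 < s -> {for s, continuous (gam x)}.
Proof.
move=> s0; apply: continuousM.
  apply: differentiable_continuous; apply/derivable1_diffP.
  by apply: derivable_powR; rewrite in_itv/= andbT.
apply: (@continuous_comp _ _ _ -%R expR); last exact: continuous_expR.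
exact: opp_continuous.
Qed.

Let measurable_gam x : measurable_fun [set: RT] (gam x).
Proof.
apply: measurable_funM; first exact: measurable_powR.
by apply: (measurableT_comp (@measurable_expR R)); exact: oppr_measurable.
Qed.

Lemma GammaE (x : R) : Gamma x = fine (\int[leb]_(s in pR) (gam x s)%:E)%E.
Proof.
rewrite /Gamma /Rintegral integral_itv_obnd_cbnd//.
by apply/measurable_EFinP; apply: measurable_funTS; exact: measurable_gam.
Qed.

(** The substitution s = t^2 yields twice the Gaussian integral over the half-line. *)
Lemma Gamma_half : Gamma (2^-1 : R) = Num.sqrt pi.
Proof.
rewrite GammaE.
have d1 (t : R) : 0 < t -> is_derive t (1 : R) (fun t : R => t ^+ 2) (2 * t).
  move=> t0; apply: (is_derive_eq (@is_deriveX _ _ id 2 _ _ _ (is_derive_id t (1 : R)))).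
  by rewrite [LHS]mulr1 expr1.
have c1 (t : R) : 0 < t -> {for t, continuous (fun t : R => 2 * t)}.
  by move=> t0; apply: (@continuousM _ _ (cst 2) id); [exact: cst_continuous|exact: cvg_id].
have s1 (s : R) : 0 < s -> exists2 x : R, 0 < x & x ^+ 2 = s.
  by move=> s0; exists (Num.sqrt s); rewrite ?sqrtr_gt0// sqr_sqrtr// ltW.
have := integral_subst_inc d1 c1 _ s1 (continuous_gam (x := 2^-1)).
move=> ->; last 4 first.
- by move=> t t0; rewrite exprn_gt0.
- by move=> s s0; exact: gam_ge0.
- by move=> x y x0 xy; rewrite ltrXn2r// ltW.
- by move=> x x0; rewrite mulr_ge0// ltW.
rewrite (_ : integral _ _ _ = (\int[leb]_(t in pR) (2 * gauss_fun t)%:E)%E).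
  under eq_integral do rewrite EFinM.
  rewrite ge0_integralZl//=; first last.
  + by move=> t _; rewrite lee_fin gauss_fun_ge0.
  + by apply/measurable_EFinP/measurable_funTS; exact: measurable_gauss_fun.
  rewrite integral_itv_obnd_cbnd; last first.
    by apply/measurable_EFinP/measurable_funTS; exact: measurable_gauss_fun.
  by rewrite integral0y_gauss -EFinM/= mulrCA mulfV// mulr1.
apply: eq_integral => t; rewrite inE/= in_itv/= andbT => t0; congr EFin.
rewrite /gam /gauss_fun -powR_mulrn ?ltW// -powRrM.
rewrite (_ : 2%:R * (2^-1 - 1) = - 1 :> R); last by field.
rewrite powR_inv1 ?ltW// powR_mulrn ?ltW//; field; exact: lt0r_neq0.
Qed.

Definition peak_const : R := (Num.sqrt (pi *+ 2))^-1.

Lemma peak_const_gt0 : 0 < peak_const.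
Proof. by rewrite invr_gt0 sqrtr_gt0 mulrn_wgt0// pi_gt0. Qed.

(** A Gaussian density as a function of its standard deviation, S being the squared norm. The
    exponent is kept apart from the dimension: m + 1 is n for the potential and n + 2 for the Riesz
    transforms. *)
Definition std_kernel (m : nat) (S : R) (a : RT) : R :=
  normal_peak a ^+ m.+1 * expR (- S / (a ^+ 2 *+ 2)).

Lemma std_kernel_ge0 m S a : 0 <= std_kernel m S a.
Proof. by rewrite mulr_ge0 ?exprn_ge0 ?normal_peak_ge0 ?expR_ge0. Qed.

Lemma std_kernel0 m S : std_kernel m S 0 = 0.
Proof. by rewrite /std_kernel normal_peak0 expr0n mul0r. Qed.

Lemma std_kernelN m S a : std_kernel m S (- a) = std_kernel m S a.
Proof. by rewrite /std_kernel /normal_peak sqrrN. Qed.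

Lemma measurable_std_kernel m S : measurable_fun [set: RT] (std_kernel m S).
Proof.
apply: measurable_funM.
  apply: measurable_funX; apply: measurable_fun_inv => [|x]; last exact: sqrtr_ge0.
  apply: (measurableT_comp (continuous_measurable_fun (@sqrt_continuous R))).
  under eq_fun do rewrite -[(_ * _) *+ 2]mulr_natr.
  by apply: measurable_funM => //; apply: measurable_funM => //; exact: measurable_funX.
apply: (measurableT_comp (@measurable_expR R)).
apply: measurable_funM => //; apply: measurable_fun_inv => [|x].
  under eq_fun do rewrite -[(_ ^+ 2) *+ 2]mulr_natr.
  by apply: measurable_funM => //; exact: measurable_funX.
by rewrite mulrn_wge0// sqr_ge0.
Qed.

(** The k-th power of u / k <= exp(u / k). *)
Lemma expR_ge_pow (k : nat) (u : R) : (0 < k)%N -> 0 <= u -> u ^+ k <= k%:R ^+ k * expR u.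
Proof.
move=> k0 u0; have kR : (0 : R) < k%:R by rewrite ltr0n.
have -> : expR u = expR (u / k%:R) ^+ k.
  by rewrite -expRM_natl mulrC divfK// gt_eqF.
rewrite -exprMn; apply: lerXn2r; rewrite ?nnegrE ?mulr_ge0 ?expR_ge0 ?ler0n//.
rewrite mulrC -ler_pdivrMr//.
by apply: le_trans (expR_ge1Dx _); rewrite lerDr.
Qed.

Lemma std_kernel_summable m S : (0 < m)%N -> 0 < S ->
  summable_fun leb (std_kernel m S).
Proof.
(* The 1 in [C] serves for |a| >= 1, where |a|^-(m+1) <= a^-2 as m is positive. The power serves for
   |a| <= 1: with t = 1 / |a| and u = S t^2 / 2, t^(m+1) is at most (t^2)^k = (2 u / S)^k, and
   [expR_ge_pow] applies. *)
move=> m0 S0; pose k := m.+1; pose C := 1 + (2 * k%:R / S) ^+ k.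
have C1 : 1 <= C by rewrite lerDl exprn_ge0// divr_ge0 ?mulr_ge0 ?ler0n ?ltW.
have C0 : 0 <= C by exact: le_trans C1.
have sC : summable_fun leb (fun a => C * (2 * lorentz a)).
  by apply: summable_funZ; apply: summable_funZ; exact: (lorentz_integral R).1.
apply: (summable_le (measurable_std_kernel m S) _ sC) => a.
rewrite ger0_norm ?std_kernel_ge0//.
have [->|a0] := eqVneq a 0.
  by rewrite std_kernel0 mulr_ge0// mulr_ge0// lorentz_ge0.
have A0 : 0 < `|a| by rewrite normr_gt0.
set t := `|a|^-1; have t0 : 0 < t by rewrite invr_gt0.
have ta : t ^+ 2 = a ^- 2 by rewrite exprVn real_normK// num_real.
have Ee : - S / (a ^+ 2 *+ 2) = - (S / 2 * t ^+ 2).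
  by rewrite ta -[(a ^+ 2) *+ 2]mulr_natr; field.
have pk : std_kernel m S a <= t ^+ m.+1 * expR (- (S / 2 * t ^+ 2)).
  rewrite /std_kernel Ee; apply: ler_wpM2r; first exact: expR_ge0.
  by apply: lerXn2r; rewrite ?nnegrE ?normal_peak_ge0 ?(ltW t0) ?normal_peak_le.
apply: (le_trans pk).
have [a1|/ltW a1] := leP 1 `|a|.
  apply: le_trans (ler_wpM2l C0 (lorentz_ge_large a1)).
  rewrite -ta -[leLHS]mul1r; apply: ler_pM => //.
    by rewrite mulr_ge0 ?expR_ge0// exprn_ge0// ltW.
  rewrite -[leRHS]mulr1.
  apply: ler_pM; rewrite ?expR_ge0 ?exprn_ge0 ?(ltW t0)//.
    by apply: ler_wiXn2l; rewrite ?ltnS// ?(ltW t0)// /t invf_le1.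
  by rewrite -[leRHS]expR0 ler_expR oppr_le0 mulr_ge0// ?exprn_ge0 ?(ltW t0) ?divr_ge0 ?ltW.
apply: le_trans (ler_wpM2l C0 (lorentz_ge_small a1)).
rewrite mulr1 expRN ler_pdivrMr ?expR_gt0//.
have t1 : 1 <= t by rewrite /t -[leLHS]invr1 lef_pV2 ?posrE.
set u := S / 2 * t ^+ 2.
have u0 : 0 <= u by rewrite mulr_ge0 ?exprn_ge0 ?(ltW t0) ?divr_ge0 ?ltW.
apply: (@le_trans _ _ (t ^+ 2 ^+ k)).
  by rewrite -exprM; apply: ler_weXn2l => //; rewrite /k leq_pmull.
have -> : t ^+ 2 = 2 / S * u by rewrite /u; field; rewrite gt_eqF.
rewrite exprMn.
have := expR_ge_pow (isT : (0 < k)%N) u0 => H.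
have P0 : 0 <= (2 / S) ^+ k by rewrite exprn_ge0// divr_ge0// ltW.
apply: (le_trans (ler_wpM2l P0 H)).
rewrite mulrA -exprMn (mulrAC 2) ler_wpM2r ?expR_ge0//.
by rewrite lerDr.
Qed.

(** Under s = S / (2 a^2) the exponential becomes exp(- s), and the powers of a combine with the
    Jacobian into s^(m/2 - 1), which gives Euler's integral. *)
Lemma Rintegral_std_kernel m S : (0 < m)%N -> 0 < S ->
  \int[leb]_a std_kernel m S a =
  peak_const ^+ m.+1 * (S / 2) `^ (- (m%:R / 2)) * Gamma (m%:R / 2 : R).
Proof.
move=> m0 S0; pose c := S / 2; have c0 : 0 < c by rewrite divr_gt0.
have inv0 (a : R) : 0 < a -> 0 < a^-1 by rewrite invr_gt0.
pose F (a : R) := c * a^-1 ^+ 2; pose F' (a : R) := c * (2 * a^-1 * (- a ^- 2)).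
have d1 (a : R) : 0 < a -> is_derive a (1 : R) F (F' a).
  move=> a0; have dV := is_derive_inv (negbT (gt_eqF a0)).
  by have := is_deriveZ c (@is_deriveX _ _ _ 2 _ _ _ dV); rewrite expr1.
have cV (a : R) : 0 < a -> {for a, continuous (fun a : R => a^-1)}.
  by move=> a0; apply: inv_continuous; rewrite gt_eqF.
have c1 (a : R) : 0 < a -> {for a, continuous F'}.
  move=> a0; apply: (@continuousM _ _ (cst c) (fun a : R => 2 * a^-1 * (- a ^- 2))).
    exact: cst_continuous.
  apply: (@continuousM _ _ (fun a : R => 2 * a^-1) (fun a : R => - a ^- 2)).
    apply: (@continuousM _ _ (cst 2) (fun a : R => a^-1)); first exact: cst_continuous.
    exact: cV.
  apply: continuousN.
  rewrite (_ : (fun a : R => a ^- 2) = (fun a : R => a^-1 * a^-1)).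
    by apply: continuousM; exact: cV.
  by apply/funext => b; rewrite -exprVn.
have F0 (a : R) : 0 < a -> 0 < F a.
  by move=> a0; rewrite mulr_gt0// exprn_gt0// inv0.
have s1 (s : R) : 0 < s -> exists2 x : R, 0 < x & F x = s.
  move=> s0; exists (Num.sqrt (c / s)); first by rewrite sqrtr_gt0 divr_gt0.
  rewrite /F exprVn sqr_sqrtr ?divr_ge0 ?ltW// invf_div mulrCA mulfV ?mulr1//.
  by rewrite gt_eqF.
have dec (x y : R) : 0 < x -> x < y -> F y < F x.
  move=> x0 xy; have y0 := lt_trans x0 xy.
  rewrite /F ltr_pM2l// ltrXn2r//.
  - by rewrite ltW// inv0.
  - by rewrite ltf_pV2.
have F'0 (x : R) : 0 < x -> F' x <= 0.
  move=> x0; rewrite /F' mulrN mulrN oppr_le0 !mulr_ge0// ?ltW// ?inv0// exprn_gt0//.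
have gE := integral_subst_dec d1 c1 F0 s1 (continuous_gam (x := m%:R / 2))
  (fun s _ => gam_ge0 _ s) dec F'0.
(* The ratio of [std_kernel m S] to the pulled back Gamma integrand. The 2 in the denominator comes
   from the Jacobian 2 c a^-3 and offsets the doubling by evenness. *)
pose kap := peak_const ^+ m.+1 * c `^ (- (m%:R / 2)) / 2.
have kap0 : 0 < kap by rewrite divr_gt0// mulr_gt0 ?powR_gt0// exprn_gt0// peak_const_gt0.
rewrite Rintegral_even ?std_kernel0//; last 2 first.
- exact: std_kernel_summable.
- exact: std_kernelN.
rewrite GammaE gE -/c.
rewrite {1}/Rintegral (_ : integral _ _ _ =
   (kap%:E * \int[leb]_(x in pR) (gam (m%:R / 2) (F x) * - F' x)%:E)%E); last first.
  rewrite -ge0_integralZl//.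
  - apply: eq_integral => a; rewrite inE/= in_itv/= andbT => a0.
    rewrite -EFinM; congr EFin.
    rewrite /std_kernel /gam normal_peakE gtr0_norm// exprMn -/peak_const.
    have -> : - S / (a ^+ 2 *+ 2) = - F a.
      by rewrite /F /c exprVn -[(a ^+ 2) *+ 2]mulr_natr; field; rewrite gt_eqF.
    set b := a^-1; have b0 : 0 < b by rewrite invr_gt0.
    have -> : - F' a = 2 * c * b ^+ 3 by rewrite /F' -exprVn -/b; ring.
    have Eb : (b ^+ 2) `^ (m%:R / 2 - 1) * b ^+ 3 = b ^+ m.+1.
      rewrite -!powR_mulrn ?(ltW b0)// -powRrM -powRDp//.
      by congr (_ `^ _); rewrite -(natr1 m); field.
    have Ec : c `^ (- (m%:R / 2)) * (c `^ (m%:R / 2 - 1) * c) = 1.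
      rewrite -[X in _ * (_ * X)]powRr1 ?(ltW c0)// -!powRDp//.
      by rewrite (_ : _ + _ = 0) ?powRr0//; ring.
    rewrite /F powRM ?(ltW c0) ?exprn_ge0 ?(ltW b0)// -/b.
    set X := expR _; set Y := c `^ (m%:R / 2 - 1) in Ec *.
    rewrite -Eb /kap; set Z := (b ^+ 2) `^ _; set W := c `^ _ in Ec *.
    transitivity (peak_const ^+ m.+1 * Z * b ^+ 3 * X * (W * (Y * c))); last by field.
    by rewrite Ec mulr1; ring.
  - have mm : measurable_fun [set: RT] (fun a : RT => gam (m%:R / 2) (F a) * - F' a).
      have mV : measurable_fun [set: RT] (fun a : RT => a ^- 2).
        by apply: measurable_fun_inv => [|x]; [exact: measurable_funX|exact: sqr_ge0].
      have mF : measurable_fun [set: RT] F.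
        by apply: measurable_funM => //; under eq_fun do rewrite exprVn.
      have mV1 : measurable_fun [set: RT] (fun a : RT => a^-1).
        rewrite (_ : (fun a : RT => a^-1) = (fun a : RT => a * a ^- 2)).
          exact: measurable_funM.
        apply/funext => a; have [->|a0] := eqVneq a 0; first by rewrite invr0 mul0r.
        by rewrite expr2 invfM mulrA mulfV// mul1r.
      apply: measurable_funM; first exact: (measurableT_comp (measurable_gam _) mF).
      apply: measurable_funN; apply: measurable_funM => //.
      by apply: measurable_funM; [exact: measurable_funM|exact: measurable_funN].
    by apply/measurable_EFinP; exact: measurable_funTS.
  - move=> a; rewrite /= in_itv/= andbT => a0.
    by rewrite lee_fin mulr_ge0 ?gam_ge0// oppr_ge0 F'0.
  - by rewrite lee_fin ltW.
rewrite -gE.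
have -> : peak_const ^+ m.+1 * c `^ (- (m%:R / 2)) = 2 * kap by rewrite /kap; field.
rewrite -mulrA; congr (_ * _).
(* [fine] commutes with a positive factor even at infinite values, which it sends to 0. *)
case: (integral _ _ _) => [r| |] //=.
  by rewrite gt0_muley ?lte_fin//= mulr0.
by rewrite gt0_muleNy ?lte_fin//= mulr0.
Qed.

End gamma.

(** * Gaussian formulas for the kernels of the Riesz potential and of the Riesz transforms *)

Section kernels.
Context (R : realType) (n : nat).
Local Notation leb := (@lebesgue_measure R).
Local Notation E := 'rV[R]_n.
Local Notation kap := (peak_const R).
Implicit Types (w : E).

Lemma sqn_gt0 w : w != 0 -> 0 < sqn w.
Proof.
move=> w0; rewrite lt0r sqn_ge0 andbT; apply: contra w0 => /eqP H.
apply/eqP/rowP => i; rewrite mxE; apply/eqP.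
rewrite -sqrf_eq0; apply/eqP/le_anti; rewrite sqr_ge0 andbT -H.
exact: sqn_coord.
Qed.

Lemma enormE w : enorm w = Num.sqrt (sqn w).
Proof. by []. Qed.

Lemma peak_constE : kap = (2 * pi) `^ (- 2^-1).
Proof. by rewrite powRN powR12_sqrt ?mulr_ge0 ?pi_ge0// /peak_const -[pi *+ 2]mulr_natr mulrC. Qed.

Lemma peak_constX (k : nat) : kap ^+ k = (2 * pi) `^ (- (k%:R / 2)).
Proof.
by rewrite peak_constE -powR_mulrn ?powR_ge0// -powRrM; congr (_ `^ _); field.
Qed.

Lemma sqrt_powR (S x : R) : 0 <= S -> Num.sqrt S `^ x = S `^ (x / 2).
Proof. by move=> S0; rewrite -powR12_sqrt// -powRrM mulrC. Qed.

Lemma half_powR (x : R) : (2^-1) `^ x = 2 `^ (- x).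
Proof. by rewrite -powR_inv1// -powRrM mulN1r. Qed.

(** The case m = n - 1 of [Rintegral_std_kernel], where n >= 2 ensures convergence for large a. What
    remains is to compare the powers of 2, pi and |w|, using [Gamma_half]. *)
Lemma riesz_potential_kernel w : (1 < n)%N -> w != 0 ->
  summable_fun leb (fun a => gauss a w) /\
  (@riesz_gamma R n 1)^-1 / (enorm w `^ (n%:R - 1)) =
  kap * \int[leb]_a gauss a w.
Proof.
move=> n1 w0; have S0 := sqn_gt0 w0.
have En : n = n.-1.+1 by rewrite prednK// ltnW.
have m0 : (0 < n.-1)%N by rewrite -ltnS -En.
have Eg : (fun a => gauss a w) = std_kernel n.-1 (sqn w).
  by apply/funext => a; rewrite /gauss /std_kernel -En.
rewrite Eg; split; first exact: std_kernel_summable.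
rewrite Rintegral_std_kernel// -En mulrA mulrA -exprS peak_constX.
have En' : n.-1%:R = n%:R - 1 :> R by rewrite [in RHS]En -natr1 addrK.
rewrite En' enormE sqrt_powR ?(ltW S0)// /riesz_gamma mul1r Gamma_half.
rewrite -powR12_sqrt ?pi_ge0//.
rewrite (powRM _ (ltW S0)) ?invr_ge0// half_powR.
rewrite (powRM _ (ler0n _ _) (pi_ge0 R)).
set G := Gamma _; set p := n%:R - 1; rewrite -powRN.
rewrite invf_div !invfM -!powRN.
rewrite [LHS](_ : _ = G * sqn w `^ (- (p / 2)) * (pi `^ (- (n%:R / 2)) * pi `^ (- 2^-1)) * 2 `^ (-1)); last by ring.
rewrite [RHS](_ : _ = G * sqn w `^ (- (p / 2)) * pi `^ (- (n.+1%:R / 2)) *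
  (2 `^ (- (n.+1%:R / 2)) * 2 `^ (- - (p / 2)))); last by ring.
rewrite -!powRDp ?pi_gt0//.
by congr (_ * _ `^ _ * _ `^ _); rewrite /p -(natr1 n); field.
Qed.

(** Since a^-2 is [kap ^- 2] times the squared peak, this is the case m = n + 1 of
    [Rintegral_std_kernel]. Multiplied by the coordinate w_j, the right-hand integrand becomes
    [- dgauss j a w]. *)
Lemma riesz_transform_kernel w : (0 < n)%N -> w != 0 ->
  summable_fun leb (fun a => a ^- 2 * gauss a w) /\
  @riesz_const R n / enorm w ^+ n.+1 =
  kap * \int[leb]_a (a ^- 2 * gauss a w).
Proof.
move=> n0 w0; have S0 := sqn_gt0 w0.
have k2 : kap ^- 2 * kap ^+ n.+2 = kap ^+ n.
  have kN0 := lt0r_neq0 (peak_const_gt0 R).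
  by rewrite -[n.+2]addn2 exprD mulrC mulfK// expf_neq0.
have Eg : (fun a => a ^- 2 * gauss a w) = (fun a => kap ^- 2 * std_kernel n.+1 (sqn w) a).
  apply/funext => a; have [->|a0] := eqVneq a 0.
    by rewrite gauss0// std_kernel0 !mulr0.
  rewrite /gauss /std_kernel mulrA mulrA; congr (_ * _).
  have kN0 := lt0r_neq0 (peak_const_gt0 R).
  rewrite -[n.+2]addn2 exprD mulrC [RHS]mulrCA; congr (_ * _).
  rewrite normal_peakE exprMn -/(peak_const R) [`|a|^-1 ^+ 2]exprVn real_normK ?num_real//.
  by rewrite mulrCA mulVf ?mulr1// expf_neq0.
have sk := std_kernel_summable (ltn0Sn n) S0.
rewrite Eg; split; first exact: summable_funZ.
rewrite RintegralZl// Rintegral_std_kernel// mulrA [RHS]mulrA [_ * (kap ^+ _ * _)]mulrA.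
rewrite -(mulrA kap) k2 -exprS peak_constX.
rewrite -[enorm w ^+ _]powR_mulrn ?sqrtr_ge0// enormE sqrt_powR ?(ltW S0)// /riesz_const.
rewrite (powRM _ (ltW S0)) ?invr_ge0// half_powR.
rewrite (powRM _ (ler0n _ _) (pi_ge0 R)).
set G := Gamma _; rewrite -!powRN.
rewrite [LHS](_ : _ = G * sqn w `^ (- (n.+1%:R / 2)) * pi `^ (- (n.+1%:R / 2))); last by ring.
rewrite [RHS](_ : _ = G * sqn w `^ (- (n.+1%:R / 2)) * pi `^ (- (n.+1%:R / 2)) *
  (2 `^ (- (n.+1%:R / 2)) * 2 `^ (- - (n.+1%:R / 2)))); last by ring.
rewrite -!powRDp ?pi_gt0//.
by rewrite subrr powRr0 mulr1.
Qed.

End kernels.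

(** * Convolution with Gaussians *)

Section convolution.
Context (R : realType) (n : nat).
Local Notation RT := (measurableTypeR R).
Local Notation E := 'rV[R]_n.
Local Notation ET := (n.-tuple RT).
Local Notation mu := (lebesgue_tuple n : {sigma_finite_measure set ET -> \bar R}).
Local Notation v := (@rV_of_tuple R n).
Local Notation e_ j := (@ebase R n j).
Implicit Types (h k : E -> R) (x y : E) (i j : 'I_n) (s : seq 'I_n).

Definition pder j h : E -> R := fun x => 'D_(e_ j) h x.
Definition pders s h : E -> R := foldr pder h s.

(** What the integrations by parts and the decay estimates ask of h. Quantifying over all iterated
    derivatives makes the class stable under [pder]. *)
Definition tame h := forall s, [/\ continuous (pders s h),
  forall j x, derivable (pders s h) x (e_ j), vsummable (pders s h) &
  exists M : R, forall x, `|pders s h x| <= M].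

Lemma tame_pder j h : tame h -> tame (pder j h).
Proof.
by move=> th s; have := th (rcons s j); rewrite /pders foldr_rcons.
Qed.

Lemma tame_continuous h : tame h -> continuous h.
Proof. by case/(_ [::]). Qed.

Lemma tame_summable h : tame h -> vsummable h.
Proof. by case/(_ [::]). Qed.

Lemma tame_bounded h : tame h -> exists2 M : R, 0 <= M & forall x, `|h x| <= M.
Proof.
case/(_ [::]) => _ _ _ [M HM]; exists M => //.
exact: le_trans (normr_ge0 _) (HM 0).
Qed.

Lemma tame_derive h j x : tame h -> is_derive x (e_ j) h (pder j h x).
Proof. by case/(_ [::]) => _ dh _ _; split. Qed.

Lemma tame_lipschitz h : tame h -> exists2 L : R, 0 <= L &
  forall x z, `|h (x + z) - h x| <= L * \sum_(i < n) `|z ord0 i|.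
Proof.
move=> th.
have [M HM] : {M : 'I_n -> R & forall j, 0 <= M j /\ forall x, `|pder j h x| <= M j}.
  apply: (@boolp.choice _ _ (fun j M => 0 <= M /\ forall x, `|pder j h x| <= M)) => j.
  by have [M M0 HM] := tame_bounded (tame_pder j th); exists M.
exists (\sum_j M j); first by apply: sumr_ge0 => j _; case: (HM j).
apply: lipschitz_partials => j y; first by have [] := tame_derive j y th.
rewrite (bigD1 j)//=; apply: le_trans ((HM j).2 y) _.
by rewrite lerDl; apply: sumr_ge0 => i _; case: (HM i).
Qed.

Definition vconv k h x : R := vint (fun y => k (x - y) * h y).

Lemma measurable_sub_tuple d (T : measurableType d) (f g : T -> ET) i :
  measurable_fun [set: T] f -> measurable_fun [set: T] g ->
  measurable_fun [set: T] (fun t => (v (f t) - v (g t)) ord0 i).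
Proof.
move=> mf mg; under eq_fun do rewrite mxE [X in _ + X]mxE.
apply: measurable_funB; apply: (measurableT_comp (measurable_coord_tuple i)) => //.
Qed.

Lemma continuous_reflect h x : continuous h -> continuous (fun y => h (x - y)).
Proof.
move=> ch y.
have cs : {for y, continuous (cst x - id)}.
  by apply: continuousB; [exact: cst_continuous|exact: cvg_id].
exact: (cvg_comp _ _ cs (ch _)).
Qed.

Section young.
Variables (k h : E -> R).
Hypotheses (ck : continuous k) (sk : vsummable k) (th : tame h).

Lemma vconv_summable x : vsummable (fun y => k (x - y) * h y).
Proof.
have [M M0 HM] := tame_bounded th.
apply: (@vsummable_cont_le _ _ _ (fun y => M * `|k (x - y)|)).
- by apply: continuous_mul; [exact: continuous_reflect|exact: tame_continuous].
- by move=> y; rewrite normrM mulrC ler_wpM2r.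
- by apply: vsummableZ; exact: (vint_reflect x (vsummable_norm sk)).1.
Qed.

Lemma vconv_bound M x : 0 <= M -> (forall y, `|h y| <= M) ->
  `|vconv k h x| <= M * vint (fun y => `|k y|).
Proof.
move=> M0 HM; have sx := vint_reflect x (vsummable_norm sk).
rewrite -sx.2 -vintZ; last exact: sx.1.
apply: vint_norm_le; [exact: vconv_summable|exact: vsummableZ sx.1|].
by move=> y; rewrite normrM mulrC ler_wpM2r.
Qed.

Let K (z : ET * ET) : R := k (v z.1 - v z.2) * h (v z.2).

Let mK : measurable_fun [set: ET * ET] K.
Proof.
apply: measurable_funM.
  apply: measurable_continuous_rV => // i.
  by apply: measurable_sub_tuple; [exact: measurable_fst|exact: measurable_snd].
apply: (measurableT_comp (measurable_continuous_tuple (tame_continuous th))).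
exact: measurable_snd.
Qed.

Let sK : summable_fun (mu \x mu)%E K.
Proof.
apply: (@summable_prod2 _ _ _ _ _ mu mu _ (fun t => vint (fun y => `|k y|) * `|h (v t)|)) => //.
- move=> t; rewrite /K /=; under eq_fun do rewrite mulrC.
  have H := (vint_shift (- v t) sk).1; exact: (summable_funZ _ H).
- by apply: summable_funZ; exact: (summable_norm (tame_summable th)).
- move=> t; rewrite /K/=; under eq_Rintegral do rewrite normrM.
  have [H1 H2] := vint_shift (- v t) (vsummable_norm sk).
  by rewrite RintegralZr// -H2.
Qed.

Lemma vconv_vsummable : vsummable (vconv k h).
Proof. exact: (Rfubini1 sK).1. Qed.

Lemma vconv_norm1 : vint (fun x => `|vconv k h x|) <=
  vint (fun y => `|k y|) * vint (fun y => `|h y|).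
Proof.
have sN := summable_norm sK.
have [s1 E1] := Rfubini1 sN; have [s2 E2] := Rfubini2 sN.
apply: (@le_trans _ _ (\int[mu]_x \int[mu]_y `|K (x, y)|)).
  apply: Rintegral_le => //; first exact: (summable_norm vconv_vsummable).
  move=> x; exact: (le_normr_Rintegral measurableT (vconv_summable (v x))).
rewrite E1 -E2.
have Et (t : ET) : \int[mu]_x `|K (x, t)| = vint (fun y => `|k y|) * `|h (v t)|.
  have [H1 H2] := vint_shift (- v t) (vsummable_norm sk).
  rewrite -H2 -RintegralZr//.
  by apply: eq_Rintegral => z _; rewrite /K/= normrM.
under eq_Rintegral do rewrite Et.
by rewrite RintegralZl//; exact: (summable_norm (tame_summable th)).
Qed.

End young.

(** The derivative of y |-> k (x - y) h (y) along e_j integrates to 0 by [vint_partial0]; the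
    reflected argument supplies the minus sign that makes the two sides equal. *)
Lemma vconv_parts k k' h j x : continuous k -> continuous k' -> vsummable k -> vsummable k' ->
  (forall y, is_derive y (e_ j) k (k' y)) -> tame h ->
  vconv k (pder j h) x = vconv k' h x.
Proof.
move=> ck ck' sk sk' dk th.
have s1 := vconv_summable ck sk (tame_pder j th) x.
have s2 := vconv_summable ck' sk' th x.
have s0 := vconv_summable ck sk th x.
have dr y : is_derive y (e_ j) (fun y => k (x - y)) (- k' (x - y)).
  apply: is_derive_line.
  have dl : is_derive (- 0 : R) (1 : R) (fun s : R => k ((x - y) + s *: e_ j)) (k' (x - y)).
    rewrite oppr0; have := @derive_line R n k (x - y) (e_ j) 0.
    rewrite scale0r addr0; have [d1 d2] := dk (x - y).
    by move=> /(_ d1); rewrite d2.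
  have := is_derive1_comp dl (is_deriveNid (0 : R) (1 : R)).
  rewrite mulrN1; congr is_derive; apply/funext => s /=.
  by rewrite opprD addrA scaleNr.
have dF y : is_derive y (e_ j) (fun y => k (x - y) * h y)
    (k (x - y) * pder j h y - k' (x - y) * h y).
  apply: (is_derive_eq (is_deriveM (dr y) (tame_derive j y th))).
  by rewrite /GRing.scale/= mulrN [h y * _]mulrC.
have := vint_partial0 dF.
rewrite vintB// => H; apply/eqP; rewrite -subr_eq0; apply/eqP; apply: H => //.
- apply: continuous_add.
    by apply: continuous_mul; [exact: continuous_reflect|exact/tame_continuous/tame_pder].
  by apply/continuous_opp/continuous_mul; [exact: continuous_reflect|exact: tame_continuous].
- exact: vsummableB.
Qed.

(** Both derivatives sit on h, which keeps the convolution bounded as a tends to 0; [heat_parts]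
    moves them to the Gaussian when decay in a is wanted. *)
Definition heat j h (a : R) : E -> R := vconv (gauss a) (pder j (pder j h)).

Lemma heat0 j h : (0 < n)%N -> heat j h 0 = fun=> 0.
Proof.
move=> n0; apply/funext => x; rewrite /heat /vconv /vint.
under eq_Rintegral do rewrite gauss0// mul0r.
by rewrite Rintegral_cst// mul0r.
Qed.

Lemma heat_parts j h a x : a != 0 -> tame h ->
  heat j h a x = vconv (d2gauss j a) h x.
Proof.
move=> a0 th; rewrite /heat.
transitivity (vconv (dgauss j a) (pder j h) x).
  apply: vconv_parts; last exact: tame_pder.
  - exact: continuous_gauss.
  - exact: continuous_dgauss.
  - exact: vsummable_gauss.
  - exact: vsummable_dgauss.
  - by move=> y; exact: is_derive_gauss.
apply: vconv_parts => //.
- exact: continuous_dgauss.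
- exact: continuous_d2gauss.
- exact: vsummable_dgauss.
- exact: vsummable_d2gauss.
- by move=> y; exact: is_derive_dgauss.
Qed.

(** For |a| <= 1 the Gaussian has mass 1 and the norms of d_j^2 h are used; for |a| >= 1 the
    derivatives go to the Gaussian, whose L^1 norm is then O(a^-2). Each regime is absorbed in
    [lorentz a] at the price of a factor 2. Sup and L^1 norms are treated together since the
    potential needs both. *)
Lemma heat_decay j h : (0 < n)%N -> tame h -> exists2 C : R, 0 <= C &
  forall a : R, [/\ forall x, `|heat j h a x| <= C * lorentz a, vsummable (heat j h a) &
    vint (fun x => `|heat j h a x|) <= C * lorentz a].
Proof.
move=> n0 th; have tq := tame_pder j (tame_pder j th).
set q := pder j (pder j h) in tq.
have [Mq Mq0 HMq] := tame_bounded tq; have [Mh Mh0 HMh] := tame_bounded th.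
set Iq := vint (fun y => `|q y|); set Ih := vint (fun y => `|h y|).
have Iq0 : 0 <= Iq by apply: Rintegral_ge0.
have Ih0 : 0 <= Ih by apply: Rintegral_ge0.
set g := gauss_const R n + 1.
have g0 : 0 <= g by rewrite addr_ge0// gauss_const_ge0.
pose C := 2 * (Mq + Iq + g * (Mh + Ih)).
have MI0 : 0 <= Mq + Iq by exact: addr_ge0.
have gI0 : 0 <= g * (Mh + Ih) by apply: mulr_ge0 => //; exact: addr_ge0.
have C0 : 0 <= C by rewrite mulr_ge0// addr_ge0.
exists C => // a.
have [->|a0] := eqVneq a 0.
  rewrite heat0//; split.
  - by move=> x; rewrite normr0 mulr_ge0// lorentz_ge0.
  - exact: integrable0.
  - rewrite /vint; under eq_Rintegral do rewrite normr0.
    by rewrite Rintegral_cst// mul0r mulr_ge0// lorentz_ge0.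
have sg := vsummable_gauss n a0; have cg := @continuous_gauss R n a.
have Ng : vint (fun y => `|gauss a y|) = 1 :> R.
  rewrite -(vint_gauss n a0); congr vint; apply/funext => y.
  by rewrite ger0_norm// gauss_ge0.
have ca := lorentz_ge0 a.
split; last 1 first.
- have [a1|/ltW a1] := leP `|a| 1.
    apply: (le_trans (vconv_norm1 cg sg tq)); rewrite Ng mul1r -/q -/Iq.
    have := lorentz_ge_small a1 => H.
    apply: (@le_trans _ _ (Iq * (2 * lorentz a))); first by rewrite ler_peMr.
    rewrite mulrA (mulrC Iq) ler_wpM2r// /C ler_pM2l//.
    by rewrite -addrA addrCA lerDl addr_ge0// mulr_ge0// addr_ge0.
  under [X in vint X]eq_fun do rewrite heat_parts//.
  apply: (le_trans (vconv_norm1 (@continuous_d2gauss R n j a) (vsummable_d2gauss j a0) th)).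
  rewrite -/Ih; apply: (@le_trans _ _ (g * a ^- 2 * Ih)).
    by rewrite ler_wpM2r//; exact: vint_d2gauss_le.
  apply: (@le_trans _ _ (g * (2 * lorentz a) * Ih)).
    by rewrite ler_wpM2r// ler_wpM2l// lorentz_ge_large.
  rewrite [leLHS](_ : _ = 2 * (g * Ih) * lorentz a); last by ring.
  rewrite ler_wpM2r// /C ler_pM2l// mulrDr.
  by rewrite [leRHS]addrA lerDr !addr_ge0// mulr_ge0.
- move=> x; have [a1|/ltW a1] := leP `|a| 1.
    apply: (le_trans (vconv_bound cg sg tq x Mq0 HMq)); rewrite Ng mulr1.
    have := lorentz_ge_small a1 => H.
    apply: (@le_trans _ _ (Mq * (2 * lorentz a))); first by rewrite ler_peMr.
    rewrite mulrA (mulrC Mq) ler_wpM2r// /C ler_pM2l//.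
    by rewrite -addrA lerDl addr_ge0// mulr_ge0// addr_ge0.
  rewrite heat_parts//.
  apply: (le_trans (vconv_bound (@continuous_d2gauss R n j a) (vsummable_d2gauss j a0) th x Mh0 HMh)).
  apply: (@le_trans _ _ (Mh * (g * a ^- 2))).
    by rewrite ler_wpM2l//; exact: vint_d2gauss_le.
  apply: (@le_trans _ _ (Mh * (g * (2 * lorentz a)))).
    by rewrite ler_wpM2l// ler_wpM2l// lorentz_ge_large.
  rewrite [leLHS](_ : _ = 2 * (g * Mh) * lorentz a); last by ring.
  rewrite ler_wpM2r// /C ler_pM2l// mulrDr.
  by rewrite addrCA lerDl !addr_ge0// mulr_ge0.
- exact: vconv_vsummable.
Qed.

Lemma measurable_heat d (T : measurableType d) (A : T -> R) (W : T -> E) j h :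
  tame h -> measurable_fun [set: T] A ->
  (forall i, measurable_fun [set: T] (fun t => W t ord0 i)) ->
  measurable_fun [set: T] (fun t => heat j h (A t) (W t)).
Proof.
move=> th mA mW; have tq := tame_pder j (tame_pder j th).
have mz : measurable_fun [set: T * ET]
    (fun z => gauss (A z.1) (W z.1 - v z.2) * pder j (pder j h) (v z.2)).
  apply: measurable_funM.
    apply: measurable_gauss.
      by apply: (measurableT_comp mA); exact: measurable_fst.
    move=> i; under eq_fun do rewrite mxE [X in _ + X]mxE.
    apply: measurable_funB.
      by apply: (measurableT_comp (mW i)); exact: measurable_fst.
    by apply: (measurableT_comp (measurable_coord_tuple i)); exact: measurable_snd.
  apply: (measurableT_comp (measurable_continuous_tuple (tame_continuous tq))).
  exact: measurable_snd.
exact: (@measurable_Rintegral2 _ _ _ _ _ mu _ mz).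
Qed.

End convolution.

(** * The principal value *)

Section gamma_positivity.
Context (R : realType).
Local Notation RT := (measurableTypeR R).
Local Notation leb := (@lebesgue_measure R).

(** By [Rintegral_std_kernel] at S = 1, Gamma (m / 2) times a positive number is the integral of a
    nonnegative kernel that exceeds a positive constant on [1, 2]. *)
Lemma Gamma_half_nat_gt0 (m : nat) : (0 < m)%N -> 0 < Gamma (m%:R / 2 : R).
Proof.
move=> m0.
have sk := std_kernel_summable m0 (ltr01 : (0 : R) < 1).
have H := Rintegral_std_kernel m0 (ltr01 : (0 : R) < 1).
(* On [1, 2] the peak is smallest at a = 2 and the exponential is smallest at a = 1. *)
pose d : R := normal_peak (2 : R) ^+ m.+1 * expR (- (2^-1)).
have d0 : 0 < d by rewrite mulr_gt0 ?expR_gt0// exprn_gt0// normal_peak_gt0.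
have s1 : summable_fun leb (fun a : RT => d * \1_`[1, 2]%classic a).
  by apply: summable_funZ; exact: integrable_indic_itv.
have le1 (a : RT) : d * \1_`[1, 2]%classic a <= std_kernel m 1 a.
  rewrite indicE; case: (boolP (_ \in _)) => [|_]; last by rewrite mulr0 std_kernel_ge0.
  rewrite inE/= in_itv/= => /andP[a1 a2]; rewrite mulr1 /std_kernel.
  have a0 : 0 < a by exact: lt_le_trans a1.
  apply: ler_pM; rewrite ?exprn_ge0 ?normal_peak_ge0 ?expR_ge0//.
    apply: lerXn2r; rewrite ?nnegrE ?normal_peak_ge0// !normal_peakE.
    rewrite ler_wpM2r ?invr_ge0 ?sqrtr_ge0// lef_pV2 ?posrE ?normr_gt0 ?gt_eqF//.
    by rewrite !gtr0_norm.
  rewrite ler_expR mulN1r lerN2 lef_pV2 ?posrE//; last by rewrite mulrn_wgt0// exprn_gt0.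
  rewrite -[X in X <= _]mul1r -[(a ^+ 2) *+ 2]mulr_natr ler_wpM2r//.
  by rewrite exprn_ege1.
have := Rintegral_le s1 sk le1; rewrite H RintegralZl//; last exact: integrable_indic_itv.
rewrite {1}/Rintegral integral_indic//= setIT lebesgue_measure_itv/= lte_fin ltr1n/=.
rewrite (_ : 2 - 1 = 1 :> R) ?mulr1; last by ring.
move=> /(lt_le_trans d0).
by rewrite pmulr_rgt0// mulr_gt0// ?powR_gt0// exprn_gt0// peak_const_gt0.
Qed.

Lemma riesz_const_gt0 (n : nat) : (0 < n)%N -> 0 < @riesz_const R n.
Proof. by move=> n0; rewrite divr_gt0 ?powR_gt0 ?pi_gt0// Gamma_half_nat_gt0. Qed.

End gamma_positivity.

Lemma norm_mul_le (R : realType) (a b c : R) : a ^+ 2 <= c -> b ^+ 2 <= c -> `|a| * `|b| <= c.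
Proof.
rewrite -(real_normK (num_real a)) -(real_normK (num_real b)).
by move: `|a| `|b| => p q pc qc; have := sqr_ge0 (p - q); nra.
Qed.

Section principal_value.
Context (R : realType) (n : nat).
Local Notation RT := (measurableTypeR R).
Local Notation leb := (@lebesgue_measure R).
Local Notation E := 'rV[R]_n.
Local Notation ET := (n.-tuple RT).
Local Notation mu := (lebesgue_tuple n : {sigma_finite_measure set ET -> \bar R}).
Local Notation v := (@rV_of_tuple R n).
Local Notation kap := (peak_const R).
Implicit Types (h g : E -> R) (x y w : E) (i j : 'I_n).

Definition riesz_kernel j w : R := w ord0 j / enorm w ^+ n.+1.

Lemma enorm_ge0 w : 0 <= enorm w. Proof. exact: sqrtr_ge0. Qed.

Lemma coord_le_enorm w j : `|w ord0 j| <= enorm w.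
Proof. by rewrite -sqrtr_sqr ler_wsqrtr// sqn_coord. Qed.

Lemma enormN w : enorm (- w) = enorm w.
Proof. by rewrite !enormE sqnN. Qed.

Lemma riesz_kernelN j w : riesz_kernel j (- w) = - riesz_kernel j w.
Proof. by rewrite /riesz_kernel enormN mxE mulNr. Qed.

Lemma continuous_enorm : continuous (@enorm R n).
Proof.
move=> w; exact: (cvg_comp _ _ (@continuous_sqn R n w) (@sqrt_continuous R _)).
Qed.

Lemma measurable_sub_const x i :
  measurable_fun [set: ET] (fun t => (x - v t) ord0 i).
Proof.
under eq_fun do rewrite mxE [X in _ + X]mxE.
by apply: measurable_funB => //; exact: measurable_coord_tuple.
Qed.

Lemma measurable_enorm_sub x : measurable_fun [set: ET] (fun t => enorm (x - v t)).
Proof.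
apply: measurable_continuous_rV; first exact: continuous_enorm.
exact: measurable_sub_const.
Qed.

Lemma measurable_riesz_kernel j x :
  measurable_fun [set: ET] (fun t => riesz_kernel j (x - v t)).
Proof.
apply: measurable_funM; first exact: measurable_sub_const.
apply: measurable_fun_inv => [|t]; last by rewrite exprn_ge0// enorm_ge0.
by apply: measurable_funX; exact: measurable_enorm_sub.
Qed.

Definition far x (eps : R) : set E := [set y | eps < enorm (x - y)].

Lemma measurable_far x eps : measurable (v @^-1` far x eps).
Proof.
have := measurable_enorm_sub x measurableT (measurable_itv `]eps, +oo[).
rewrite setTI; congr measurable.
by apply/seteqP; split => t; rewrite /far/= in_itv/= andbT.
Qed.

Lemma riesz_kernel_le j w (eps : R) : 0 < eps -> eps < enorm w ->
  `|riesz_kernel j w| <= eps ^- n.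
Proof.
move=> e0 ew; have w0 : 0 < enorm w by exact: lt_trans ew.
rewrite /riesz_kernel normrM [`|_^-1|]ger0_norm ?invr_ge0 ?exprn_ge0 ?enorm_ge0//.
rewrite ler_pdivrMr ?exprn_gt0// exprS mulrCA.
apply: (le_trans (coord_le_enorm w j)).
rewrite ler_peMr ?enorm_ge0// mulrC ler_pdivlMr ?exprn_gt0// mul1r.
by rewrite lerXn2r ?nnegrE ?enorm_ge0 ?ltW.
Qed.

Section pv.
Variables (h : E -> R) (j : 'I_n) (x : E).
Hypothesis (n0 : (0 < n)%N) (th : tame h).
Let g := pder j h.
Let tg : tame g. Proof. exact: tame_pder. Qed.

Let c := x + x.
(* Only the odd part D of g around x survives integration against the odd
   kernel, and W, unlike the kernel times g, is integrable. *)
Let D y : R := (g y - g (c - y)) / 2.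
Let W y : R := riesz_kernel j (x - y) * D y.

Let x_sub_reflect y : x - (c - y) = - (x - y).
Proof. by rewrite /c !opprD !opprK addrA addrA subrr add0r addrC. Qed.

Let sD : vsummable D.
Proof.
have H := vsummableB (tame_summable tg) (vint_reflect c (tame_summable tg)).1.
have := vsummableZ 2^-1 H; congr vsummable; apply/funext => y.
by rewrite mulrC.
Qed.

Let cD : continuous D.
Proof.
apply: continuous_mul; last exact: continuous_cst.
apply: continuous_add; first exact: tame_continuous.
by apply/continuous_opp/continuous_reflect/tame_continuous.
Qed.

(** The points y and c - y differ by 2 (y - x), and the factor 2 cancels the halving in [D]. The
    resulting zero at x lowers the singularity of the kernel by one power. *)
Let Dlip : exists2 L : R, 0 <= L & forall y, `|D y| <= L * \sum_(i < n) `|(x - y) ord0 i|.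
Proof.
have [L L0 HL] := tame_lipschitz tg; exists L => // y.
rewrite /D normrM (@ger0_norm _ 2^-1) ?invr_ge0// ler_pdivrMr//.
have -> : g y = g ((c - y) + (y - (c - y))) by rewrite addrCA subrr addr0.
apply: (le_trans (HL _ _)); rewrite -mulrA ler_wpM2l// mulr_suml.
apply: ler_sum => i _.
have -> : y - (c - y) = - ((x - y) + (x - y)).
  by rewrite /c !opprD !opprK; apply/rowP => k; rewrite !mxE; ring.
by rewrite [X in `|X|]mxE normrN [X in `|X|]mxE -mulr2n normrMn mulr_natr.
Qed.

(** Fubini for this function links the two sides: integrated in a it gives the kernel times [D]
    ([PhiW]), integrated in y it gives minus the heat term ([PhiA]). *)
Let Phi (z : ET * RT) : R := - dgauss j z.2 (x - v z.1) * D (v z.1).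

Let mPhi : measurable_fun [set: ET * RT] Phi.
Proof.
apply: measurable_funM.
  apply: measurable_funN; apply: measurable_dgauss; first exact: measurable_snd.
  by move=> i; exact: (measurableT_comp (measurable_sub_const x i) measurable_fst).
apply: (measurableT_comp (measurable_continuous_tuple cD)).
exact: measurable_fst.
Qed.

Let dgauss0 a' w : a' = 0 -> dgauss j a' w = 0.
Proof. by move=> ->; rewrite /dgauss gauss0// mulr0. Qed.

(** For |a| <= 1, [Dlip] bounds the integrand by L n a^-2 |w|^2 N_a(w), and the second moment of
    order a^2 cancels a^-2. For |a| >= 1, |w_j| N_a(w) <= 1 leaves a^-2 |D|. *)
Let Phi_bound : exists2 C : R, 0 <= C & forall a : RT,
  summable_fun mu (fun t => Phi (t, a)) /\ \int[mu]_t `|Phi (t, a)| <= C * lorentz a.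
Proof.
have [L L0 HL] := Dlip.
set I := vint (fun y => `|D y|).
have I0 : 0 <= I by apply: Rintegral_ge0.
have gc0 := gauss_const_ge0 R n.
pose C : R := 2 * (L * n%:R * gauss_const R n + I).
have C1 : 0 <= L * n%:R * gauss_const R n by rewrite !mulr_ge0 ?ler0n.
exists C => [|a]; first by rewrite mulr_ge0// addr_ge0.
have la := lorentz_ge0 a.
have mP : measurable_fun [set: ET] (fun t => Phi (t, a)) by exact: measurable_section2.
have [a0|a0] := eqVneq a 0.
  have P0 t : Phi (t, a) = 0 by rewrite /Phi/= dgauss0// oppr0 mul0r.
  split.
    by rewrite /summable_fun; under eq_fun do rewrite /= P0; exact: integrable0.
  under eq_Rintegral do rewrite P0 normr0.
  by rewrite Rintegral_cst// mul0r mulr_ge0// mulr_ge0// addr_ge0.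
have av0 : 0 <= a ^- 2 by rewrite invr_ge0 sqr_ge0.
have [a1|/ltW a1] := leP `|a| 1.
  have [s1 H1] := sqn_gauss_sum n a0.
  have [s2 E2] := vint_reflect x s1.
  have bd t : `|Phi (t, a)| <= L * n%:R * a ^- 2 * (sqn (x - v t) * gauss a (x - v t)).
    rewrite /Phi/= normrM normrN.
    apply: (@le_trans _ _ (`|dgauss j a (x - v t)| * (L * \sum_(i < n) `|(x - v t) ord0 i|))).
      by rewrite ler_wpM2l.
    move: (x - v t) => w.
    rewrite /dgauss normrM normrN normrM (ger0_norm av0) (ger0_norm (gauss_ge0 _ _)).
    rewrite [leLHS](_ : _ = L * a ^- 2 * gauss a w * (`|w ord0 j| * \sum_(i < n) `|w ord0 i|)); last by ring.
    rewrite [leRHS](_ : _ = L * a ^- 2 * gauss a w * (n%:R * sqn w)); last by ring.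
    apply: ler_wpM2l.
      by apply: mulr_ge0; [exact: mulr_ge0|exact: gauss_ge0].
    have -> : n%:R * sqn w = \sum_(i < n) sqn w by rewrite sumr_const card_ord mulr_natl.
    rewrite mulr_sumr.
    apply: ler_sum => i _.
    exact: norm_mul_le (sqn_coord w j) (sqn_coord w i).
  have s3 := vsummableZ (L * n%:R * a ^- 2) s2.
  split; first exact: (summable_le mP bd s3).
  have bd' t : `| `|Phi (t, a)| | <= L * n%:R * a ^- 2 * (sqn (x - v t) * gauss a (x - v t)).
    by rewrite normr_id.
  apply: (@le_trans _ _ (vint (fun y => L * n%:R * a ^- 2 * (sqn (x - y) * gauss a (x - y))))).
    apply: Rintegral_le => //.
    by apply: (summable_le _ bd' s3); exact: measurableT_comp.
  rewrite vintZ// E2.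
  apply: (@le_trans _ _ (L * n%:R * a ^- 2 * (gauss_const R n * a ^+ 2))).
    by rewrite ler_wpM2l// !mulr_ge0 ?ler0n.
  rewrite [leLHS](_ : _ = L * n%:R * gauss_const R n); last first.
    by field.
  apply: (@le_trans _ _ (L * n%:R * gauss_const R n * (2 * lorentz a))).
    by rewrite ler_peMr// lorentz_ge_small.
  rewrite mulrA ler_wpM2r// /C mulrC ler_pM2l// lerDl//.
have bd t : `|Phi (t, a)| <= a ^- 2 * `|D (v t)|.
  rewrite /Phi/= normrM normrN ler_wpM2r//.
  rewrite /dgauss normrM normrN normrM (ger0_norm av0) (ger0_norm (gauss_ge0 _ _)).
  by rewrite mulrAC mulrC ler_piMr// abs_coord_gauss_le1.
have s3 := vsummableZ (a ^- 2) (vsummable_norm sD).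
split; first exact: (summable_le mP bd s3).
have bd' t : `| `|Phi (t, a)| | <= a ^- 2 * `|D (v t)| by rewrite normr_id.
apply: (@le_trans _ _ (vint (fun y => a ^- 2 * `|D y|))).
  apply: Rintegral_le => //.
  by apply: (summable_le _ bd' s3); exact: measurableT_comp.
rewrite vintZ; last exact: vsummable_norm.
rewrite -/I; apply: (@le_trans _ _ ((2 * lorentz a) * I)).
  by rewrite ler_wpM2r// lorentz_ge_large.
rewrite mulrAC ler_wpM2r// /C ler_pM2l// lerDr//.
Qed.

Let sPhi : summable_fun (mu \x leb)%E Phi.
Proof.
have [C C0 HC] := Phi_bound.
apply: (@summable_prod2 _ _ _ _ _ mu leb Phi (fun a => C * lorentz a)) => //.
- by move=> a; exact: (HC a).1.
- by apply: summable_funZ; exact: (lorentz_integral R).1.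
- by move=> a; exact: (HC a).2.
Qed.

Let rc_neq0 : @riesz_const R n != 0.
Proof. exact/lt0r_neq0/riesz_const_gt0. Qed.

Let PhiW t : kap * \int[leb]_a Phi (t, a) = @riesz_const R n * W (v t).
Proof.
set w := x - v t.
have E1 a : Phi (t, a) = w ord0 j * D (v t) * (a ^- 2 * gauss a w).
  by rewrite /Phi/= -/w /dgauss; ring.
under eq_Rintegral do rewrite E1.
have [w0|w0] := eqVneq w 0.
  under eq_Rintegral do rewrite w0 mxE mul0r mul0r.
  rewrite Rintegral_cst// mul0r mulr0 /W -/w w0 /riesz_kernel mxE.
  by rewrite !mul0r mulr0.
have [sk Ek] := riesz_transform_kernel n0 w0.
by rewrite RintegralZl// mulrCA -Ek /W -/w /riesz_kernel; ring.
Qed.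

(** Integrability at x is inherited from [Phi], whose integral in a is a multiple of [W], instead of
    being derived from the order |w|^(1-n) of the singularity. *)
Let sW : vsummable W.
Proof.
have := summable_funZ (kap / @riesz_const R n) (Rfubini1 sPhi).1.
congr (summable_fun _ _); apply/funext => t.
by rewrite mulrAC PhiW mulrAC (mulfV rc_neq0) mul1r.
Qed.

Let PhiA (a : RT) : \int[mu]_t Phi (t, a) = - heat j h a x.
Proof.
have [a0|a0] := eqVneq a 0.
  rewrite a0 heat0// oppr0.
  have P0 t : Phi (t, 0) = 0 by rewrite /Phi/= dgauss0// oppr0 mul0r.
  by under eq_Rintegral do rewrite P0; rewrite Rintegral_cst// mul0r.
have cd := @continuous_dgauss R n j a; have sd := vsummable_dgauss j a0.
have E1 : heat j h a x = vconv (dgauss j a) g x.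
  apply: vconv_parts => //; [exact: continuous_gauss|exact: vsummable_gauss|].
  by move=> y; exact: is_derive_gauss.
pose F y := dgauss j a (x - y) * g y.
have sF : vsummable F by exact: vconv_summable.
have [sF' EF'] := vint_reflect c sF.
have E2 y : - dgauss j a (x - y) * D y = (- 2^-1) * (F y + F (c - y)).
  rewrite /F x_sub_reflect dgaussN /D.
  by move: (dgauss _ _ _) (g y) (g _) => p q r; field.
rewrite E1 /vconv -/F -[LHS]/(vint (fun y => - dgauss j a (x - y) * D y)).
under [X in vint X]eq_fun do rewrite E2.
rewrite (vintZ _ (vsummableD sF sF')) (vintD sF sF') EF'.
by move: (vint F) => r; field.
Qed.

Lemma heat_time_summable : summable_fun leb (fun a : RT => heat j h a x).
Proof.
have [C C0 HC] := heat_decay j n0 th.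
apply: (summable_le (g := fun a : RT => C * lorentz a)).
- by apply: measurable_heat.
- by move=> a; have [+ _ _] := HC a; exact.
- by apply: summable_funZ; exact: (lorentz_integral R).1.
Qed.

Let vintW : @riesz_const R n * vint W = - kap * \int[leb]_a heat j h a x.
Proof.
have [s1 E1] := Rfubini1 sPhi; have [s2 E2] := Rfubini2 sPhi.
rewrite -vintZ//.
transitivity (\int[mu]_t (kap * \int[leb]_a Phi (t, a))).
  by apply: eq_Rintegral => t _; rewrite PhiW.
rewrite RintegralZl// E1 -E2.
under eq_Rintegral do rewrite PhiA.
rewrite mulNr -mulrN; congr (_ * _).
rewrite -mulN1r -RintegralZl//; last exact: heat_time_summable.
by apply: eq_Rintegral => a _; rewrite mulN1r.
Qed.

Let I (eps : R) y : R := \1_(far x eps) y * riesz_kernel j (x - y).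

Let far_reflect eps y : \1_(far x eps) (c - y) = \1_(far x eps) y :> R.
Proof.
rewrite !indicE; congr ((_ : bool)%:R).
by apply/asboolP/asboolP; rewrite /far/= x_sub_reflect enormN.
Qed.

Let measurable_ind eps : measurable_fun [set: ET] (fun t => \1_(far x eps) (v t) : R).
Proof.
rewrite (_ : (fun t => _) = \1_(v @^-1` far x eps)).
  by apply: measurable_indic; exact: measurable_far.
by apply/funext => t; rewrite !indicE.
Qed.

Let sI eps : 0 < eps -> vsummable (fun y => I eps y * g y).
Proof.
move=> e0; apply: (@summable_Mbounded _ _ _ _ (fun t => I eps (v t)) (fun t => g (v t)) (eps ^- n)).
- by apply: measurable_funM; [exact: measurable_ind|exact: measurable_riesz_kernel].
- move=> t; rewrite /I indicE; case: (boolP (_ \in _)) => [|_].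
    by rewrite inE mul1r /far/= => ?; exact: riesz_kernel_le.
  by rewrite mul0r normr0 invr_ge0 exprn_ge0// ltW.
- exact: tame_summable.
Qed.

Let truncE eps : \int[mu]_(t in v @^-1` far x eps) (riesz_kernel j (x - v t) * g (v t)) =
  vint (fun y => I eps y * g y).
Proof.
rewrite Rintegral_mkcond; apply: eq_Rintegral => t _.
rewrite patchE /I indicE; have -> : (t \in v @^-1` far x eps) = (v t \in far x eps) by [].
by case: (_ \in _); rewrite ?mul1r// !mul0r.
Qed.

(** The truncated region is symmetric about x, so the integral equals the average of itself and its
    reflection, in which the odd kernel selects [D]. *)
Let trunc_sym eps : 0 < eps -> vint (fun y => I eps y * g y) =
  vint (fun y => \1_(far x eps) y * W y).
Proof.
move=> /sI; pose F y := I eps y * g y => sF.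
have [s1 E1] := vint_reflect c sF.
transitivity (vint (fun y => 2^-1 * (F y + F (c - y)))).
  rewrite (vintZ 2^-1 (vsummableD sF s1)) (vintD sF s1) E1 -/F.
  by move: (vint F) => r; field.
congr vint; apply/funext => y.
rewrite /F /I far_reflect x_sub_reflect riesz_kernelN /W /D.
by move: (\1_(far x eps) y) (riesz_kernel j _) (g y) (g _) => p q r t; field.
Qed.

Lemma riesz_trunc_summable eps : 0 < eps ->
  mu.-integrable (v @^-1` far x eps) (fun t => (riesz_kernel j (x - v t) * g (v t))%:E).
Proof.
move=> e0; apply/integrable_mkcond; first exact: measurable_far.
have := sI e0; apply: eq_integrable => // t _ /=.
rewrite patchE /I indicE; have -> : (t \in v @^-1` far x eps) = (v t \in far x eps) by [].
by case: (_ \in _); rewrite ?mul1r// !mul0r.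
Qed.

Let trunc_cvg : vint (fun y => \1_(far x eps) y * W y) @[eps --> 0^'+] --> vint W.
Proof.
apply/cvg_at_rightP => u [u0 ucvg].
have mW := summable_measurable sW.
have := @dominated_convergence _ _ _ mu setT measurableT
  (fun k t => (\1_(far x (u k)) (v t) * W (v t))%:E) (fun t => (W (v t))%:E)
  (fun t => `|W (v t)|%:E).
case.
- move=> k; apply/measurable_EFinP; apply: measurable_funM => //.
- exact/measurable_EFinP.
- apply: aeW => t _.
  apply: cvg_EFin; first by near=> k.
  (* At the centre the kernel takes the value 0, its numerator being 0; at any other point the
     indicator is eventually 1. *)
  have [wt|wt] := eqVneq (x - v t) 0.
    have -> : W (v t) = 0 by rewrite /W wt /riesz_kernel mxE !mul0r.
    under eq_fun do rewrite mulr0; exact: cvg_cst.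
  have et : 0 < enorm (x - v t) by rewrite enormE sqrtr_gt0 sqn_gt0.
  apply: (@cvg_trans _ (W (v t) @[k --> \oo])); last exact: cvg_cst.
  apply: near_eq_cvg; near=> k => /=.
  rewrite indicE mem_set ?mul1r// /far/=.
  near: k; exact: (cvgr_lt _ ucvg).
- exact: (summable_norm sW).
- apply: aeW => t k _; rewrite lee_fin normrM ler_piMl//.
  by rewrite indicE; case: (_ \in _); rewrite ?normr1 ?normr0.
move=> _ _ H.
have sk k : vsummable (fun y => \1_(far x (u k)) y * W y).
  apply: (summable_le _ _ (summable_norm sW)).
    by apply: measurable_funM => //; exact: mW.
  move=> t; rewrite normrM ler_piMl//.
  by rewrite indicE; case: (_ \in _); rewrite ?normr1 ?normr0.
rewrite /comp -(EFin_Rintegral sW) in H.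
move: H; rewrite (_ : (fun k => _) =
  EFin \o (fun k => vint (fun y => \1_(far x (u k)) y * W y))).
  by move=> /fine_cvg.
by apply/funext => k /=; rewrite EFin_Rintegral//; exact: sk.
Unshelve. all: by end_near. Qed.

Lemma riesz_pv :
  (\int[mu]_(t in v @^-1` far x eps) (riesz_kernel j (x - v t) * g (v t)))
    @[eps --> 0^'+] --> - (kap / @riesz_const R n) * \int[leb]_a heat j h a x.
Proof.
have -> : - (kap / @riesz_const R n) * \int[leb]_a heat j h a x = vint W.
  apply: (mulfI rc_neq0); rewrite vintW.
  by rewrite mulNr mulrN mulrA mulrCA (mulfV rc_neq0) mulr1 mulNr.
apply: cvg_trans trunc_cvg; apply: near_eq_cvg; near=> eps.
by rewrite truncE trunc_sym.
Unshelve. all: by end_near. Qed.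

End pv.
End principal_value.

(** * The Riesz potential *)

Section product_measure.
Context d1 d2 (T1 : measurableType d1) (T2 : measurableType d2) (R : realType).
Variable m1 : {sigma_finite_measure set T1 -> \bar R}.
Variable m2 : {sigma_finite_measure set T2 -> \bar R}.

(* A copy of the product measure, for which canonical inference finds the
   sigma-finite structure (on [m1 \x m2] it insists on probabilities). *)
Definition sfprod : set (T1 * T2)%type -> \bar R := (m1 \x m2)%E.

HB.instance Definition _ := Measure.copy sfprod (m1 \x m2)%E.

Let sfprod_sigma_finite : sigma_finite setT sfprod.
Proof.
have [F TF Fk] := sigma_finiteT m1; have [G TG Gk] := sigma_finiteT m2.
exists (fun k => if unpickle k is Some (i, l) then F i `*` G l else set0) => [|k].
  apply/esym; rewrite -subTset => -[x y] _.
  have [i _ Fi] : (\bigcup_i F i) x by rewrite -TF.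
  have [l _ Gl] : (\bigcup_i G i) y by rewrite -TG.
  by exists (pickle (i, l)) => //; rewrite pickleK.
case: (unpickle k) => [[i l]|]; last by rewrite measure0.
have [mF Fi] := Fk i; have [mG Gl] := Gk l; split; first exact: measurableX.
by rewrite [sfprod _]product_measure1E// lte_mul_pinfty// ge0_fin_numE.
Qed.

HB.instance Definition _ := @Measure_isSigmaFinite.Build _ _ _ sfprod sfprod_sigma_finite.

End product_measure.

Section real_integrals_ae.
Context d (T : measurableType d) (R : realType).
Variable mu : {measure set T -> \bar R}.
Implicit Types f g : T -> R.

Lemma summable_ae_eq f g : measurable_fun [set: T] f -> summable_fun mu g ->
  {ae mu, forall t, f t = g t} -> summable_fun mu f /\ \int[mu]_t f t = \int[mu]_t g t.
Proof.
move=> mf sg fg.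
have mF : measurable_fun [set: T] (EFin \o f) by exact/measurable_EFinP.
have mG : measurable_fun [set: T] (EFin \o g) by exact/measurable_EFinP/summable_measurable/sg.
split.
  apply/integrableP; split => //; case/integrableP: sg => _.
  rewrite (_ : (\int[mu]_x `|(EFin \o f) x|)%E = \int[mu]_x `|(EFin \o g) x|)%E//.
  apply: ae_eq_integral => //; [exact: measurableT_comp|exact: measurableT_comp|].
  by apply: filterS fg => t /= -> _.
rewrite /Rintegral; congr fine; apply: ae_eq_integral => //.
by apply: filterS fg => t /= -> _.
Qed.

End real_integrals_ae.

Section potential.
Context (R : realType) (n : nat).
Local Notation RT := (measurableTypeR R).
Local Notation leb := (@lebesgue_measure R : {sigma_finite_measure set RT -> \bar R}).
Local Notation E := 'rV[R]_n.
Local Notation ET := (n.-tuple RT).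
Local Notation mu := (lebesgue_tuple n : {sigma_finite_measure set ET -> \bar R}).
Local Notation v := (@rV_of_tuple R n).
Local Notation kap := (peak_const R).
Implicit Types (h : E -> R) (x y w : E) (i j : 'I_n).

(** Associativity of convolution together with [gauss_semigroup]. For absolute convergence the same
    semigroup identity bounds the inner integral by N_s |d_j^2 h|. *)
Lemma heat_semigroup j h a b x : a != 0 -> b != 0 -> tame h ->
  vint (fun y => gauss b (x - y) * heat j h a y) = heat j h (Num.sqrt (a ^+ 2 + b ^+ 2)) x.
Proof.
move=> a0 b0 th; have tq := tame_pder j (tame_pder j th).
rewrite /heat; set q := pder j (pder j h) in tq *.
set s := Num.sqrt _.
have s0 : s != 0.
  rewrite gt_eqF// sqrtr_gt0 ltr_wpDr ?sqr_ge0//.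
  by rewrite exprn_even_gt0.
pose f (z : ET * ET) : R := gauss b (x - v z.1) * gauss a (v z.1 - v z.2) * q (v z.2).
have mf : measurable_fun [set: ET * ET] f.
  apply: measurable_funM; last first.
    apply: (measurableT_comp (measurable_continuous_tuple (tame_continuous tq))).
    exact: measurable_snd.
  apply: measurable_funM.
    exact: (measurableT_comp (measurable_gauss_tuple b x) measurable_fst).
  apply: measurable_gauss => // i.
  by apply: measurable_sub_tuple; [exact: measurable_fst|exact: measurable_snd].
have sK : summable_fun mu (fun t => `|gauss s (x - v t) * q (v t)|).
  apply: summable_norm; apply: vconv_summable => //; [exact: continuous_gauss|].
  exact: vsummable_gauss.
have sf : summable_fun (mu \x mu)%E f.
  apply: (@summable_prod2 _ _ _ _ _ mu mu f _ mf _ sK) => t.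
    have [H _] := gauss_semigroup x (v t) a0 b0.
    rewrite /f/=; under eq_fun do rewrite mulrC; exact: (summable_funZ _ H).
  have [H1 H2] := gauss_semigroup x (v t) a0 b0.
  rewrite normrM (ger0_norm (gauss_ge0 _ _)) -H2 -RintegralZr//.
  rewrite le_eqVlt; apply/orP; left; apply/eqP; apply: eq_Rintegral => z _.
  by rewrite /f/= normrM ger0_norm// mulr_ge0 ?gauss_ge0.
transitivity (\int[mu]_y \int[mu]_z f (y, z)).
  apply: eq_Rintegral => t _; rewrite {1}/vconv -vintZ; last first.
    exact: (vconv_summable (@continuous_gauss R n a) (vsummable_gauss n a0) tq).
  by apply: eq_Rintegral => z _; rewrite /f/= mulrA.
rewrite (Rfubini sf); apply: eq_Rintegral => t _.
have [H1 H2] := gauss_semigroup x (v t) a0 b0.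
by rewrite -H2 -RintegralZr.
Qed.

Lemma heat_abs j h a x : heat j h `|a| x = heat j h a x.
Proof.
apply: eq_Rintegral => t _; congr (_ * _); apply: gauss_sqr.
by rewrite real_normK// num_real.
Qed.

Section fixed_point.
Variables (h : E -> R) (j : 'I_n) (x : E).
Hypotheses (n1 : (1 < n)%N) (th : tame h).
Let n0 : (0 < n)%N. Proof. exact: ltnW. Qed.

(** The weight |a| spoils the a^-2 decay of [heat_decay]. For |a| >= 1 and n >= 2 the sup norm of
    [d2gauss j a] is O(a^-4), and pairing it with the L^1 norm of h leaves |a| a^-4 <= a^-2. *)
Lemma heat_time_decay : exists2 C : R, 0 <= C &
  forall a : R, `| `|a| * heat j h a x| <= C * lorentz a.
Proof.
have [C C0 HC] := heat_decay j n0 th.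
set Ih := vint (fun y => `|h y|).
have Ih0 : 0 <= Ih by apply: Rintegral_ge0.
set g := gauss_const R n + 1.
have g0 : 0 <= g by rewrite addr_ge0// gauss_const_ge0.
exists (C + g * Ih * 2) => [|a]; first by rewrite addr_ge0// mulr_ge0// mulr_ge0.
have la := lorentz_ge0 a.
rewrite normrM normr_id mulrDl.
have [a1|/ltW a1] := leP `|a| 1.
  have [H _ _] := HC a.
  apply: (@le_trans _ _ (C * lorentz a)).
    by apply: le_trans (H x); rewrite ler_piMl.
  by rewrite lerDl mulr_ge0// mulr_ge0// mulr_ge0.
have a0 : a != 0 by rewrite -normr_gt0 (lt_le_trans ltr01).
have av0 : 0 <= a ^- 2 by rewrite invr_ge0 sqr_ge0.
apply: (@le_trans _ _ (g * Ih * a ^- 2)); last first.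
  rewrite -[leLHS]add0r lerD//; first by rewrite mulr_ge0.
  rewrite -[leRHS]mulrA ler_wpM2l//; first by rewrite mulr_ge0.
  exact: lorentz_ge_large.
have sg := vsummableZ (a ^- 2 * (g * a ^- 2)) (vsummable_norm (tame_summable th)).
have H : `|heat j h a x| <= a ^- 2 * (g * a ^- 2) * Ih.
  rewrite heat_parts// -vintZ; last exact/vsummable_norm/tame_summable.
  apply: vint_norm_le => //.
    by apply: vconv_summable => //; [exact: continuous_d2gauss|exact: vsummable_d2gauss].
  move=> y; rewrite normrM ler_wpM2r//; apply: (le_trans (d2gauss_le _ _ a0)).
  rewrite ler_wpM2l// /g mulrDl mul1r lerD//; last exact: gauss_le_sqr.
  rewrite ler_wpM2l ?gauss_const_ge0//.
  have sq1 : 1 <= (Num.sqrt 2 : R) by rewrite -[leLHS]sqrtr1 ler_wsqrtr// ler1n.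
  have sa : `|a| <= `|Num.sqrt 2 * a| by rewrite normrM ler_peMl// ger0_norm// (le_trans ler01).
  apply: (le_trans (gauss_le_sqr _ n1 (le_trans a1 sa))).
  rewrite lef_pV2 ?posrE ?exprn_even_gt0//=; last by rewrite -normr_gt0 (lt_le_trans _ sa)// normr_gt0.
  by rewrite -(real_normK (num_real a)) -(real_normK (num_real (_ * a))) lerXn2r ?nnegrE.
apply: (@le_trans _ _ (`|a| * (a ^- 2 * (g * a ^- 2) * Ih))); first by rewrite ler_wpM2l.
rewrite [leLHS](_ : _ = (`|a| * a ^- 2) * (g * Ih * a ^- 2)); last by ring.
apply: ler_piMl; first by rewrite !mulr_ge0.
rewrite -(real_normK (num_real a)) ler_pdivrMr; last by rewrite exprn_gt0// normr_gt0.
by rewrite mul1r expr2 ler_peMl.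
Qed.

Let G (b : RT) : R := `|b| * heat j h b x.

Let mG : measurable_fun [set: RT] G.
Proof. apply: measurable_funM; last by apply: measurable_heat.
exact: (@normr_measurable R setT). Qed.

Lemma heat_abs_summable : summable_fun leb G.
Proof.
have [C C0 HC] := heat_time_decay.
apply: (summable_le mG HC); apply: summable_funZ; exact: (lorentz_integral R).1.
Qed.

Let f (z : ET * (RT * RT)) : R := gauss z.2.2 (x - v z.1) * heat j h z.2.1 (v z.1).

Let mf : measurable_fun [set: ET * (RT * RT)] f.
Proof.
have m2 : measurable_fun [set: ET * (RT * RT)] snd by exact: measurable_snd.
apply: measurable_funM.
  apply: measurable_gauss; first exact: (measurableT_comp measurable_snd m2).
  by move=> i; exact: (measurableT_comp (measurable_sub_const x i) measurable_fst).
apply: measurable_heat => //; first exact: (measurableT_comp measurable_fst m2).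
by move=> i; exact: (measurableT_comp (measurable_coord_tuple i) measurable_fst).
Qed.

(** Here [c.1] belongs to the Riesz transform and [c.2] to the potential. For |b| <= 1 the mass 1 of
    N_b meets the sup norm of the heat term; for |b| >= 1 the bound N_b <= b^-2 meets its L^1
    norm. *)
Let f_bound : exists2 C : R, 0 <= C & forall c : RT * RT,
  summable_fun mu (fun t => f (t, c)) /\
  \int[mu]_t `|f (t, c)| <= C * (lorentz c.1 * lorentz c.2).
Proof.
have [C C0 HC] := heat_decay j n0 th.
exists (2 * C) => [|[a b]]; first exact: mulr_ge0.
have [Hs si Hi] := HC a; have la := lorentz_ge0 a; have lb := lorentz_ge0 b.
have mc : measurable_fun [set: ET] (fun t => f (t, (a, b))) by exact: measurable_section2.
have [b0|b0] := eqVneq b 0.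
  have f0 t : f (t, (a, b)) = 0 by rewrite /f/= b0 gauss0// mul0r.
  split; first by rewrite /summable_fun; under eq_fun do rewrite /= f0; exact: integrable0.
  under eq_Rintegral do rewrite f0 normr0.
  by rewrite Rintegral_cst// mul0r; do ?apply: mulr_ge0.
have close (F : E -> R) : (forall t, `|f (t, (a, b))| <= F (v t)) -> vsummable F ->
    vint F <= 2 * C * (lorentz a * lorentz b) -> summable_fun mu (fun t => f (t, (a, b))) /\
    \int[mu]_t `|f (t, (a, b))| <= 2 * C * (lorentz a * lorentz b).
  move=> fF sF iF; have s1 := summable_le mc fF sF; split => //.
  apply: le_trans iF; apply: Rintegral_le => //; exact: summable_norm.
have [b1|/ltW b1] := leP `|b| 1.
  have [s1 E1] := vint_reflect x (vsummable_gauss n b0).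
  apply: (close (fun y => C * lorentz a * gauss b (x - y))).
  - by move=> t; rewrite /f/= normrM (ger0_norm (gauss_ge0 _ _)) mulrC ler_wpM2r// gauss_ge0.
  - exact: vsummableZ.
  - rewrite vintZ// E1 vint_gauss// mulr1.
    rewrite [leRHS](_ : _ = C * lorentz a * (2 * lorentz b)); last by ring.
    by rewrite ler_peMr ?lorentz_ge_small// mulr_ge0.
apply: (close (fun y => 2 * lorentz b * `|heat j h a y|)).
- move=> t; rewrite /f/= normrM (ger0_norm (gauss_ge0 _ _)) ler_wpM2r//.
  by apply: (le_trans (gauss_le_sqr _ n1 b1)); exact: lorentz_ge_large.
- exact/vsummableZ/vsummable_norm.
- rewrite vintZ; last exact: vsummable_norm.
  rewrite [leRHS](_ : _ = 2 * lorentz b * (C * lorentz a)); last by ring.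
  by rewrite ler_wpM2l// mulr_ge0.
Qed.

Let sl : summable_fun (leb \x leb)%E (fun c : RT * RT => lorentz c.1 * lorentz c.2).
Proof. by apply: summable_funX; exact: (lorentz_integral R).1. Qed.

Local Notation leb2 := (sfprod leb leb).

Let sf : summable_fun (mu \x leb2)%E f.
Proof.
have [C C0 HC] := f_bound.
apply: (@summable_prod2 _ _ _ _ _ mu leb2 f
  (fun c => C * (lorentz c.1 * lorentz c.2))) => //.
- by move=> c; exact: (HC c).1.
- exact: summable_funZ.
- by move=> c; exact: (HC c).2.
Qed.

(** Off the axes this is a radial function of (a, b), by the semigroup property; on the axes it is
    0, by the default value of the Gaussian at 0. *)
Let Q (c : RT * RT) : R := \int[mu]_t f (t, c).

Let Q_bound : exists2 C : R, 0 <= C & forall c : RT * RT,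
  `|Q c| <= C * (lorentz c.1 * lorentz c.2).
Proof.
have [C C0 HC] := f_bound; exists C => // c; have [s1 H1] := HC c.
exact: le_trans (le_normr_Rintegral measurableT s1) H1.
Qed.

Let mQ : measurable_fun [set: RT * RT] Q.
Proof. exact: measurable_Rintegral1. Qed.

Let Q0 a b : a = 0 \/ b = 0 -> Q (a, b) = 0.
Proof.
move=> ab; have f0 t : f (t, (a, b)) = 0.
  by rewrite /f/=; case: ab => ->; [rewrite heat0// mulr0|rewrite gauss0// mul0r].
by rewrite /Q; under eq_Rintegral do rewrite f0; rewrite Rintegral_cst// mul0r.
Qed.

Let QE a b : a != 0 -> b != 0 -> Q (a, b) = heat j h (Num.sqrt (a ^+ 2 + b ^+ 2)) x.
Proof. by move=> a0 b0; exact: heat_semigroup. Qed.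

Let sQ : summable_fun (leb \x leb)%E Q. Proof. exact: (Rfubini2 sf).1. Qed.

Let Q_sect b : summable_fun leb (fun a => Q (a, b)).
Proof.
have [C C0 HC] := Q_bound.
apply: (summable_le (g := fun a : RT => C * lorentz b * lorentz a)).
- exact: measurable_section2.
- by move=> a; rewrite -mulrA (mulrC (lorentz b)); exact: HC.
- by apply: summable_funZ; exact: (lorentz_integral R).1.
Qed.

(* The integral over the plane in the coordinates (b r, b). *)
Let S (z : RT * RT) : R := `|z.2| * Q (z.2 * z.1, z.2).

Let mS : measurable_fun [set: RT * RT] S.
Proof.
have m1 : measurable_fun [set: RT * RT] (fst : _ -> RT) by exact: measurable_fst.
have m2 : measurable_fun [set: RT * RT] (snd : _ -> RT) by exact: measurable_snd.
apply: measurable_funM; first exact: (measurableT_comp (@normr_measurable R setT) m2).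
apply: (measurableT_comp mQ); apply: measurable_fun_pair => //.
exact: measurable_funM.
Qed.

Let scale_change (k : R) (F : RT -> R) : k != 0 -> summable_fun leb F ->
  summable_fun leb (fun r => F (k * r)) /\
  `|k| * \int[leb]_r F (k * r) = \int[leb]_r F r.
Proof.
move=> k0 sF; have mk : measurable_fun [set: RT] (fun r : RT => k * r : RT).
  exact: measurable_funM.
have kE (g : RT -> \bar R) : measurable_fun [set: RT] g -> (forall r, (0 <= g r)%E) ->
    (\int[leb]_r g (k * r)%R = (`|k|%R^-1)%:E * \int[leb]_r g r)%E.
  move=> mg g0; have [kp|kn|/eqP] := ltgtP k 0; last by rewrite (negbTE k0).
    rewrite ltr0_norm// -(ge0_integral_opp mg g0).
    rewrite -(@ge0_integral_affine R (- k) 0 (fun r => g (- r)%R)) ?oppr_gt0//.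
      by apply: eq_integral => r _; rewrite addr0 mulNr opprK.
    exact: (measurableT_comp mg).
  rewrite gtr0_norm// -(@ge0_integral_affine R k 0 g)//.
  by apply: eq_integral => r _; rewrite addr0.
split; first exact: (summable_change mk kE sF).
rewrite (Rintegral_change mk kE sF) mulrA mulfV ?mul1r// normr_eq0.
by [].
Qed.

(** For fixed b the substitution a = b r has Jacobian |b|. At b = 0 all terms vanish because [Q] is
    0 on the axis. *)
Let S_sect (b : RT) : [/\ summable_fun leb (fun r => S (r, b)),
  \int[leb]_r S (r, b) = \int[leb]_a Q (a, b) &
  \int[leb]_r `|S (r, b)| = \int[leb]_a `|Q (a, b)| ].
Proof.
have [->|b0] := eqVneq b 0.
  have S0 r : S (r, 0) = 0 by rewrite /S/= normr0 mul0r.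
  split; first by rewrite /summable_fun; under eq_fun do rewrite /= S0; exact: integrable0.
    by apply: eq_Rintegral => r _; rewrite S0 Q0//; right.
  by apply: eq_Rintegral => r _; rewrite S0 Q0//; right.
have [s1 E1] := scale_change b0 (Q_sect b).
have [s2 E2] := scale_change b0 (summable_norm (Q_sect b)).
split; first exact: (summable_funZ `|b| s1).
  by rewrite -E1 -RintegralZl.
rewrite -E2 -RintegralZl//.
by apply: eq_Rintegral => r _; rewrite /S/= normrM normr_id.
Qed.

Let sS : summable_fun (leb \x leb)%E S.
Proof.
apply: (@summable_prod2 _ _ _ _ _ leb leb S (fun b => \int[leb]_a `|Q (a, b)|)).
- exact: mS.
- by move=> b; have [] := S_sect b.
- exact: (Rfubini2 (summable_norm sQ)).1.
- by move=> b; have [_ _ ->] := S_sect b.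
Qed.

(** With c^2 = 1 + r^2 the radius of (b r, b) is |c b|. One factor 1 / c comes from rewriting |b| as
    |c b| / c and another from the dilation by c, which together give [lorentz r]. *)
Let S_time (r : RT) : r != 0 -> \int[leb]_b S (r, b) = lorentz r * \int[leb]_b G b.
Proof.
move=> r0; have l0 : 0 < 1 + r ^+ 2 by rewrite ltr_pwDl// sqr_ge0.
pose c := Num.sqrt (1 + r ^+ 2); have c0 : 0 < c by rewrite sqrtr_gt0.
have c2 : c ^+ 2 = 1 + r ^+ 2 by rewrite sqr_sqrtr// ltW.
have SE b : S (r, b) = c^-1 * G (c * b).
  have [->|b0] := eqVneq b 0; first by rewrite /S/G/= mulr0 normr0 !mul0r mulr0.
  rewrite /S/= (QE (mulf_neq0 b0 r0) b0) /G normrM (gtr0_norm c0) -[_ * `|b| * _]mulrA.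
  rewrite (mulKf (lt0r_neq0 c0)) -(heat_abs _ _ (c * b)).
  have -> : Num.sqrt ((b * r) ^+ 2 + b ^+ 2) = `|c * b|.
    by rewrite -sqrtr_sqr; congr Num.sqrt; rewrite !exprMn c2; ring.
  by [].
under eq_Rintegral do rewrite SE.
have [s1 E1] := scale_change (lt0r_neq0 c0) heat_abs_summable.
transitivity (c^-1 * \int[leb]_b G (c * b)).
  by apply: RintegralZl; [exact: measurableT|exact: s1].
rewrite -E1 (gtr0_norm c0) /lorentz -c2.
move: (Rintegral _ _ _) => J.
by rewrite expr2 invfM mulrA mulfVK// gt_eqF.
Qed.

Let plane : \int[(leb \x leb)%E]_c Q c = pi * \int[leb]_b G b.
Proof.
rewrite -(Rfubini2 sQ).2.
transitivity (\int[leb]_b \int[leb]_r S (r, b)).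
  by apply: eq_Rintegral => b _; have [_ -> _] := S_sect b.
rewrite -(Rfubini sS).
have [sl1 El1] := lorentz_integral R.
have sl2 : summable_fun leb (fun r => lorentz r * \int[leb]_b G b).
  by under eq_fun do rewrite mulrC; exact: summable_funZ.
(* At r = 0 the left side is 0 by the default value of [Q] on the axis, so the identity is stated
   almost everywhere. *)
have ae0 : {ae leb, forall r : RT, \int[leb]_b S (r, b) = lorentz r * \int[leb]_b G b}.
  exists [set 0 : RT]; split; [exact: measurable_set1|exact: lebesgue_measure_set1|].
  by move=> r /=; apply: contra_notP => /eqP; exact: S_time.
have := (summable_ae_eq _ sl2 ae0).2; rewrite RintegralZr// El1; apply.
exact: (summable_measurable (Rfubini1 sS).1).
Qed.

Definition heat_time_integral y : R := \int[leb]_a heat j h a y.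

Lemma measurable_heat_time_integral :
  measurable_fun [set: ET] (fun t => heat_time_integral (v t)).
Proof.
apply: (@measurable_Rintegral2 _ _ _ _ _ leb (fun z : ET * RT => heat j h z.2 (v z.1))).
have m2 : measurable_fun [set: ET * RT] snd by exact: measurable_snd.
apply: (measurable_heat j th m2).
by move=> i; exact: (measurableT_comp (measurable_coord_tuple i) measurable_fst).
Qed.

Let P y := (enorm (x - y) `^ (n%:R - 1))^-1 * heat_time_integral y.

Let mP : measurable_fun [set: ET] (fun t => P (v t)).
Proof.
apply: measurable_funM; last exact: measurable_heat_time_integral.
apply: measurable_fun_inv => [|t]; last exact: powR_ge0.
exact: (measurableT_comp (measurable_powR _) (measurable_enorm_sub x)).
Qed.

Let gam_gt0 : 0 < @riesz_gamma R n 1.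
Proof.
rewrite /riesz_gamma; apply: divr_gt0.
  by rewrite !mulr_gt0 ?powR_gt0 ?pi_gt0// (@Gamma_half_nat_gt0 _ 1).
have -> : n%:R - 1 = n.-1%:R :> R by rewrite -subn1 (natrB _ n0).
by apply: Gamma_half_nat_gt0; rewrite -subn1 subn_gt0.
Qed.

(** For fixed y the integrand is a product in a and b, so the double integral splits; the factor in
    b is the potential kernel by [riesz_potential_kernel]. *)
Let PE t : v t != x ->
  P (v t) = kap * @riesz_gamma R n 1 * \int[leb2]_c f (t, c).
Proof.
move=> tx; have w0 : x - v t != 0 by rewrite subr_eq0 eq_sym.
have [s1 E1] := riesz_potential_kernel n1 w0.
have s2 := heat_time_summable j (v t) n0 th.
have -> : \int[leb2]_c f (t, c) = heat_time_integral (v t) * \int[leb]_b gauss b (x - v t).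
  rewrite -(RintegralX s2 s1); apply: eq_Rintegral => c _; exact: mulrC.
have mulACA (p g H I : R) : p * g * (H * I) = g * H * (p * I) by ring.
rewrite mulACA -E1 /P; have := lt0r_neq0 gam_gt0.
move: (riesz_gamma _) (_ `^ _)^-1 (heat_time_integral _) => g p H g0.
by rewrite mulrACA mulfV// mul1r mulrC.
Qed.

Lemma potential_heat : vsummable P /\
  (@riesz_gamma R n 1)^-1 * vint P = kap * (pi * \int[leb]_b (`|b| * heat j h b x)).
Proof.
have [s1 E1] := Rfubini1 sf.
have sF := summable_funZ (kap * @riesz_gamma R n 1) s1.
have aeP : {ae mu, forall t, P (v t) = kap * @riesz_gamma R n 1 * \int[leb2]_c f (t, c)}.
  by apply: filterS (ae_tuple_neq x n0) => t; exact: PE.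
have [sP EP] := summable_ae_eq mP sF aeP; split => //.
rewrite /vint EP RintegralZl// E1 -(Rfubini2 sf).2 plane.
have := lt0r_neq0 gam_gt0; move: (riesz_gamma _) (pi * _) => g p g0.
by rewrite -[kap * g * p]mulrA mulrCA mulKf.
Qed.

End fixed_point.
End potential.

(** * Integration over time *)

Section time_integral.
Context (R : realType) (n : nat).
Local Notation RT := (measurableTypeR R).
Local Notation leb := (@lebesgue_measure R : {sigma_finite_measure set RT -> \bar R}).
Local Notation E := 'rV[R]_n.
Local Notation ET := (n.-tuple RT).
Local Notation mu := (lebesgue_tuple n : {sigma_finite_measure set ET -> \bar R}).
Local Notation v := (@rV_of_tuple R n).
Local Notation pR := `]0%R, +oo[%classic.
Implicit Types (h : E -> R) (x y w : E) (i j : 'I_n).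

Let dtgauss (s : R) w : R := s * \sum_(j < n) d2gauss j s w.

Let dtgauss_continuous w (s : R) : 0 < s -> {for s, continuous (dtgauss^~ w)}.
Proof.
move=> s0; have sN0 : s != 0 by rewrite gt_eqF.
have cg : gauss r w @[r --> s] --> gauss s w.
  have [dg _] := is_derive_gauss_std w s0; move/derivable1_diffP: dg.
  exact: differentiable_continuous.
have cv : (r : R)^-1 @[r --> s] --> s^-1 by apply: cvgV => //; exact: cvg_id.
pose K (r : R) := r * ((sqn w * (r^-1 ^+ 2 * r^-1 ^+ 2) - n%:R * r^-1 ^+ 2) * gauss r w).
have -> : dtgauss^~ w = K.
  apply/funext => r.
  rewrite /dtgauss /K /d2gauss -mulr_suml; congr (_ * (_ * _)).
  rewrite sumrB sumr_const card_ord mulr_natl -exprVn /sqn mulr_suml; congr (_ - _).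
  by apply: eq_bigr => i _; rewrite exprMn -expr2.
apply: cvgM; first exact: cvg_id.
apply: cvgM => //; apply: cvgB.
  by apply: cvgM; [exact: cvg_cst|apply: cvgM; apply: cvgM].
by apply: cvgM; [exact: cvg_cst|apply: cvgM].
Qed.

Let dtgauss_ftc w (p q : R) : 0 < p -> p < q ->
  \int[leb]_(s in `[p, q]) dtgauss s w = gauss q w - gauss p w.
Proof.
move=> p0 pq.
have cg (s : R) : 0 < s -> {for s, continuous (fun r : R => gauss r w)}.
  move=> s0; have [dg _] := is_derive_gauss_std w s0; move/derivable1_diffP: dg.
  exact: differentiable_continuous.
rewrite /Rintegral (@continuous_FTC2 _ _ (fun s : R => gauss s w)) //=.
- apply: continuous_in_subspaceT => s; rewrite inE/= in_itv/= => /andP[ps _].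
  by apply: dtgauss_continuous; exact: lt_le_trans ps.
- split.
  + move=> s; rewrite in_itv/= => /andP[ps _].
    by have [] := is_derive_gauss_std w (lt_trans p0 ps).
  + by apply: cvg_at_right_filter; exact: cg.
  + by apply: cvg_at_left_filter; apply: cg; exact: lt_trans pq.
- move=> s; rewrite in_itv/= => /andP[ps _]; rewrite derive1E.
  by have [] := is_derive_gauss_std w (lt_trans p0 ps).
Qed.

Let norm_le_moment (s u c : R) : 0 < s -> u ^+ 2 <= c -> `|u| <= s + s^-1 * c.
Proof.
move=> s0 uc; rewrite -(ler_pM2l s0) mulrDr mulrA mulfV ?gt_eqF// mul1r.
apply: (@le_trans _ _ (s * s + u ^+ 2)); last by rewrite lerD2l.
rewrite -(real_normK (num_real u)); move: `|u| (normr_ge0 u) => a a0.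
have := sqr_ge0 (s - a); have := mulr_ge0 (ltW s0) a0; rewrite sqrrB !expr2.
by move: (s * a) (s * s) (a * a) => p q r; lra.
Qed.

(** First moments are traded for second ones through |w_i| <= s + |w|^2 / s; both terms have a
    Gaussian mean of order s. *)
Let gauss_moment (s L d : R) w : 0 < s -> 0 <= L -> `|d| <= L * \sum_(i < n) `|w ord0 i| ->
  `|gauss s w * d| <= L * n%:R * (s * gauss s w + s^-1 * (sqn w * gauss s w)).
Proof.
move=> s0 L0 dL; have g0 := gauss_ge0 s w.
rewrite normrM (ger0_norm g0) [leRHS](_ : _ = gauss s w * (L * (n%:R * (s + s^-1 * sqn w)))).
  rewrite ler_wpM2l//; apply: (le_trans dL); rewrite ler_wpM2l//.
  have -> : n%:R * (s + s^-1 * sqn w) = \sum_(i < n) (s + s^-1 * sqn w).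
    by rewrite sumr_const card_ord mulr_natl.
  by apply: ler_sum => i _; apply: norm_le_moment => //; exact: sqn_coord.
by move: (gauss s w) (sqn w) s^-1 (n%:R : R) => *; ring.
Qed.

Let mul3_le (s q d r M : R) : 0 <= s -> s <= q -> `|r| <= M -> s * `|d| * `|r| <= q * M * `|d|.
Proof.
move=> s0 sq rM; rewrite [leRHS]mulrAC; apply: ler_pM => //; first exact: mulr_ge0.
by rewrite ler_wpM2r.
Qed.

Let time_bound (p q s M g V : R) : 0 < p -> p <= s -> 0 <= q -> 0 <= M -> 0 <= g ->
  V <= g * s ^- 2 -> q * M * V <= q * (M * (g * p ^- 2)).
Proof.
move=> p0 ps q0 M0 g0 Vg; rewrite -mulrA ler_wpM2l// ler_wpM2l//.
apply: (le_trans Vg); rewrite ler_wpM2l//.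
have s0 := lt_le_trans p0 ps.
by rewrite lef_pV2 ?posrE ?exprn_gt0// lerXn2r ?nnegrE ?(ltW p0) ?(ltW s0).
Qed.

Section initial_value.
Variables (h : E -> R) (x : E).
Hypotheses (n1 : (1 < n)%N) (th : tame h).
Let n0 : (0 < n)%N. Proof. exact: ltnW. Qed.

(** The density is at most s^-2. The weaker s^-1 is kept so that both ends of the time interval are
    compared with the harmonic sequence. *)
Lemma vconv_gauss_large (s : R) : 1 <= s ->
  `|vconv (gauss s) h x| <= vint (fun y => `|h y|) * s^-1.
Proof.
move=> s1; have s0 : s != 0 by rewrite gt_eqF// (lt_le_trans ltr01).
have sn := vsummable_norm (tame_summable th).
rewrite mulrC -vintZ//; apply: vint_norm_le; last first.
- move=> y; rewrite normrM ler_wpM2r// ger0_norm ?gauss_ge0//.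
  apply: (le_trans (gauss_le_sqr _ n1 _)); first by rewrite ger0_norm// (le_trans ler01).
  rewrite lef_pV2 ?posrE ?exprn_gt0 ?(lt_le_trans ltr01 s1)//.
  by rewrite expr2 ler_peMl// (le_trans ler01).
- exact: vsummableZ.
- by apply: vconv_summable => //; [exact: continuous_gauss|exact: vsummable_gauss].
Qed.

(** Since the Gaussian has mass 1, the difference is the mean of h y - h x, controlled by the
    Lipschitz bound of h and [gauss_moment]. *)
Lemma vconv_gauss_small : exists2 C : R, 0 <= C & forall s : R, 0 < s ->
  `|vconv (gauss s) h x - h x| <= C * s.
Proof.
have [L L0 HL] := tame_lipschitz th; have gc0 := gauss_const_ge0 R n.
exists (L * n%:R * (1 + gauss_const R n)) => [|s s0].
  by apply: mulr_ge0; [exact: mulr_ge0|exact: addr_ge0].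
have sN0 : s != 0 by rewrite gt_eqF.
have [s1 E1] := vint_reflect x (vsummable_gauss n sN0).
have s2 : vsummable (fun y => gauss s (x - y) * h y).
  by apply: vconv_summable => //; [exact: continuous_gauss|exact: vsummable_gauss].
have s3 := vsummableZ (h x) s1.
pose D y := gauss s (x - y) * h y - h x * gauss s (x - y).
have sD : vsummable D by exact: vsummableB.
have -> : vconv (gauss s) h x - h x = vint D.
  by rewrite (vintB s2 s3) (vintZ _ s1) E1 (vint_gauss n sN0) mulr1.
have [sq Hq] := sqn_gauss_sum n sN0.
pose B w := L * n%:R * (s * gauss s w + s^-1 * (sqn w * gauss s w)).
have t1 := vsummableZ s (vsummable_gauss n sN0); have t2 := vsummableZ s^-1 sq.
have t3 := vsummableD t1 t2; have sB : vsummable B by exact: vsummableZ t3.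
have [sB' EB] := vint_reflect x sB.
have DB y : `|D y| <= B (x - y).
  rewrite /D [h x * _]mulrC -mulrBr; apply: (gauss_moment s0 L0).
  have -> : h y = h (x + - (x - y)) by rewrite opprB addrCA subrr addr0.
  apply: (le_trans (HL _ _)); apply: (ler_wpM2l L0).
  by apply: ler_sum => i _; rewrite [X in `|X|]mxE normrN.
apply: (le_trans (vint_norm_le sD sB' DB)).
rewrite EB (vintZ _ t3) (vintD t1 t2) (vintZ _ (vsummable_gauss n sN0)) (vintZ _ sq).
rewrite (vint_gauss n sN0) mulr1.
move: (vint _) Hq => V Hq; clear -s0 L0 gc0 Hq.
rewrite -[leRHS]mulrA; apply: ler_wpM2l; first exact: mulr_ge0.
rewrite mulrDl mul1r lerD2l ler_pdivrMl//; apply: (le_trans Hq).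
by rewrite [leRHS]mulrCA expr2.
Qed.

(** With the derivatives on the Gaussian, the sum over j becomes the s-derivative of the density,
    which is integrated first. Staying away from s = 0 provides the constant majorant for Fubini. *)
Lemma heat_time_ftc (p q : R) : 0 < p -> p < q ->
  \int[leb]_(s in `[p, q]) (`|s| * \sum_(j < n) heat j h s x) =
  vconv (gauss q) h x - vconv (gauss p) h x.
Proof.
move=> p0 pq; have q0 := lt_trans p0 pq.
have [M M0 HM] := tame_bounded th.
pose Ipq : RT -> R := \1_`[p, q]%classic.
have I01 s : Ipq s = 0 \/ Ipq s = 1 /\ p <= s <= q.
  rewrite /Ipq indicE; case: (boolP (_ \in _)) => [|_]; last by left.
  by rewrite inE/= in_itv/=; right.
have mI : measurable_fun [set: RT] Ipq by exact: measurable_indic.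
pose F j (z : ET * RT) : R := Ipq z.2 * `|z.2| * d2gauss j z.2 (x - v z.1) * h (v z.1).
have sFs j s : summable_fun mu (fun t => F j (t, s)).
  have [I0|[I1 /andP[ps sq]]] := I01 s.
    rewrite /summable_fun; under eq_fun do rewrite /F/= I0 !mul0r; exact: integrable0.
  have s0 : s != 0 by rewrite gt_eqF// (lt_le_trans p0).
  have H := vconv_summable (@continuous_d2gauss R n j s) (vsummable_d2gauss j s0) th x.
  rewrite /F/=; under eq_fun do rewrite -mulrA; exact: (summable_funZ _ H).
have FE j s : \int[mu]_t F j (t, s) = Ipq s * (`|s| * heat j h s x).
  have [I0|[I1 /andP[ps sq]]] := I01 s.
    by rewrite /F/= I0; under eq_Rintegral do rewrite !mul0r; rewrite Rintegral_cst// !mul0r.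
  have s0 : s != 0 by rewrite gt_eqF// (lt_le_trans p0).
  have H := vconv_summable (@continuous_d2gauss R n j s) (vsummable_d2gauss j s0) th x.
  rewrite heat_parts// /F/=; under eq_Rintegral do rewrite -mulrA.
  by rewrite RintegralZl// -mulrA.
pose g := gauss_const R n + 1.
have g0 : 0 <= g by rewrite addr_ge0// gauss_const_ge0.
have m1 : measurable_fun [set: ET * RT] (fst : _ -> ET) by exact: measurable_fst.
have m2 : measurable_fun [set: ET * RT] (snd : _ -> RT) by exact: measurable_snd.
have mF j : measurable_fun [set: ET * RT] (F j).
  apply: measurable_funM; last first.
    exact: (measurableT_comp (measurable_continuous_tuple (tame_continuous th)) m1).
  apply: measurable_funM.
    apply: measurable_funM; first exact: (measurableT_comp mI m2).
    exact: (measurableT_comp (@normr_measurable R setT) m2).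
  apply: (measurable_d2gauss j m2) => i.
  exact: (measurableT_comp (measurable_sub_const x i) m1).
have sF j : summable_fun (mu \x leb)%E (F j).
  apply: (@summable_prod2 _ _ _ _ _ mu leb (F j) (fun s => q * (M * (g * p ^- 2)) * Ipq s)) => //.
    by apply: summable_funZ; exact: integrable_indic_itv.
  move=> s; have [I0|[I1 /andP[ps sq]]] := I01 s.
    rewrite /F/= I0 mulr0; under eq_Rintegral do rewrite !mul0r normr0.
    by rewrite Rintegral_cst// mul0r.
  have s0' : 0 < s by exact: lt_le_trans ps.
  have s0 : s != 0 by rewrite gt_eqF.
  rewrite I1 mulr1.
  have [sd Ed] := vint_reflect x (vsummable_norm (vsummable_d2gauss j s0)).
  have sB := vsummableZ (q * M) sd.
  apply: (@le_trans _ _ (vint (fun y => q * M * `|d2gauss j s (x - y)|))).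
    apply: Rintegral_le; [exact/summable_norm/sFs|exact: sB|].
    move=> t; rewrite /F/= I1 mul1r; have /= := HM (v t).
    move: (d2gauss j s _) (h _) => d r rM; rewrite normrM normrM normr_id (ger0_norm (ltW s0')).
    exact: mul3_le (ltW s0') sq rM.
  rewrite (vintZ _ sd) Ed; have := vint_d2gauss_le j s0; rewrite -/g.
  exact: time_bound p0 ps (ltW q0) M0 g0.
pose f z := \sum_(j < n) F j z.
have sf : summable_fun (mu \x leb)%E f by exact: summable_sum.
have fE t s : f (t, s) = h (v t) * (Ipq s * dtgauss s (x - v t)).
  rewrite /f /F/= -mulr_suml [RHS]mulrC; congr (_ * _).
  rewrite -mulr_sumr /dtgauss -mulrA.
  have [->|[-> /andP[ps _]]] := I01 s; first by rewrite !mul0r.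
  by rewrite ger0_norm// (le_trans (ltW p0)).
have IE (u : RT -> R) : \int[leb]_(s in `[p, q]) u s = \int[leb]_s (Ipq s * u s).
  rewrite Rintegral_mkcond; apply: eq_Rintegral => s _.
  by rewrite patchE /Ipq indicE; case: ifPn => _; rewrite ?mul1r ?mul0r.
rewrite IE; transitivity (\int[leb]_s \int[mu]_t f (t, s)).
  apply: eq_Rintegral => s _; rewrite Rintegral_sum//.
  under [RHS]eq_bigr do rewrite FE.
  by rewrite -!mulr_sumr.
rewrite -(Rfubini sf) /vconv -vintB.
- apply: eq_Rintegral => t _; under eq_Rintegral do rewrite fE mulrCA.
  rewrite -IE -mulrBl -(dtgauss_ftc _ p0 pq) mulrC; apply: RintegralZl => //.
  apply: continuous_compact_integrable; first exact: segment_compact.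
  apply: continuous_in_subspaceT => s; rewrite inE/= in_itv/= => /andP[ps _].
  by apply: dtgauss_continuous; exact: lt_le_trans ps.
- by apply: vconv_summable => //; [exact: continuous_gauss|apply: vsummable_gauss; rewrite gt_eqF].
- by apply: vconv_summable => //; [exact: continuous_gauss|apply: vsummable_gauss; rewrite gt_eqF].
Qed.

Let Hs (s : RT) : R := \sum_(j < n) (`|s| * heat j h s x).

Let sHs : summable_fun leb Hs.
Proof. by apply: summable_sum => j; exact: heat_abs_summable. Qed.

Let p (k : nat) : R := k.+1%:R^-1.
(** k + 2 instead of k + 1 keeps [p k < q k] strict at k = 0. *)
Let q (k : nat) : R := k.+2%:R.

Let pq k : p k < q k.
Proof.
apply: (@le_lt_trans _ _ 1); last by rewrite /q ltr1n.
by rewrite /p invf_le1// ler1n.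
Qed.

Let exhaust_pos : \int[leb]_(s in `[p k, q k]) Hs s @[k --> \oo] --> \int[leb]_(s in pR) Hs s.
Proof.
have mk k : measurable (`[p k, q k]%classic : set RT) by [].
have := @dominated_convergence _ _ _ leb setT measurableT
  (fun k (s : RT) => (\1_(`[p k, q k]%classic) s * Hs s)%:E)
  (fun s => (\1_pR s * Hs s)%:E) (fun s => `|Hs s|%:E).
have mH := summable_measurable sHs.
have sI (A : set RT) : measurable A -> summable_fun leb (fun s => \1_A s * Hs s).
  move=> mA; apply: (summable_le _ _ (summable_norm sHs)).
    by apply: measurable_funM => //; exact: measurable_indic.
  move=> s; rewrite normrM ler_piMl// indicE.
  by case: (_ \in _); rewrite ?normr1 ?normr0.
have IE (A : set RT) : \int[leb]_(s in A) Hs s = \int[leb]_s (\1_A s * Hs s).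
  rewrite Rintegral_mkcond; apply: eq_Rintegral => s _.
  by rewrite patchE indicE; case: ifPn => _; rewrite ?mul1r ?mul0r.
case.
- by move=> k; apply/measurable_EFinP/summable_measurable/sI.
- by apply/measurable_EFinP/summable_measurable/sI; exact: measurable_pos.
- apply: aeW => s _.
  have [s0|s0] := ltP 0 s.
    apply: cvg_near_cst; near=> k; congr (_ * _)%:E.
    rewrite !indicE !mem_set//=; first by rewrite in_itv/= s0.
    rewrite in_itv/=; apply/andP; split.
      apply: ltW; near: k; have := @cvg_harmonic R; move/cvgr_lt; exact.
    apply: ltW; rewrite /q; near: k.
    exists (Num.truncn s) => // k /= sk; apply: (lt_le_trans (truncnS_gt s)).
    by rewrite ler_nat ltnS; exact: leqW sk.
  rewrite (_ : (fun k => _) = fun=> (\1_pR s * Hs s)%:E); first exact: cvg_cst.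
  apply/funext => k; congr (_ * _)%:E; rewrite !indicE !memNset//=.
    by rewrite in_itv/= andbT; apply/negP; rewrite -leNgt.
  rewrite in_itv/= => /andP[ps _]; have := lt_le_trans (natSinv_gt0 R k) (le_trans ps s0).
  by rewrite ltxx.
- exact: (summable_norm sHs).
- apply: aeW => s k _; rewrite lee_fin normrM ler_piMl// indicE.
  by case: (_ \in _); rewrite ?normr1 ?normr0.
move=> _ _ H; rewrite IE; move: H; rewrite -(EFin_Rintegral (sI _ (@measurable_pos R))).
rewrite (_ : (fun k => _) = EFin \o (fun k => \int[leb]_(s in `[p k, q k]) Hs s)).
  by move=> /fine_cvg.
by apply/funext => k /=; rewrite IE EFin_Rintegral//; exact: sI.
Unshelve. all: by end_near. Qed.

(** Evenness reduces to twice the half-line. On [p k, q k] the integral is the difference of the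
    Gaussian means of h, which tends to 0 - h x. *)
Lemma heat_time_total : \sum_(j < n) \int[leb]_b (`|b| * heat j h b x) = - 2 * h x.
Proof.
rewrite -Rintegral_sum; last by move=> j; exact: heat_abs_summable.
rewrite (Rintegral_even sHs); last first.
- by move=> s; apply: eq_bigr => j _; rewrite -(heat_abs j h (- s)) !normrN heat_abs.
- by apply: big1 => j _; rewrite normr0 mul0r.
rewrite mulNr -mulrN; congr (_ * _).
apply: (cvg_unique _ exhaust_pos) => //; apply/subr_cvg0.
have [C C0 HC] := vconv_gauss_small; set I := vint (fun y => `|h y|).
have I0 : 0 <= I by apply: Rintegral_ge0.
have bd k : `|\int[leb]_(s in `[p k, q k]) Hs s - - h x| <= (I + C) * harmonic k.
  have Ek : \int[leb]_(s in `[p k, q k]) Hs s = vconv (gauss (q k)) h x - vconv (gauss (p k)) h x.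
    rewrite -(heat_time_ftc (natSinv_gt0 R k) (pq k)).
    by apply: eq_Rintegral => s _; rewrite mulr_sumr.
  rewrite Ek opprK -addrA -[X in _ + X]opprK opprD opprK.
  apply: (le_trans (ler_normB _ _)); rewrite mulrDl; apply: lerD; last exact/HC/natSinv_gt0.
  have q1 : 1 <= q k by rewrite ler1n.
  apply: (le_trans (vconv_gauss_large q1)); apply: (ler_wpM2l I0).
  by rewrite lef_pV2 ?posrE ?ltr0n// ler_nat.
have hc : (I + C) * harmonic k @[k --> \oo] --> 0.
  by rewrite -(mulr0 (I + C)); apply: cvgM; [exact: cvg_cst|exact: cvg_harmonic].
apply/norm_cvg0P; apply: (squeeze_cvgr _ (cvg_cst 0) hc).
by apply: nearW => k; rewrite bd andbT.
Qed.

End initial_value.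
End time_integral.

(** * Schwartz functions and chirps *)

Section real_schwartz.
Context (R : realType) (n : nat).
Local Notation E := 'rV[R]_n.
Local Notation e_ j := (@ebase R n j).
Implicit Types (f g : E -> R) (x : E) (j k : 'I_n) (s l : seq 'I_n).

Definition rsmooth g := forall s,
  continuous (pders s g) /\ forall j x, derivable (pders s g) x (e_ j).

Definition rschwartz g := rsmooth g /\
  forall (a : 'I_n -> nat) s, exists M : R,
    forall x, `|monomial a x| * `|pders s g x| <= M.

Lemma pders_rcons s j g : pders (rcons s j) g = pders s (pder j g).
Proof. exact: foldr_rcons. Qed.

Lemma rsmooth_pder j g : rsmooth g -> rsmooth (pder j g).
Proof. by move=> sg s; rewrite -pders_rcons. Qed.

Lemma rschwartz_pder j g : rschwartz g -> rschwartz (pder j g).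
Proof.
case=> sg bg; split; first exact: rsmooth_pder.
by move=> a s; rewrite -pders_rcons; exact: bg.
Qed.

Lemma rsmooth_derive g s j x : rsmooth g ->
  is_derive x (e_ j) (pders s g) (pders (j :: s) g x).
Proof. by move=> /(_ s)[_ dg]; split. Qed.

Lemma pderE j g dg : (forall x, is_derive x (e_ j) g (dg x)) -> pder j g = dg.
Proof. by move=> H; apply/funext => x; have [_] := H x. Qed.

Lemma pders_add s f g : rsmooth f -> rsmooth g ->
  pders s (fun x => f x + g x) = (fun x => pders s f x + pders s g x).
Proof.
move=> sf sg; elim: s => [//|j s IH]; rewrite [LHS]/= IH.
by apply: pderE => x; apply: is_deriveD; exact: rsmooth_derive.
Qed.

Lemma rsmooth_add f g : rsmooth f -> rsmooth g -> rsmooth (fun x => f x + g x).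
Proof.
move=> sf sg s; rewrite pders_add//; split.
  by apply: continuous_add; [case: (sf s)|case: (sg s)].
by move=> j x; apply: derivableD; [case: (sf s)|case: (sg s)].
Qed.

Lemma rschwartz_add f g : rschwartz f -> rschwartz g -> rschwartz (fun x => f x + g x).
Proof.
move=> [sf bf] [sg bg]; split; first exact: rsmooth_add.
move=> a s; have [M HM] := bf a s; have [N HN] := bg a s; exists (M + N) => x.
rewrite pders_add//; apply: le_trans (lerD (HM x) (HN x)).
by rewrite -mulrDr ler_wpM2l// ler_normD.
Qed.

Lemma pders_scale s (c : R) g : rsmooth g ->
  pders s (fun x => c * g x) = (fun x => c * pders s g x).
Proof.
move=> sg; elim: s => [//|j s IH]; rewrite [LHS]/= IH.
by apply: pderE => x; exact: (is_deriveZ c (rsmooth_derive s j x sg)).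
Qed.

Lemma rschwartz_scale (c : R) g : rschwartz g -> rschwartz (fun x => c * g x).
Proof.
move=> [sg bg]; split.
  move=> s; rewrite pders_scale//; split.
    by apply: continuous_mul; [exact: continuous_cst|case: (sg s)].
  by move=> j x; have [+ _] := is_deriveZ c (rsmooth_derive s j x sg).
move=> a s; have [M HM] := bg a s; exists (`|c| * M) => x.
by rewrite pders_scale// normrM mulrCA ler_wpM2l.
Qed.

Lemma rsmooth_sum (L : seq (seq 'I_n)) g j x : rsmooth g ->
  is_derive x (e_ j) (fun x => \sum_(l <- L) pders l g x) (\sum_(l <- L) pders (j :: l) g x).
Proof.
move=> sg; elim: L => [|l L IH].
  under eq_fun do rewrite big_nil; rewrite big_nil; exact: is_derive_cst.
under eq_fun do rewrite big_cons; rewrite big_cons.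
by apply: is_deriveD => //; exact: rsmooth_derive.
Qed.

Lemma is_derive_coordM k j g x dg : is_derive x (e_ j) g dg ->
  is_derive x (e_ j) (fun x => x ord0 k * g x) ((k == j)%:R * g x + x ord0 k * dg).
Proof.
move=> dgx; apply: (is_derive_eq (is_deriveM (is_derive_coord x k j) dgx)).
by rewrite /GRing.scale/= addrC [g x * _]mulrC.
Qed.

(* Leibniz: the remainder only involves derivatives of g of lower order. *)
Lemma pders_coordM k g s : rsmooth g -> exists L : seq (seq 'I_n),
  pders s (fun x => x ord0 k * g x) =
  (fun x => x ord0 k * pders s g x + \sum_(l <- L) pders l g x).
Proof.
move=> sg; elim: s => [|j s [L IH]].
  by exists [::]; apply/funext => x; rewrite big_nil addr0.
exists (nseq (k == j) s ++ map (cons j) L); rewrite [LHS]/= IH.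
apply: pderE => x; rewrite big_cat/= big_map.
apply: (is_derive_eq (is_deriveD (is_derive_coordM k (rsmooth_derive s j x sg))
  (rsmooth_sum L j x sg))).
rewrite [RHS]addrCA addrA; congr (_ + _ + _).
by case: eqVneq => _; rewrite ?big_seq1 ?big_nil ?mul1r ?mul0r.
Qed.

Lemma monomial_coordM a k x :
  monomial a x * x ord0 k = monomial (fun i => (a i + (i == k))%N) x.
Proof.
rewrite /monomial (bigD1 k)//= [RHS](bigD1 k)//= eqxx addn1 exprSr mulrAC.
congr (_ * _); apply: eq_bigr => i /negbTE ->; by rewrite addn0.
Qed.

Lemma rschwartz_coordM k g : rschwartz g -> rschwartz (fun x => x ord0 k * g x).
Proof.
move=> [sg bg]; split=> [s|a s]; have [L ->] := pders_coordM k s sg.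
  split.
    apply: continuous_add.
      by apply: continuous_mul; [exact: continuous_coord|case: (sg s)].
    by apply: continuous_sum => l; case: (sg l).
  move=> j x.
  by have [+ _] := is_deriveD (is_derive_coordM k (rsmooth_derive s j x sg)) (rsmooth_sum L j x sg).
have [M HM] := bg (fun i => (a i + (i == k))%N) s.
have [N HN] : exists N : R, forall x, `|monomial a x| * (\sum_(l <- L) `|pders l g x|) <= N.
  elim: L => [|l L [N HN]]; first by exists 0 => x; rewrite big_nil mulr0.
  have [N' HN'] := bg a l; exists (N' + N) => x.
  by rewrite big_cons mulrDr lerD.
exists (M + N) => x; apply: le_trans (lerD (HM x) (HN x)).
have -> : `|monomial (fun i => (a i + (i == k))%N) x| * `|pders s g x| =
    `|monomial a x| * `|x ord0 k * pders s g x|.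
  by rewrite -(monomial_coordM a k x) !normrM mulrA.
rewrite -mulrDr ler_wpM2l//.
by apply: le_trans (ler_normD _ _) _; rewrite lerD2l; exact: ler_norm_sum.
Qed.

Lemma rschwartz_continuous g : rschwartz g -> continuous g.
Proof. by case=> /(_ [::])[]. Qed.

Lemma rschwartz_bounded g : rschwartz g -> exists M : R, forall x, `|g x| <= M.
Proof.
case=> _ /(_ (fun=> 0%N) [::])[M HM]; exists M => x; have := HM x.
by rewrite /monomial big1 ?normr1 ?mul1r.
Qed.

Lemma rschwartz_prodM (s : seq 'I_n) g : rschwartz g ->
  rschwartz (fun x => \prod_(i <- s) (1 + x ord0 i ^+ 2) * g x).
Proof.
move=> sg; elim: s => [|i s IH]; first by under eq_fun do rewrite big_nil mul1r.
have := rschwartz_add IH (rschwartz_coordM i (rschwartz_coordM i IH)).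
by congr rschwartz; apply/funext => x; rewrite big_cons; ring.
Qed.

(** Multiplied by the product of the 1 + x_i^2, g stays bounded; hence it is dominated by a product
    of functions [lorentz]. *)
Lemma rschwartz_summable g : rschwartz g -> vsummable g.
Proof.
move=> sg; have [M HM] := rschwartz_bounded (rschwartz_prodM (enum 'I_n) sg).
have [sl El] := lorentz_integral R.
have [sP _] := @vsummable_prod R n (fun=> @lorentz R) (fun=> pi)
  (fun=> @measurable_lorentz R) (fun _ => @lorentz_ge0 R)
  (fun=> etrans (esym (EFin_Rintegral sl)) (congr1 EFin El)).
apply: (vsummable_cont_le (rschwartz_continuous sg) _ (vsummableZ M sP)) => x.
have P0 : 0 < \prod_(i < n) (1 + x ord0 i ^+ 2).
  by apply: prodr_gt0 => i _; rewrite ltr_pwDl// sqr_ge0.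
have := HM x; rewrite big_enum/= normrM (ger0_norm (ltW P0)) mulrC -ler_pdivlMr//.
by rewrite /lorentz prodfV.
Qed.

End real_schwartz.

(** * Derivatives of the product of a chirp and a Schwartz function *)

Section chirp_product.
Context (R : realType) (n : nat) (alpha : 'rV[R]_n).
Local Notation E := 'rV[R]_n.
Local Notation e_ j := (@ebase R n j).
Implicit Types (p q : E -> R) (x : E) (j k : 'I_n) (s : seq 'I_n).

Definition phase x : R := 2 * pi * \sum_(k < n) chirp_coef (alpha ord0 k) * x ord0 k ^+ 2.

Definition phase_slope j : R := 4 * pi * chirp_coef (alpha ord0 j).

Lemma is_derive_phase j x : is_derive x (e_ j) phase (phase_slope j * x ord0 j).
Proof.
have H k := is_deriveZ (chirp_coef (alpha ord0 k)) (@is_deriveX _ _ _ 2 _ _ _ (is_derive_coord x k j)).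
have := is_deriveZ (2 * pi : R) (is_derive_sum H).
rewrite (_ : _ \*: _ = phase); last first.
  by apply/funext => y; rewrite /phase /= fct_sumE.
move=> d; apply: (is_derive_eq d).
rewrite (bigD1 j)//= big1 ?addr0 => [|k /negbTE kj].
  by rewrite eqxx /phase_slope /GRing.scale/= expr1; ring.
by rewrite /GRing.scale/= kj !mulr0.
Qed.

Lemma continuous_phase : continuous phase.
Proof.
apply: continuous_mul; first exact: continuous_cst.
apply: continuous_sum => k; apply: continuous_mul; first exact: continuous_cst.
by apply: continuous_mul; exact: continuous_coord.
Qed.

Let C x := cos (phase x).
Let S x := sin (phase x).

Let continuousC : continuous C.
Proof. by move=> x; apply: (cvg_comp _ _ (@continuous_phase x)); exact: continuous_cos. Qed.

Let continuousS : continuous S.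
Proof. by move=> x; apply: (cvg_comp _ _ (@continuous_phase x)); exact: continuous_sin. Qed.

Let phase_line j x : is_derive (0 : R) (1 : R) (fun s : R => phase (x + s *: e_ j)) (phase_slope j * x ord0 j).
Proof.
have [dp <-] := is_derive_phase j x.
by have := @derive_line R n phase x (e_ j) 0; rewrite scale0r addr0; apply.
Qed.

Let is_deriveC j x : is_derive x (e_ j) C (- S x * (phase_slope j * x ord0 j)).
Proof.
apply: is_derive_line; have := is_derive1_comp (is_derive_cos _) (phase_line j x).
by rewrite scale0r addr0.
Qed.

Let is_deriveS j x : is_derive x (e_ j) S (C x * (phase_slope j * x ord0 j)).
Proof.
apply: is_derive_line; have := is_derive1_comp (is_derive_sin _) (phase_line j x).
by rewrite scale0r addr0.
Qed.

(** With [chirp_diffr], the real and imaginary parts of exp(- i phase) d_j (exp(i phase) (p + i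
    q)). *)
Definition chirp_diffl j p q x : R := pder j p x - phase_slope j * (x ord0 j * q x).
Definition chirp_diffr j p q x : R := pder j q x + phase_slope j * (x ord0 j * p x).

Lemma rschwartz_chirp_diffl j p q : rschwartz p -> rschwartz q -> rschwartz (chirp_diffl j p q).
Proof.
move=> sp sq; have := rschwartz_add (rschwartz_pder j sp)
  (rschwartz_scale (- phase_slope j) (rschwartz_coordM j sq)).
by congr rschwartz; apply/funext => x; rewrite mulNr.
Qed.

Lemma rschwartz_chirp_diffr j p q : rschwartz p -> rschwartz q -> rschwartz (chirp_diffr j p q).
Proof.
move=> sp sq; exact: (rschwartz_add (rschwartz_pder j sq)
  (rschwartz_scale (phase_slope j) (rschwartz_coordM j sp))).
Qed.

Definition chirp_re p q x : R := cos (phase x) * p x - sin (phase x) * q x.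

Lemma is_derive_chirp_re j p q x : rschwartz p -> rschwartz q ->
  is_derive x (e_ j) (chirp_re p q) (chirp_re (chirp_diffl j p q) (chirp_diffr j p q) x).
Proof.
move=> [sp _] [sq _].
have dp := rsmooth_derive [::] j x sp; have dq := rsmooth_derive [::] j x sq.
apply: (is_derive_eq (is_deriveB (is_deriveM (is_deriveC j x) dp) (is_deriveM (is_deriveS j x) dq))).
rewrite /GRing.scale/= /chirp_re /chirp_diffl /chirp_diffr -/(C x) -/(S x).
by move: (C x) (S x) (pder j p x) (pder j q x) (p x) (q x) (x ord0 j) (phase_slope j) => *; ring.
Qed.

Lemma pders_chirp_re s p q : rschwartz p -> rschwartz q ->
  exists p' q', [/\ rschwartz p', rschwartz q' & pders s (chirp_re p q) = chirp_re p' q'].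
Proof.
move=> sp sq; elim: s => [|j s [p' [q' [sp' sq' IH]]]]; first by exists p, q.
exists (chirp_diffl j p' q'), (chirp_diffr j p' q'); split.
- exact: rschwartz_chirp_diffl.
- exact: rschwartz_chirp_diffr.
- by rewrite [LHS]/= IH; apply: pderE => x; exact: is_derive_chirp_re.
Qed.

(** Each derivative again has the form [chirp_re p' q'] with p' and q' Schwartz, and the oscillating
    factors are bounded by 1. *)
Lemma tame_chirp_re p q : rschwartz p -> rschwartz q -> tame (chirp_re p q).
Proof.
move=> sp0 sq0 s; have [p' [q' [sp sq ->]]] := pders_chirp_re s sp0 sq0.
have cc : continuous (chirp_re p' q').
  apply: continuous_add; last apply: continuous_opp; apply: continuous_mul => //;
    exact: rschwartz_continuous.
have bd x : `|chirp_re p' q' x| <= `|p' x| + `|q' x|.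
  apply: le_trans (ler_normB _ _) _; rewrite !normrM.
  by apply: lerD; rewrite ler_piMl// ?cos_le1 ler_norml ?cos_geN1 ?cos_le1 ?sin_geN1 ?sin_le1.
split => //.
- by move=> j x; have [] := is_derive_chirp_re j x sp sq.
- apply: (vsummable_cont_le cc bd).
  by apply: vsummableD; exact/vsummable_norm/rschwartz_summable.
- have [M HM] := rschwartz_bounded sp; have [N HN] := rschwartz_bounded sq.
  by exists (M + N) => x; apply: le_trans (bd x) _; rewrite lerD.
Qed.

End chirp_product.

(** * Complex-valued functions *)

Local Open Scope complex_scope.
Local Open Scope ring_scope.

Section complex_parts.
Context (R : realType).
Implicit Types (z w : R[i]).

Lemma ReM z w : complex.Re (z * w) = complex.Re z * complex.Re w - complex.Im z * complex.Im w.
Proof. by case: z w => [a b] [c d]. Qed.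

Lemma ImM z w : complex.Im (z * w) = complex.Re z * complex.Im w + complex.Im z * complex.Re w.
Proof. by case: z w => [a b] [c d]. Qed.

Lemma ReD z w : complex.Re (z + w) = complex.Re z + complex.Re w.
Proof. by case: z w => [a b] [c d]. Qed.

Lemma ImD z w : complex.Im (z + w) = complex.Im z + complex.Im w.
Proof. by case: z w => [a b] [c d]. Qed.

Lemma complex_sum (I : Type) (s : seq I) (a b : I -> R) :
  \sum_(i <- s) (a i +i* b i) = (\sum_(i <- s) a i) +i* (\sum_(i <- s) b i).
Proof.
elim: s => [|i s IH]; first by rewrite !big_nil.
by rewrite !big_cons IH.
Qed.

Lemma complexM (a b c d : R) : (a +i* b) * (c +i* d) = (a * c - b * d) +i* (a * d + b * c).
Proof. by []. Qed.

Lemma real_complexM (r a b : R) : r%:C * (a +i* b) = (r * a) +i* (r * b).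
Proof. by rewrite complexM !mul0r subr0 addr0. Qed.

Lemma eq_complexP z w : complex.Re z = complex.Re w -> complex.Im z = complex.Im w -> z = w.
Proof. by case: z w => [a b] [c d] /= -> ->. Qed.

Lemma real_complexV (r : R) : (r%:C)^-1 = (r^-1)%:C.
Proof. by rewrite -fmorphV. Qed.

Lemma normcE z : Normc.normc z = Num.sqrt (complex.Re z ^+ 2 + complex.Im z ^+ 2).
Proof. by case: z. Qed.

Lemma Re_le_normc z : `|complex.Re z| <= Normc.normc z.
Proof. by rewrite normcE -sqrtr_sqr ler_wsqrtr// lerDl sqr_ge0. Qed.

Lemma Im_le_normc z : `|complex.Im z| <= Normc.normc z.
Proof. by rewrite normcE -sqrtr_sqr ler_wsqrtr// lerDr sqr_ge0. Qed.

Lemma normc_le z : Normc.normc z <= `|complex.Re z| + `|complex.Im z|.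
Proof.
have H0 : 0 <= `|complex.Re z| + `|complex.Im z| by rewrite addr_ge0.
rewrite normcE -[leRHS](ger0_norm H0) -sqrtr_sqr ler_wsqrtr// sqrrD !real_normK ?num_real//.
by rewrite lerD2r lerDl mulrn_wge0// mulr_ge0.
Qed.

End complex_parts.

(** * Real and imaginary parts of Schwartz functions, and tempered distributions *)

Section schwartz_parts.
Context (R : realType) (n : nat).
Local Notation E := 'rV[R]_n.
Implicit Types (u f phi : E -> R[i]) (x : E) (j : 'I_n) (s : seq 'I_n).

Lemma Re_partials s u : @complex.Re R \o partials s u = pders s (@complex.Re R \o u).
Proof. by elim: s => [//|j s IH]; rewrite /= -IH. Qed.

Lemma Im_partials s u : @complex.Im R \o partials s u = pders s (@complex.Im R \o u).
Proof. by elim: s => [//|j s IH]; rewrite /= -IH. Qed.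

Lemma schwartzP u : schwartz u <->
  rschwartz (@complex.Re R \o u) /\ rschwartz (@complex.Im R \o u).
Proof.
split=> [[su bu]|[[sr br] [si bi]]].
  split; split=> [s|a s].
  - have [c1 c2 d] := su s; rewrite -Re_partials; split => // j x; exact: (d j x).1.
  - have [M HM] := bu a s; exists M => x; apply: le_trans (HM x).
    by rewrite ler_wpM2l// -Re_partials; exact: Re_le_normc.
  - have [c1 c2 d] := su s; rewrite -Im_partials; split => // j x; exact: (d j x).2.
  - have [M HM] := bu a s; exists M => x; apply: le_trans (HM x).
    by rewrite ler_wpM2l// -Im_partials; exact: Im_le_normc.
split=> [s|a s].
  have [c1 d1] := sr s; have [c2 d2] := si s.
  split; rewrite ?Re_partials ?Im_partials// => j x.
  by split; rewrite ?Re_partials ?Im_partials; [exact: d1|exact: d2].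
have [M HM] := br a s; have [N HN] := bi a s; exists (M + N) => x.
apply: le_trans (lerD (HM x) (HN x)); rewrite -mulrDr ler_wpM2l//.
by rewrite -Re_partials -Im_partials; exact: normc_le.
Qed.

Definition Csummable u := vsummable (@complex.Re R \o u) /\ vsummable (@complex.Im R \o u).

Lemma CintegrableT u : Cintegrable setT u <-> Csummable u.
Proof. by rewrite /Cintegrable preimage_setT. Qed.

Lemma CintegralT u : Cintegral setT u =
  vint (@complex.Re R \o u) +i* vint (@complex.Im R \o u).
Proof. by rewrite /Cintegral preimage_setT. Qed.

Lemma Csummable_linear (c : R[i]) u1 u2 : Csummable u1 -> Csummable u2 ->
  Cintegral setT (fun x => c * u1 x + u2 x) = c * Cintegral setT u1 + Cintegral setT u2.
Proof.
move=> [r1 i1] [r2 i2]; rewrite !CintegralT.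
have E1 : @complex.Re R \o (fun x => c * u1 x + u2 x) = fun x =>
    complex.Re c * (@complex.Re R \o u1) x - complex.Im c * (@complex.Im R \o u1) x +
    (@complex.Re R \o u2) x.
  by apply/funext => x /=; rewrite ReD ReM.
have E2 : @complex.Im R \o (fun x => c * u1 x + u2 x) = fun x =>
    complex.Re c * (@complex.Im R \o u1) x + complex.Im c * (@complex.Re R \o u1) x +
    (@complex.Im R \o u2) x.
  by apply/funext => x /=; rewrite ImD ImM.
rewrite E1 E2.
have t1 := vsummableZ (complex.Re c) r1; have t2 := vsummableZ (complex.Im c) i1.
have t3 := vsummableZ (complex.Re c) i1; have t4 := vsummableZ (complex.Im c) r1.
rewrite (vintD (vsummableB t1 t2) r2) (vintB t1 t2) (vintD (vsummableD t3 t4) i2) (vintD t3 t4).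
rewrite (vintZ _ r1) (vintZ _ i1) (vintZ _ i1) (vintZ _ r1).
by apply: eq_complexP; rewrite ?ReD ?ImD ?ReM ?ImM.
Qed.

Let schwartz_bounded phi : schwartz phi -> forall x, Normc.normc (phi x) <= schwartz_norm 0 phi.
Proof.
move=> sp x; rewrite /schwartz_norm; set A := [set r | _].
(* In order 0 all exponents vanish and no derivative is left, so the seminorm is the sup norm.
   Boundedness of the set, which [sup] requires, comes from the definition of [schwartz]. *)
have mon0 (a : 'I_n -> nat) y : (\sum_(j < n) a j <= 0)%N -> monomial a y = 1.
  rewrite leqn0 sum_nat_eq0 => /forallP a0; rewrite /monomial big1// => j _.
  by have /eqP -> := implyP (a0 j) isT; rewrite expr0.
have [M HM] := sp.2 (fun=> 0%N) [::].
apply: ub_le_sup; last first.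
  exists (fun=> 0%N), [::], x; split => //; first by rewrite big1.
  by rewrite mon0 ?big1// normr1 mul1r.
exists M => r [a [s [y [a0]]]]; rewrite leqn0 size_eq0 => /eqP -> ->.
by have := HM y; rewrite !mon0// big1.
Qed.

(** The pairing is controlled by the L^1 norms of the two parts of f and the sup norm of the test
    function, hence order 0; the factor 2 accounts for the two parts of the pairing. *)
Lemma schwartz_tempered f : schwartz f -> tempered_function f.
Proof.
move=> /schwartzP[fr fi].
have sr := rschwartz_summable fr; have si := rschwartz_summable fi.
pose F x : R := `|complex.Re (f x)| + `|complex.Im (f x)|.
have sF : vsummable F by apply: vsummableD; exact: vsummable_norm.
have cf phi : schwartz phi -> continuous (@complex.Re R \o phi) /\ continuous (@complex.Im R \o phi).
  by move=> /schwartzP[/rschwartz_continuous c1 /rschwartz_continuous c2].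
have cfr := rschwartz_continuous fr; have cfi := rschwartz_continuous fi.
have cRe phi : schwartz phi -> continuous (@complex.Re R \o (fun x => f x * phi x)).
  move=> /cf[c1 c2]; rewrite (_ : _ \o _ = fun x =>
    (@complex.Re R \o f) x * (@complex.Re R \o phi) x -
    (@complex.Im R \o f) x * (@complex.Im R \o phi) x).
    by apply: continuous_add; [|apply: continuous_opp]; exact: continuous_mul.
  by apply/funext => x; exact: ReM.
have cIm phi : schwartz phi -> continuous (@complex.Im R \o (fun x => f x * phi x)).
  move=> /cf[c1 c2]; rewrite (_ : _ \o _ = fun x =>
    (@complex.Re R \o f) x * (@complex.Im R \o phi) x +
    (@complex.Im R \o f) x * (@complex.Re R \o phi) x).
    by apply: continuous_add; exact: continuous_mul.
  by apply/funext => x; exact: ImM.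
have bd phi x : schwartz phi -> Normc.normc (f x * phi x) <= schwartz_norm 0 phi * F x.
  move=> sp; rewrite Normc.normcM mulrC; have := schwartz_bounded sp x => H.
  apply: ler_pM => //; rewrite ?normcE ?sqrtr_ge0//.
  by rewrite -normcE; exact: normc_le.
have bRe phi x : schwartz phi -> `|complex.Re (f x * phi x)| <= schwartz_norm 0 phi * F x.
  by move=> sp; apply: le_trans (bd _ _ sp); exact: Re_le_normc.
have bIm phi x : schwartz phi -> `|complex.Im (f x * phi x)| <= schwartz_norm 0 phi * F x.
  by move=> sp; apply: le_trans (bd _ _ sp); exact: Im_le_normc.
have sfp phi : schwartz phi -> Csummable (fun x => f x * phi x).
  move=> sp; split.
    exact: (vsummable_cont_le (cRe _ sp) (fun x => bRe _ x sp) (vsummableZ _ sF)).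
  exact: (vsummable_cont_le (cIm _ sp) (fun x => bIm _ x sp) (vsummableZ _ sF)).
split; first by move=> phi sp; apply/CintegrableT; exact: sfp.
split=> [c phi psi sp sq|].
  rewrite /distr_of -Csummable_linear; [|exact: sfp|exact: sfp].
  by congr Cintegral; apply/funext => x; rewrite mulrDr mulrCA.
exists 0%N, (2 * vint F) => phi sp; have [s1 s2] := sfp _ sp.
rewrite /distr_of CintegralT; apply: le_trans (normc_le _) _ => /=.
have -> : 2 * vint F * schwartz_norm 0 phi =
    schwartz_norm 0 phi * vint F + schwartz_norm 0 phi * vint F by ring.
have sZ := vsummableZ (schwartz_norm 0 phi) sF.
rewrite -(vintZ _ sF); apply: lerD.
  by apply: (vint_norm_le s1 sZ) => x; exact: bRe.
by apply: (vint_norm_le s2 sZ) => x; exact: bIm.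
Qed.

End schwartz_parts.

(** * Cancellation of the chirps and assembly of the identity *)

Section chirp_parts.
Context (R : realType) (n : nat) (alpha : 'rV[R]_n).
Local Notation E := 'rV[R]_n.
Implicit Types (p q : E -> R) (x : E) (j : 'I_n).

(** The cotangent is odd, so the first factor is the conjugate of the second, which has modulus
    1. *)
Lemma chirpN_mul x : chirp (- alpha) x * chirp alpha x = 1.
Proof.
have -> : chirp (- alpha) x = cos (phase alpha x) +i* - sin (phase alpha x).
  rewrite -(cosN (phase alpha x)) -sinN; have -> : - phase alpha x = phase (- alpha) x; last by [].
  rewrite /phase -mulrN -sumrN; congr (_ * _); apply: eq_bigr => k _.
  by rewrite mxE /chirp_coef cosN sinN invrN mulrN !mulNr.
apply: eq_complexP; rewrite ?ReM ?ImM /=.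
  by rewrite mulNr opprK -!expr2 cos2Dsin2.
by rewrite mulNr [sin _ * _]mulrC subrr.
Qed.

Lemma chirp_mul x (a b : R) : chirp alpha x * (a +i* b) =
  (cos (phase alpha x) * a - sin (phase alpha x) * b) +i*
  (cos (phase alpha x) * b + sin (phase alpha x) * a).
Proof. by []. Qed.

Variable f : E -> R[i].
Hypothesis sf : schwartz f.

Let fr := @complex.Re R \o f.
Let fi := @complex.Im R \o f.
Let sfr : rschwartz fr. Proof. by case/schwartzP : sf. Qed.
Let sfi : rschwartz fi. Proof. by case/schwartzP : sf. Qed.

Definition chirped_re x : R := chirp_re alpha fr fi x.
(** The imaginary part of chirp times f is the real part of chirp times - i f, whose parts are [fi]
    and [- fr]; one lemma on [chirp_re] thus serves both parts. *)
Definition chirped_im x : R := chirp_re alpha fi (fun x => -1 * fr x) x.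

Let sNfr : rschwartz (fun x => -1 * fr x). Proof. exact: rschwartz_scale. Qed.

Lemma tame_chirped_re : tame chirped_re. Proof. exact: tame_chirp_re. Qed.
Lemma tame_chirped_im : tame chirped_im. Proof. exact: tame_chirp_re. Qed.

Lemma chirpedE x : chirp alpha x * f x = chirped_re x +i* chirped_im x.
Proof.
rewrite (_ : f x = fr x +i* fi x); last by rewrite /fr /fi /=; case: (f x).
by rewrite chirp_mul /chirped_re /chirped_im /chirp_re mulN1r mulrN opprK.
Qed.

Lemma partial_chirped j x : partial j (fun y => chirp alpha y * f y) x =
  pder j chirped_re x +i* pder j chirped_im x.
Proof. by under eq_fun do rewrite chirpedE. Qed.

Lemma chirp_partialE j x : chirp_partial alpha j f x =
  chirp_diffl alpha j fr fi x +i* chirp_diffr alpha j fr fi x.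
Proof.
rewrite /chirp_partial partial_chirped.
rewrite (pderE (fun y => is_derive_chirp_re alpha j y sfr sfi)).
rewrite (pderE (fun y => is_derive_chirp_re alpha j y sfi sNfr)).
rewrite -[RHS]mul1r -(chirpN_mul x) -mulrA chirp_mul; congr (_ * _).
have -> : chirp_diffl alpha j fi (fun x => -1 * fr x) = chirp_diffr alpha j fr fi.
  by apply/funext => y; rewrite /chirp_diffl /chirp_diffr; ring.
have -> : chirp_diffr alpha j fi (fun x => -1 * fr x) = fun y => - chirp_diffl alpha j fr fi y.
  apply/funext => y; rewrite /chirp_diffl /chirp_diffr.
  rewrite (_ : pder j _ y = - pder j fr y); first by rewrite opprB addrC.
  have := pders_scale [:: j] (-1) sfr.1; rewrite /= => ->.
  by rewrite mulN1r.
by rewrite /chirp_re mulrN opprK.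
Qed.

Lemma schwartz_chirp_partial j : schwartz (chirp_partial alpha j f).
Proof.
rewrite (_ : chirp_partial alpha j f = fun x =>
  chirp_diffl alpha j fr fi x +i* chirp_diffr alpha j fr fi x).
  apply/schwartzP; split; [exact: rschwartz_chirp_diffl|exact: rschwartz_chirp_diffr].
by apply/funext => x; exact: chirp_partialE.
Qed.

Lemma riesz_integrandE j x : riesz_integrand alpha j (chirp_partial alpha j f) x =
  fun y => (riesz_kernel j (x - y) * pder j chirped_re y) +i*
    (riesz_kernel j (x - y) * pder j chirped_im y).
Proof.
apply/funext => y; rewrite /riesz_integrand /chirp_partial partial_chirped -mulrA.
rewrite [chirp _ _ * _ * _]mulrAC chirpN_mul mul1r real_complexM.
by rewrite /riesz_kernel [in RHS]mxE [in RHS]mxE.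
Qed.

Hypothesis n1 : (1 < n)%N.
Let n0 : (0 < n)%N. Proof. exact: ltnW. Qed.

Let pv_re j x :
  complex.Re (pv_trunc x (riesz_integrand alpha j (chirp_partial alpha j f) x) eps) @[eps --> 0^'+] -->
  - (peak_const R / @riesz_const R n) * heat_time_integral chirped_re j x.
Proof.
rewrite riesz_integrandE.
exact: (riesz_pv n0 tame_chirped_re).
Qed.

Let pv_im j x :
  complex.Im (pv_trunc x (riesz_integrand alpha j (chirp_partial alpha j f) x) eps) @[eps --> 0^'+] -->
  - (peak_const R / @riesz_const R n) * heat_time_integral chirped_im j x.
Proof.
rewrite riesz_integrandE.
exact: (riesz_pv n0 tame_chirped_im).
Qed.

Lemma frac_riesz_chirp_exists j x : frac_riesz_exists alpha j (chirp_partial alpha j f) x.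
Proof.
split; [move=> eps e0|apply: cvgP; exact: pv_re|apply: cvgP; exact: pv_im].
rewrite riesz_integrandE.
by split; [exact: (riesz_trunc_summable j x tame_chirped_re e0)|
  exact: (riesz_trunc_summable j x tame_chirped_im e0)].
Qed.

Definition chirp_riesz_re j x : R := - peak_const R * heat_time_integral chirped_re j x.
Definition chirp_riesz_im j x : R := - peak_const R * heat_time_integral chirped_im j x.

Lemma frac_rieszE j x : frac_riesz alpha j (chirp_partial alpha j f) x =
  chirp (- alpha) x * (chirp_riesz_re j x +i* chirp_riesz_im j x).
Proof.
rewrite /frac_riesz /pv_integral (cvg_lim (@norm_hausdorff _ _) (pv_re (j := j) (x := x))).
rewrite (cvg_lim (@norm_hausdorff _ _) (pv_im (j := j) (x := x))).
rewrite [_%:C * _]mulrC -mulrA real_complexM; congr (_ * _).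
have rN0 := lt0r_neq0 (riesz_const_gt0 R n0).
by congr (_ +i* _); rewrite mulrA mulrN mulrCA mulfV// mulr1.
Qed.

Let pot_kernel x y : R := (enorm (x - y) `^ (n%:R - 1))^-1.

Lemma frac_potential_chirp (a b : E -> R) x :
  vsummable (fun y => pot_kernel x y * a y) -> vsummable (fun y => pot_kernel x y * b y) ->
  let g y := chirp (- alpha) y * (a y +i* b y) in
  frac_potential_exists alpha 1 g x /\
  frac_potential alpha 1 g x = chirp (- alpha) x *
    (((@riesz_gamma R n 1)^-1 * vint (fun y => pot_kernel x y * a y)) +i*
     ((@riesz_gamma R n 1)^-1 * vint (fun y => pot_kernel x y * b y))).
Proof.
move=> sa sb g.
have E1 : potential_integrand alpha 1 g x = fun y => (pot_kernel x y * a y) +i* (pot_kernel x y * b y).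
  apply/funext => y; rewrite /potential_integrand /g real_complexV.
  rewrite mulrAC [_ * chirp alpha y]mulrAC chirpN_mul mul1r mulrC.
  by rewrite real_complexM.
split; first by rewrite /frac_potential_exists E1; apply/CintegrableT; split.
rewrite /frac_potential E1 CintegralT [_%:C * _]mulrC -mulrA.
by rewrite real_complexM.
Qed.

Let heat_potential_summable h j x : tame h ->
  vsummable (fun y => pot_kernel x y * (- peak_const R * heat_time_integral h j y)).
Proof.
move=> th; have [s1 _] := potential_heat j x n1 th.
have := vsummableZ (- peak_const R) s1; congr vsummable; apply/funext => y.
by rewrite mulrCA.
Qed.

(** Each term equals - kap^2 pi times the weighted time integral of [heat j h], and these integrals
    add up to - 2 h x. As kap^2 = 1 / (2 pi), the constants cancel. *)
Lemma heat_representation h x : tame h ->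
  \sum_(j < n) (@riesz_gamma R n 1)^-1 *
    vint (fun y => pot_kernel x y * (- peak_const R * heat_time_integral h j y)) = h x.
Proof.
move=> th.
have Ej j : (@riesz_gamma R n 1)^-1 *
    vint (fun y => pot_kernel x y * (- peak_const R * heat_time_integral h j y)) =
    - (peak_const R ^+ 2 * pi) * \int[lebesgue_measure]_b (`|b| * heat j h b x).
  have [s1 E1] := potential_heat j x n1 th.
  under [X in vint X]eq_fun do rewrite mulrCA.
  rewrite (vintZ _ s1) mulrCA E1.
  by move: (peak_const R) (Rintegral _ _ _) => k J; ring.
under eq_bigr do rewrite Ej.
rewrite -mulr_sumr (heat_time_total x n1 th) peak_constX divff// powRN powRr1; last first.
  by rewrite mulr_ge0// pi_ge0.
have := lt0r_neq0 (pi_gt0 R); by move: (h x) (pi : R) => c p p0; field.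
Qed.

Lemma frac_potential_riesz j x :
  frac_potential_exists alpha 1 (frac_riesz alpha j (chirp_partial alpha j f)) x /\
  frac_potential alpha 1 (frac_riesz alpha j (chirp_partial alpha j f)) x =
  chirp (- alpha) x *
    (((@riesz_gamma R n 1)^-1 * vint (fun y => pot_kernel x y * chirp_riesz_re j y)) +i*
     ((@riesz_gamma R n 1)^-1 * vint (fun y => pot_kernel x y * chirp_riesz_im j y))).
Proof.
have -> : frac_riesz alpha j (chirp_partial alpha j f) = _ := funext (frac_rieszE j).
by apply: frac_potential_chirp; apply: heat_potential_summable;
  [exact: tame_chirped_re|exact: tame_chirped_im].
Qed.

Let chirpK x : chirp (- alpha) x * (chirped_re x +i* chirped_im x) = f x.
Proof. by rewrite -chirpedE mulrA chirpN_mul mul1r. Qed.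

Lemma sum_frac_potential_riesz x :
  \sum_(j < n) frac_potential alpha 1 (frac_riesz alpha j (chirp_partial alpha j f)) x = f x.
Proof.
under eq_bigr do rewrite (frac_potential_riesz _ _).2.
rewrite -mulr_sumr complex_sum -chirpK; congr (_ * (_ +i* _)).
  by apply: heat_representation; exact: tame_chirped_re.
by apply: heat_representation; exact: tame_chirped_im.
Qed.

Lemma frac_potential_sum_riesz x :
  let g y := \sum_(j < n) frac_riesz alpha j (chirp_partial alpha j f) y in
  frac_potential_exists alpha 1 g x /\ frac_potential alpha 1 g x = f x.
Proof.
move=> g.
have sum_pot h : tame h ->
    vsummable (fun y => pot_kernel x y * \sum_(j < n) - peak_const R * heat_time_integral h j y) /\
    (@riesz_gamma R n 1)^-1 *
    vint (fun y => pot_kernel x y * \sum_(j < n) - peak_const R * heat_time_integral h j y) = h x.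
  move=> th; have s1 j := heat_potential_summable j x th.
  under eq_fun do rewrite mulr_sumr; split; first exact: summable_sum.
  rewrite /vint Rintegral_sum// mulr_sumr; exact: heat_representation.
have [s1 E1] := sum_pot _ tame_chirped_re; have [s2 E2] := sum_pot _ tame_chirped_im.
have -> : g = fun y => chirp (- alpha) y *
    ((\sum_(j < n) chirp_riesz_re j y) +i* (\sum_(j < n) chirp_riesz_im j y)).
  apply/funext => y; rewrite /g -complex_sum mulr_sumr.
  by apply: eq_bigr => j _; exact: frac_rieszE.
have [ex ->] := frac_potential_chirp s1 s2; split => //.
by rewrite -[RHS]chirpK; congr (_ * (_ +i* _)); [exact: E1|exact: E2].
Qed.

End chirp_parts.

Theorem theorem2p14 (R : realType) (n : nat) (hn : (2 <= n)%N)
    (alpha : 'rV[R]_n)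
    (halpha : forall (k : 'I_n) (m : int), alpha ord0 k <> pi * m%:~R)
    (f : 'rV[R]_n -> R[i]) (hf : schwartz f) :
  let Rf (j : 'I_n) := frac_riesz alpha j (chirp_partial alpha j f) in
  let sumRf (x : 'rV[R]_n) := \sum_(j < n) Rf j x in
  let sumIRf (x : 'rV[R]_n) := \sum_(j < n) frac_potential alpha 1 (Rf j) x in
  (* all the operators are applied to functions in their domains *)
  [/\ forall j : 'I_n, schwartz (chirp_partial alpha j f),
      forall (j : 'I_n) x, frac_riesz_exists alpha j (chirp_partial alpha j f) x,
      forall x, frac_potential_exists alpha 1 sumRf x &
      forall (j : 'I_n) x, frac_potential_exists alpha 1 (Rf j) x] /\
  eq_tempered f (frac_potential alpha 1 sumRf) /\
  eq_tempered (frac_potential alpha 1 sumRf) sumIRf.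
Proof.
move=> Rf sumRf sumIRf; split; first split.
- by move=> j; exact: schwartz_chirp_partial.
- by move=> j x; exact: frac_riesz_chirp_exists.
- by move=> x; have [] := frac_potential_sum_riesz alpha hf hn x.
- by move=> j x; have [] := frac_potential_riesz alpha hf hn j x.
(* Both right-hand sides equal f at every point, so the equalities in S' reduce to f inducing a
   tempered distribution. *)
have -> : frac_potential alpha 1 sumRf = f.
  by apply/funext => x; have [] := frac_potential_sum_riesz alpha hf hn x.
have -> : sumIRf = f by apply/funext => x; exact: sum_frac_potential_riesz.
by have tf := schwartz_tempered hf; split; split.
Qed.
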